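(* Let $X_t=\mu t+\sigma W_t$ with $\mu\in\mathbb{R}$, $\sigma>0$, let $a>0$, and let $\tilde\tau_a^n$ be the $n$-th drawdown time with recovery. For all $n\in\mathbb{N}$ and $\lambda,x\ge 0$, $$\mathbb{E}\left[e^{-\lambda\tilde\tau_a^n};\,M_{\tilde\tau_a^n}>x\right]=\left(\frac{c_\lambda}{b_\lambda}\right)^n e^{-(n-1)\beta_\lambda^+a}\sum_{m=0}^{n-1}\frac{(b_\lambda x)^m}{m!}e^{-b_\lambda x}.$$
   Context: $X_t=\mu t+\sigma W_t$ ($X_0=0$) with $W$ a standard Brownian motion, $\mu\in\mathbb{R}$, $\sigma>0$; $M_t=\sup_{0\le s\le t}X_s$ is the running maximum; $a>0$ is fixed; $\mathbb{N}=\{1,2,\dots\}$; $\inf\emptyset=\infty$. The drawdown times with recovery are defined by $\tilde\tau_a^0=0$ and $$\tilde\tau_a^n=\inf\{t>\tilde\tau_a^{n-1}:\ M_t-X_t\ge a,\ M_t>M_{\tilde\tau_a^{n-1}}\},$$ with $\tilde\tau_a^n=\infty$ if $\tilde\tau_a^{n-1}=\infty$. Notation: $\mathbb{E}[Y;U]=\mathbb{E}[Y1_U]$; expectations are restricted to the event $\{\tilde\tau_a^n<\infty\}$ (i.e. $e^{-\lambda\cdot\infty}=0$, also for $\lambda=0$). Constants: $\beta_\lambda^{\pm}=\dfrac{-\mu\pm\sqrt{\mu^2+2\lambda\sigma^2}}{\sigma^2}$, $b_\lambda=\dfrac{\beta_\lambda^+e^{-\beta_\lambda^-a}-\beta_\lambda^-e^{-\beta_\lambda^+a}}{e^{-\beta_\lambda^-a}-e^{-\beta_\lambda^+a}}$,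 $c_\lambda=\dfrac{\beta_\lambda^+-\beta_\lambda^-}{e^{-\beta_\lambda^-a}-e^{-\beta_\lambda^+a}}$; for $\lambda=0$, $b_0,c_0$ are read as limits $\lambda\to0+$ (both equal $\gamma/(e^{\gamma a}-1)$ with $\gamma=2\mu/\sigma^2$, understood as $1/a$ when $\mu=0$). The factor $(b_\lambda x)^0$ is $1$ (also for $x=0$). *)

(* Defs.v *)
From HB Require Import structures.
From mathcomp Require Import all_boot all_order all_algebra.
From mathcomp Require Import all_classical all_reals all_analysis.

Set Implicit Arguments.
Unset Strict Implicit.
Unset Printing Implicit Defensive.

Import Order.TTheory GRing.Theory Num.Theory.
Import numFieldNormedType.Exports.

Local Open Scope classical_set_scope.
Local Open Scope ring_scope.

Section brownian_motion.
Context {d : measure_display} {T : measurableType d} {R : realType}.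
Variable P : probability T R.

(* Product rule over all of 'I_n; taking some [B i := setT] gives the rule for
   every subfamily. *)
Definition mutually_independent n (Y : 'I_n -> T -> R) : Prop :=
  forall B : 'I_n -> set R, (forall i, measurable (B i)) ->
    P (\bigcap_i (Y i @^-1` B i)) = (\prod_(i < n) P (Y i @^-1` B i))%E.

(* Time is [0, +oo[; the variables [W t] with [t < 0] are unconstrained and
   never used. The second parameter of [normal_prob] is the standard
   deviation. *)
Definition standard_brownian_motion (W : R -> {RV P >-> R}) : Prop :=
  [/\ forall w, W 0 w = 0,
      forall w, {within `[0, +oo[, continuous (fun t => W t w)},
      forall s t, 0 <= s -> s < t -> forall B : set R, measurable B ->
        pushforward P (W t \- W s) B
        = normal_prob 0 (Num.sqrt (t - s)) B
    & forall (n : nat) (t : nat -> R), 0 <= t 0%N ->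
        {homo t : i j / (i <= j)%N >-> i <= j} ->
        mutually_independent (fun (i : 'I_n) w => W (t i.+1) w - W (t i) w)].

End brownian_motion.

Section drawdown.
Context {T : Type} {R : realType}.
Implicit Types (X : R -> T -> R) (a t : R) (w : T).

Definition drifted (mu sigma : R) (W : R -> T -> R) : R -> T -> R :=
  fun t w => mu * t + sigma * W t w.

Definition running_max X t w : R := sup [set X s w | s in `[0, t]].

(* [ereal_inf set0 = +oo]; starting from 0, the value -oo does not occur. *)
Definition recovery_drawdown_step X a w (tau : \bar R) : \bar R :=
  if tau is r%:E then
    ereal_inf [set t%:E | t in
      [set t | [/\ r < t, a <= running_max X t w - X t w
                 & running_max X r w < running_max X t w]]]
  else +oo%E.

Definition recovery_drawdown X a (n : nat) w : \bar R :=
  iter n (recovery_drawdown_step X a w) 0%:E.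

(* Only meaningful where the n-th time is finite: [fine +oo = 0]. *)
Definition max_at_drawdown X a n w : R :=
  running_max X (fine (recovery_drawdown X a n w)) w.

End drawdown.

Section constants.
Context {R : realType}.
Implicit Types mu sigma a l : R.

Definition betap mu sigma l : R :=
  (- mu + Num.sqrt (mu ^+ 2 + 2 * l * sigma ^+ 2)) / sigma ^+ 2.

Definition betam mu sigma l : R :=
  (- mu - Num.sqrt (mu ^+ 2 + 2 * l * sigma ^+ 2)) / sigma ^+ 2.

Definition b_frac mu sigma a l : R :=
  (betap mu sigma l * expR (- betam mu sigma l * a)
   - betam mu sigma l * expR (- betap mu sigma l * a))
  / (expR (- betam mu sigma l * a) - expR (- betap mu sigma l * a)).

Definition c_frac mu sigma a l : R :=
  (betap mu sigma l - betam mu sigma l)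
  / (expR (- betam mu sigma l * a) - expR (- betap mu sigma l * a)).

(* At l = 0 the fractions are 0 / 0 if mu = 0, hence the limits. *)
Definition b_const mu sigma a l : R :=
  if l == 0 then lim (b_frac mu sigma a l' @[l' --> 0^'+])
  else b_frac mu sigma a l.

Definition c_const mu sigma a l : R :=
  if l == 0 then lim (c_frac mu sigma a l' @[l' --> 0^'+])
  else c_frac mu sigma a l.

End constants.

(* Main.v *)
(* Fix [l > 0].  A phase consists of a recovery up to the old maximum followed by a drawdown of
   size [a] below the new one.  With [bp], [bm] the exponents for which [exp(beta X_t - l t)] is a
   martingale, let the value function be, up to the discount [exp(-l t)],
   [exp(bp (X - m)) G(m)] while the process recovers to the old maximum [m], and afterwards the
   combination [fall M X] of [exp(bp (X - M))] and [exp(bm (X - M))] with [fall m m = G m] and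
   [fall m (m - a) = f m].  When [G' = b G - c f], the [M]-derivative of [fall] vanishes at
   [X = M], so an increase of [M] contributes only at second order.  Instead of stochastic integration we use a time grid: with
   the coefficients frozen at the grid points the increments are exact martingale differences of
   Brownian exponentials, and the total error is bounded by the modulus of continuity of the path
   times [M_t + 1].  Dominated convergence (the dominating function comes from a maximal
   inequality for exponentials) then gives, for one phase,
     [E(exp(-l tau_(k+1)) f(M_(tau_(k+1)))) = q E(exp(-l tau_k) G(M_(tau_k)))],
   where [q = exp(-bp a)], except [q = 1] for the first phase, which starts at the maximum.
   Tails of Gamma variables, [m |-> P(m + Y > x)], are stable under [f |-> G] up to the factor
   [c / b]: the shape parameter increases by one.  Hence the exponential tail can be carried down
   to time 0; differentiating in [x] replaces it by the indicator of [M > x], and [l = 0] is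
   obtained by letting [l] decrease to 0. *)

Require Import Defs.
From HB Require Import structures.
From mathcomp Require Import all_boot all_order all_algebra.
From mathcomp Require Import all_classical all_reals all_analysis.
From mathcomp Require Import measurable_realfun simple_functions.
From mathcomp Require Import normal_distribution random_variable.
From mathcomp Require Import ring lra zify.

Set Implicit Arguments.
Unset Strict Implicit.
Unset Printing Implicit Defensive.

Import Order.TTheory GRing.Theory Num.Theory.
Import numFieldNormedType.Exports.

Local Open Scope classical_set_scope.
Local Open Scope ring_scope.

(** * Independence of Brownian increments from the past *)

(** Probability enters only at deterministic times: no strong Markov property is invoked, only
    independence of one increment from the past. A drawdown time acts through the indicator that the
    phase is active at a grid point, an event of the past sigma-algebra at that point. Freezing
    coefficients on a grid cell needs [f] Lipschitz and [G] with a quadratic remainder in its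
    first-order expansion; the indicator of [M > x] is not admissible as terminal function, which is
    why exponential tails are carried through the recursion. Once value and slope of [fall m] on the
    diagonal are prescribed, [b] and [c] are exactly the constants that yield
    [fall m (m - a) = f m]. For [G] a tail of shape [j + 1], the equation [G' = b G - c f] forces
    [f] to be [b / c] times the tail of shape [j]: each phase therefore contributes one factor
    [c / b]. The switch from recovery to fall is matched only to first order, which is harmless
    since it happens at most once per phase. Positivity of [l] makes the discounted value vanish on
    paths where a phase never ends. *)

Section filtration.
Context {d : measure_display} {T : measurableType d} {R : realType}.
Variable P : probability T R.
Implicit Types (A E : set T) (G : set (set T)).

(** The maps [A |-> P (A]&[E)] and [A |-> P A * P E] are finite measures that agree on a pi-system
    containing the whole space, hence on the generated sigma-algebra. *)
Lemma independent_sigma G E : setI_closed G -> G setT -> G `<=` measurable ->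
  measurable E -> (forall A, G A -> P (A `&` E) = (P A * P E)%E) ->
  forall A, <<s G >> A -> P (A `&` E) = (P A * P E)%E.
Proof.
move=> GI GT Gm mE GE A sA.
have PEfin : P E \is a fin_num by exact: fin_num_measure.
have PE0 : 0 <= fine (P E) by apply: fine_ge0.
have -> : (P A * P E)%E = mscale (NngNum PE0) P A.
  by rewrite /mscale/= fineK// muleC.
have -> : P (A `&` E) = mrestr P mE A by [].
apply: (g_sigma_algebra_measure_unique G Gm (fun=> setT)) => //.
- by rewrite bigcup_const//; exists 0%N.
- by move=> B GB; apply: etrans (GE B GB) _; rewrite muleC -{1}(fineK PEfin).
- by move=> _; apply: fin_num_fun_lty; exact: fin_num_measure.
Qed.

(** Finite-dimensional cylinders up to time [t], a pi-system generating the natural filtration at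
    [t]. *)
Definition past_cylinder (W : R -> T -> R) (t : R) : set (set T) :=
  [set A | exists n (s : nat -> R) (B : nat -> set R),
    [/\ forall i, 0 <= s i <= t, forall i, measurable (B i)
      & A = \bigcap_(i < n) (W (s i) @^-1` B i)]].

Definition increment_rect (Y : nat -> T -> R) (n : nat) : set (set T) :=
  [set A | exists2 B : nat -> set R, forall i, measurable (B i)
    & A = \bigcap_(i < n) (Y i @^-1` B i)].

Lemma increment_rectI Y n : setI_closed (increment_rect Y n).
Proof.
move=> _ _ [B mB ->] [C mC ->]; exists (fun i => B i `&` C i).
  by move=> i; exact: measurableI.
by rewrite -bigcapI; apply: eq_bigcapr => i _; rewrite preimage_setI.
Qed.

Lemma past_cylinderI W t : setI_closed (past_cylinder W t).
Proof.
move=> _ _ [n [s [B [hs mB ->]]]] [m [s' [C [hs' mC ->]]]].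
exists (n + m)%N, (fun i => if (i < n)%N then s i else s' (i - n)%N),
  (fun i => if (i < n)%N then B i else C (i - n)%N); split.
- by move=> i; case: ifP.
- by move=> i; case: ifP.
apply/seteqP; split => w /=.
  move=> [h1 h2] i /= inm; case: ifP => [|/negbT]; first exact: h1.
  by rewrite -leqNgt => ni; apply: h2; rewrite /= ltn_subLR.
move=> h; split => i /= ilt.
  have := h i; rewrite ilt; apply; rewrite /=; exact: ltn_addr.
have := h (n + i)%N; rewrite /= ltn_add2l ilt => /(_ isT).
by rewrite ltnNge leq_addr/= addKn.
Qed.

Lemma measurable_increment_rect Y n :
  (forall i, measurable_fun setT (Y i)) -> increment_rect Y n `<=` measurable.
Proof.
move=> mY _ [B mB ->]; rewrite bigcap_mkord; apply: bigsetI_measurable => i _.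
by rewrite -[X in measurable X]setTI; exact: mY.
Qed.

Lemma increment_rectT Y n : increment_rect Y n setT.
Proof.
exists (fun=> setT) => //; apply/esym/seteqP; split => // w _ i _ //.
Qed.

Variable W : R -> {RV P >-> R}.
Hypothesis hW : standard_brownian_motion W.

Local Notation X := (fun t w => W t w).

Lemma increments_independent (t : nat -> R) n : 0 <= t 0%N ->
  {homo t : i j / (i <= j)%N >-> i <= j} ->
  let Y := fun i w => W (t i.+1) w - W (t i) w in
  forall A, <<s increment_rect Y n >> A -> forall B : set R, measurable B ->
  P (A `&` Y n @^-1` B) = (P A * P (Y n @^-1` B))%E.
Proof.
move=> t0 tm Y A sA B mB.
have mY i : measurable_fun setT (Y i) by exact: measurable_funB.
apply: (independent_sigma _ _ _ _ _ sA).
- exact: increment_rectI.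
- exact: increment_rectT.
- exact: measurable_increment_rect.
- by rewrite -[X in measurable X]setTI; exact: mY.
case: hW => _ _ _ hI; move=> _ [C mC ->].
have := hI n.+1 t t0 tm (fun i => if (i < n)%N then C i else B).
have -> : \bigcap_(i in [set: 'I_n.+1]) ((fun w => W (t i.+1) w - W (t i) w) @^-1`
   (if (i < n)%N then C i else B)) = \bigcap_(i < n) (Y i @^-1` C i) `&` Y n @^-1` B.
  apply/seteqP; split => w /=.
    move=> h; split => [i /= ilt|].
      by have := h (widen_ord (leqnSn n) (Ordinal ilt)) I; rewrite /= ilt.
    by have := h ord_max I; rewrite /= ltnn.
  move=> [h1 h2] i _ /=; case: ifP => [|/negbT]; first exact: h1.
  by rewrite -leqNgt => ni; have -> : i = n :> nat by apply/eqP; rewrite eqn_leq ni -ltnS ltn_ord.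
move=> ->; last by move=> i; case: ifP.
rewrite big_ord_recr/= ltnn; congr (_ * _)%E.
have := hI n t t0 tm (fun i => C i).
have -> : \bigcap_(i in [set: 'I_n]) ((fun w => W (t i.+1) w - W (t i) w) @^-1`
   (C i)) = \bigcap_(i < n) (Y i @^-1` C i).
  apply/seteqP; split => w /=.
    by move=> h i /= ilt; exact: (h (Ordinal ilt)).
  by move=> h i _ /=; exact: (h (nat_of_ord i) (ltn_ord i)).
move=> ->; last by move=> i; exact: mC.
by apply: eq_bigr => i _; rewrite ltn_ord.
Qed.

(** It suffices to treat cylinders, and each of them belongs to the sigma-algebra of finitely many
    successive increments up to [s]. *)
Lemma past_independent (s t : R) A (B : set R) : 0 <= s -> s < t ->
  <<s past_cylinder X s >> A -> measurable B ->
  P (A `&` [set w | B (W t w - W s w : R)%R]) = (P A * P [set w | B (W t w - W s w : R)%R])%E.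
Proof.
move=> s0 st sA mB.
have mE : measurable [set w | B (W t w - W s w : R)%R].
  rewrite -[X in measurable X]setTI.
  have : measurable_fun setT (fun w => W t w - W s w) by exact: measurable_funB.
  by move=> /(_ measurableT B mB).
apply: (independent_sigma _ _ _ _ _ sA) => //.
- exact: past_cylinderI.
- exists 0%N, (fun=> s), (fun=> setT); split => //; first by rewrite s0 lexx.
  by apply/seteqP; split => // w _ i.
- move=> _ [n [u [C [hu mC ->]]]]; rewrite bigcap_mkord.
  apply: bigsetI_measurable => i _.
  by rewrite -[X in measurable X]setTI; apply: (measurable_funPT (W (u i))).
move=> _ [n [u [C [hu mC ->]]]].
(* With 0 and [s] added to the times, every [W (u i)] is a partial sum of increments along the
   sorted list, since [W 0 = 0]. The default value [t] of [nth] supplies the last increment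
   [W t - W s]. *)
pose L := sort <=%R (0 :: rcons (mkseq u n) s).
have sL : size L = n.+2 by rewrite size_sort/= size_rcons size_mkseq.
have Ls : sorted <=%R L by apply: sort_sorted; exact: le_total.
have Lrange r : r \in L -> 0 <= r <= s.
  rewrite mem_sort inE mem_rcons inE => /orP[/eqP->|/orP[/eqP->|/mapP[i _ ->]]] //.
  - by rewrite lexx.
  - by rewrite s0 lexx.
pose tt i := nth t L i.
have tm : {homo tt : i j / (i <= j)%N >-> i <= j}.
  move=> i j ij; rewrite /tt.
  have [jL|jL] := ltnP j (size L); last first.
    rewrite (nth_default _ jL); have [iL|iL] := ltnP i (size L); last first.
      by rewrite nth_default.
    by have /Lrange/andP[_ h] := mem_nth t iL; apply: (le_trans h); exact: ltW.
  apply: (sorted_leq_nth le_trans) => //; rewrite inE //; exact: (leq_ltn_trans ij).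
have [k kL k0] : exists2 k, (k < n.+2)%N & tt k = s.
  exists (index s L); last by rewrite /tt nth_index// mem_sort inE mem_rcons inE eqxx orbT.
  by rewrite -sL index_mem mem_sort inE mem_rcons inE eqxx orbT.
have tt0 : tt 0%N = 0.
  have : 0 \in L by rewrite mem_sort inE eqxx.
  move=> /(nthP t)[j jL jE]; apply/eqP; rewrite eq_le.
  have /Lrange/andP[-> _] : tt 0%N \in L by apply: mem_nth; rewrite sL.
  by rewrite andbT -[leRHS]jE; exact: tm.
have ttl : tt n.+1 = s.
  apply/eqP; rewrite eq_le; apply/andP; split.
    have /Lrange/andP[_] // : tt n.+1 \in L by apply: mem_nth; rewrite sL.
  by rewrite -{1}k0; apply: tm; rewrite -ltnS.
have ttt : tt n.+2 = t by rewrite /tt nth_default// sL.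
pose Y i w := W (tt i.+1) w - W (tt i) w.
have -> : [set w | B (W t w - W s w : R)%R] = Y n.+1 @^-1` B.
  by apply/seteqP; split => w /=; rewrite /Y ttl ttt.
apply: (@increments_independent tt n.+1 _ tm) => //; first by rewrite tt0.
pose G := increment_rect Y n.+1.
have mY i : (i < n.+1)%N -> @measurable_fun _ _ (g_sigma_algebraType G) R setT (Y i).
  move=> iln _ D mD; rewrite setTI; apply: sub_sigma_algebra.
  exists (fun j => if j == i then D else setT); first by move=> j; case: ifP.
  apply/seteqP; split => w /=; first by move=> h j _ /=; case: ifP => [/eqP->|].
  by move=> /(_ i iln) /=; rewrite eqxx.
have mW j : (j <= n.+1)%N -> @measurable_fun _ _ (g_sigma_algebraType G) R setT (fun w => W (tt j) w).
  elim: j => [_|j IH jn].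
    under eq_fun do rewrite tt0; case: hW => W0 _ _ _.
    by under eq_fun do rewrite W0; exact: measurable_cst.
  have -> : (fun w => W (tt j.+1) w) = (fun w => W (tt j) w + Y j w).
    by apply/funext => w; rewrite /Y addrC subrK.
  by apply: measurable_funD; [apply: IH; exact: ltnW|exact: mY].
suff : @measurable _ (g_sigma_algebraType G) (\bigcap_(i < n) (X (u i) @^-1` C i)) by [].
rewrite bigcap_mkord; apply: bigsetI_measurable => i _.
have uL : u i \in L.
  rewrite mem_sort inE mem_rcons inE; apply/orP; right; apply/orP; right.
  by apply/mapP; exists (val i) => //; rewrite mem_iota/= add0n.
have := mW (index (u i) L); rewrite -ltnS -sL index_mem => /(_ uL).
rewrite /tt nth_index// => /(_ measurableT (C i) (mC i)).
by rewrite setTI.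
Qed.

End filtration.

(** * Integration against a density and exponential moments of the normal law *)

Section density.
Local Open Scope ereal_scope.
Context {d} {T : measurableType d} {R : realType}.
Variables (mu nu : {measure set T -> \bar R}) (p : T -> R).
Hypothesis mp : measurable_fun setT p.
Hypothesis p0 : forall x, (0 <= p x)%R.
Hypothesis nuE : forall A, measurable A -> nu A = \int[mu]_(x in A) (p x)%:E.

Import HBNNSimple.

Let integral_density_indic A : measurable A ->
  \int[nu]_x (\1_A x)%:E = \int[mu]_x ((\1_A x)%:E * (p x)%:E).
Proof.
move=> mA; rewrite integral_indic// setIT nuE// integral_mkcond.
apply: eq_integral => x _; rewrite patchE indicE.
by case: ifPn; rewrite ?mul1e ?mul0e.
Qed.

Let integral_density_nnsfun (h : {nnsfun T >-> R}) :
  \int[nu]_x (h x)%:E = \int[mu]_x ((h x)%:E * (p x)%:E).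
Proof.
under [LHS]eq_integral do rewrite fimfunE -fsumEFin//.
rewrite [LHS]ge0_integral_fsum//; last 2 first.
  - by move=> r; exact/measurable_EFinP/measurableT_comp.
  - by move=> n x _; rewrite EFinM nnfun_muleindic_ge0.
under [RHS]eq_integral.
  move=> x _; rewrite fimfunE -fsumEFin// ge0_mule_fsuml; last first.
    by move=> r; rewrite EFinM nnfun_muleindic_ge0.
  over.
rewrite [RHS]ge0_integral_fsum//; last 2 first.
  - move=> r; apply: emeasurable_funM; last exact/measurable_EFinP.
    by apply/measurable_EFinP; do 2 apply/measurableT_comp => //.
  - by move=> n x _; apply: mule_ge0; rewrite ?lee_fin// -lee_fin EFinM nnfun_muleindic_ge0.
apply: eq_fsbigr => r _.
have [r0|r0] := ltP r 0%R.
  rewrite preimage_nnfun0//; under eq_integral do rewrite indic0 mulr0.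
  by rewrite integral0; under eq_integral do rewrite indic0 mulr0 mul0e; rewrite integral0.
under eq_integral do rewrite EFinM.
under [RHS]eq_integral do rewrite EFinM -muleA.
rewrite !ge0_integralZl//.
- by rewrite integral_density_indic.
- by apply: emeasurable_funM; last exact/measurable_EFinP; apply/measurable_EFinP/measurable_indic.
- by move=> x _; rewrite mule_ge0// lee_fin.
- by apply/measurable_EFinP/measurable_indic.
Qed.

Lemma ge0_integral_density (f : T -> \bar R) : measurable_fun setT f ->
  (forall x, 0 <= f x) -> \int[nu]_x f x = \int[mu]_x (f x * (p x)%:E).
Proof.
move=> mf f0; pose f_ := nnsfun_approx measurableT mf.
transitivity (limn (fun n => \int[nu]_x (f_ n x)%:E)).
  rewrite -monotone_convergence//=.
  - apply: eq_integral => x /[!inE] xD; apply/esym/cvg_lim => //=.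
    exact: cvg_nnsfun_approx.
  - by move=> n; apply: measurableT_comp.
  - by move=> n x _; rewrite lee_fin.
  - by move=> x _ a b ab; rewrite lee_fin//; exact/lefP/nd_nnsfun_approx.
transitivity (limn (fun n => \int[mu]_x ((f_ n x)%:E * (p x)%:E))).
  by congr (limn _); apply/funext => n; rewrite integral_density_nnsfun.
rewrite -monotone_convergence//=.
- apply: eq_integral => x _; apply/cvg_lim => //=.
  by apply: cvgeZr => //; exact: cvg_nnsfun_approx.
- by move=> n; apply: emeasurable_funM; last exact/measurable_EFinP; apply: measurableT_comp.
- by move=> n x _; rewrite mule_ge0// lee_fin.
- by move=> x _ a b ab; rewrite lee_wpmul2r// lee_fin//; exact/lefP/nd_nnsfun_approx.
Qed.

End density.

Lemma normal_exp_moment {R : realType} (s th : R) : 0 < s ->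
  (\int[normal_prob 0 s]_y (expR (th * y))%:E = (expR (th ^+ 2 * s ^+ 2 / 2))%:E)%E.
Proof.
move=> s0; have sn0 : s != 0 by rewrite gt_eqF.
have mE : measurable_fun [set: measurableTypeR R] (fun y : R => (expR (th * y))%:E).
  apply/measurable_EFinP; apply: measurableT_comp => //; exact: measurable_funM.
rewrite (@ge0_integral_density _ _ _ (@lebesgue_measure R) _ (normal_pdf 0 s)) //.
- under eq_integral => y _.
    (* Completing the square: the tilted density is a constant times the normal density with mean
       [th * s ^+ 2]. *)
    rewrite -EFinM (_ : expR _ * _ = expR (th ^+ 2 * s ^+ 2 / 2) * normal_pdf (th * s ^+ 2) s y)%R; last first.
      rewrite !normal_pdfE//. rewrite /normal_fun mulrCA [RHS]mulrCA -!expRD; congr (_ * expR _).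
      by field.
    rewrite EFinM; over.
  rewrite ge0_integralZl//; first by rewrite integral_normal_pdf mule1.
    by apply/measurable_EFinP; exact: measurable_normal_pdf.
  by move=> x _; rewrite lee_fin normal_pdf_ge0.
- exact: measurable_normal_pdf.
- by move=> x; exact: normal_pdf_ge0.
Qed.

(** * Exponential martingale differences *)

Definition past_measurable {d} {T : measurableType d} {R : realType} (W : R -> T -> R) (t : R) (f : T -> R) :=
  @measurable_fun _ _ (g_sigma_algebraType (past_cylinder W t)) R setT f.

Section past.
Context {d : measure_display} {T : measurableType d} {R : realType}.
Variable P : probability T R.

Lemma past_cylinder_mono (X : R -> T -> R) s t :
  s <= t -> past_cylinder X s `<=` past_cylinder X t.
Proof.
move=> st _ [n [u [B [hu mB ->]]]]; exists n, u, B; split => // i.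
by have /andP[-> h] := hu i; exact: le_trans h st.
Qed.

Lemma past_set_mono (X : R -> T -> R) s t A :
  s <= t -> <<s past_cylinder X s >> A -> <<s past_cylinder X t >> A.
Proof.
move=> st; apply: smallest_sub; first exact: smallest_sigma_algebra.
by move=> B /(past_cylinder_mono st); exact: sub_sigma_algebra.
Qed.

Lemma past_measurable_path (X : R -> T -> R) s t :
  0 <= s <= t -> past_measurable X t (X s).
Proof.
move=> st _ B mB; rewrite setTI; apply: sub_sigma_algebra.
exists 1%N, (fun=> s), (fun=> B); split => //.
apply/seteqP; split => w /=; first by move=> h i.
by move=> /(_ 0%N isT).
Qed.

Variable W : R -> {RV P >-> R}.
Local Notation X := (fun t w => W t w).

Lemma past_set_measurable t A : <<s past_cylinder X t >> A -> measurable A.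
Proof.
apply: smallest_sub; first exact: sigma_algebra_measurable.
move=> _ [n [u [C [hu mC ->]]]]; rewrite bigcap_mkord.
apply: bigsetI_measurable => i _.
by rewrite -[X in measurable X]setTI; apply: (measurable_funPT (W (u i))).
Qed.

Lemma past_measurableW t f : past_measurable X t f -> measurable_fun setT f.
Proof. by move=> mf _ B mB; apply: (@past_set_measurable t); exact: mf. Qed.

Hypothesis hW : standard_brownian_motion W.

(** The joint law of [xi] and the increment is a product measure, as [past_independent] gives the
    product rule on rectangles; Tonelli then separates the integrals. *)
Lemma past_expectationM (s t : R) (xi : T -> R) (h : R -> R) :
  0 <= s -> s < t -> past_measurable X s xi -> (forall w, 0 <= xi w) ->
  measurable_fun setT h -> (forall y, 0 <= h y) ->
  (\int[P]_w (xi w * h (W t w - W s w : R)%R)%:E =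
   \int[P]_w (xi w)%:E * \int[P]_w (h (W t w - W s w : R)%R)%:E)%E.
Proof.
move=> s0 st mxi xi0 mh h0.
have mxi' := past_measurableW mxi.
have mY : measurable_fun setT (fun w => (W t w - W s w : R)) by exact: measurable_funB.
pose Xi : {RV P >-> R} := mfun_Sub (mem_set mxi').
pose Y : {RV P >-> R} := mfun_Sub (mem_set mY).
have mXY : measurable_fun setT (fun w => (Xi w, Y w)) by exact: measurable_fun_pair.
pose XY : {RV P >-> (R * R)%type} := mfun_Sub (mem_set mXY).
pose F (z : R * R) : \bar R := (z.1 * h z.2)%:E.
have mF : measurable_fun setT F.
  apply/measurable_EFinP; apply: measurable_funM; first exact: measurable_fst.
  by apply: measurableT_comp => //; exact: measurable_snd.
(* [F] may be negative off the range of [xi] *)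
pose F' (z : R * R) : \bar R := (`|z.1| * h z.2)%:E.
have mF' : measurable_fun setT F'.
  apply/measurable_EFinP; apply: measurable_funM.
    by apply: measurableT_comp => //; exact: measurable_fst.
  by apply: measurableT_comp => //; exact: measurable_snd.
have F'0 z : (0 <= F' z)%E by rewrite lee_fin mulr_ge0.
transitivity (\int[P]_w (F' \o XY) w)%E.
  by apply: eq_integral => w _; rewrite /F'/= ger0_norm.
rewrite -ge0_integral_distribution//.
rewrite (eq_measure_integral (distribution P Xi \x distribution P Y)%E); last first.
  move=> A mA _; apply/esym/product_measure_unique => // A1 B mA1 mB.
  rewrite /distribution /pushforward/=.
  have := @past_independent _ _ _ P W hW s t (xi @^-1` A1) B s0 st.
  rewrite -[X in <<s _ >> X]setTI => /(_ (mxi measurableT A1 mA1) mB) <-//.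
rewrite fubini_tonelli1//= /fubini_F/=.
transitivity (\int[distribution P Xi]_x (`|x|%:E * \int[distribution P Y]_y (h y)%:E))%E.
  apply: eq_integral => x _; rewrite -ge0_integralZl//.
    exact/measurable_EFinP.
  by move=> y _; rewrite lee_fin.
rewrite ge0_integralZr//.
- rewrite (ge0_integral_distribution Xi)//; last exact/measurable_EFinP.
  rewrite (ge0_integral_distribution Y)//; last exact/measurable_EFinP.
  congr (_ * _)%E; apply: eq_integral => w _ /=; by rewrite ger0_norm.
- exact/measurable_EFinP.
- by apply: integral_ge0 => y _; rewrite lee_fin.
Qed.

Lemma increment_exp_moment (s t th : R) : 0 <= s -> s < t ->
  (\int[P]_w (expR (th * (W t w - W s w : R)%R))%:E = (expR (th ^+ 2 * (t - s) / 2))%:E)%E.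
Proof.
move=> s0 st; case: hW => _ _ hN _.
have ts : 0 < t - s by rewrite subr_gt0.
have mY : measurable_fun setT (W t \- W s) by exact: measurable_funB.
have := @normal_exp_moment R (Num.sqrt (t - s)) th.
rewrite sqrtr_gt0 sqr_sqrtr ?ltW// => /(_ ts) <-.
have mE : measurable_fun [set: R] (fun y : R => (expR (th * y))%:E).
  apply/measurable_EFinP; apply: measurableT_comp => //; exact: measurable_funM.
pose Y : {RV P >-> R} := mfun_Sub (mem_set mY).
(* The identity transports the integral from [measurableTypeR R], the space of the normal law, to
   [R] as used for the law of the increment. *)
pose idR : measurableTypeR R -> R := idfun.
have midR : measurable_fun setT idR by move=> _ A mA; rewrite setTI; exact: mA.
rewrite -[RHS](@ge0_integral_pushforward _ _ _ _ _ idR midR _ setT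
  (fun y : R => (expR (th * y))%:E)) //.
rewrite [RHS](eq_measure_integral (distribution P Y)) //; last first.
  by move=> A mA _; apply/esym; exact: hN.
by rewrite (ge0_integral_distribution Y).
Qed.

Lemma exp_martingale (s t th C : R) (xi : T -> R) : 0 <= s -> s < t ->
  past_measurable X s xi -> (forall w, `|xi w| <= C) ->
  let D := fun w => xi w * (expR (th * (W t w - W s w : R) - th ^+ 2 * (t - s) / 2) - 1) in
  P.-integrable setT (EFin \o D) /\ (\int[P]_w (D w)%:E = 0)%E.
Proof.
move=> s0 st mxi xiC D.
set kap := th ^+ 2 * (t - s) / 2.
pose h y : R := expR (th * y - kap).
have mh : measurable_fun setT h.
  apply: measurableT_comp => //; apply: measurable_funB => //; exact: measurable_funM.
have h0 y : 0 <= h y by exact: expR_ge0.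
have mY : measurable_fun setT (fun w => (W t w - W s w : R)) by exact: measurable_funB.
have Eh : (\int[P]_w (h (W t w - W s w : R)%R)%:E = 1)%E.
  under eq_integral => w _ do rewrite /h expRD EFinM.
  rewrite ge0_integralZr// ?lee_fin ?expR_ge0//.
  - by rewrite increment_exp_moment// -EFinM -expRD subrr expR0.
  - by apply/measurable_EFinP; apply: measurableT_comp => //; exact: measurable_funM.
have mhY : measurable_fun setT (fun w => h (W t w - W s w : R)).
  exact: measurableT_comp.
have Ih : P.-integrable setT (fun w => (h (W t w - W s w : R)%R)%:E).
  apply/integrableP; split; first exact/measurable_EFinP.
  by under eq_integral do rewrite gee0_abs ?lee_fin//; rewrite Eh ltry.
have mxi' := past_measurableW mxi.
have C0 : 0 <= C by exact: le_trans (normr_ge0 _) (xiC point).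
have Ixi : P.-integrable setT (EFin \o xi).
  apply: (le_integrable measurableT (g := cst C%:E)) => //.
  - exact/measurable_EFinP.
  - by move=> w _ /=; rewrite lee_fin (ger0_norm C0).
  - exact: finite_measure_integrable_cst.
have Ixih : P.-integrable setT (fun w => (xi w * h (W t w - W s w : R)%R)%:E).
  apply: (le_integrable measurableT (g := fun w => (C * h (W t w - W s w : R)%R)%:E)) => //.
  - by apply/measurable_EFinP; exact: measurable_funM.
  - move=> w _ /=; rewrite lee_fin !normrM (ger0_norm (h0 _)) (ger0_norm C0).
    by rewrite ler_wpM2r.
  - exact: (integrableZl measurableT C Ih).
have DE w : (D w)%:E = ((xi w * h (W t w - W s w : R)%R)%:E - (xi w)%:E)%E.
  by rewrite /D -EFinB mulrBr mulr1.
split.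
  have -> : EFin \o D = (fun w => ((xi w * h (W t w - W s w : R)%R)%:E - (xi w)%:E)%E) by apply/funext => w; exact: DE.
  exact: (integrableB measurableT Ixih Ixi).
under eq_integral do rewrite DE.
rewrite integralB//.
(* The product rule asks for a nonnegative factor, so [xi] is shifted by its bound [C]; the shift
   cancels because the exponential factor has mean 1. *)
have E1 : (\int[P]_w ((xi w + C) * h (W t w - W s w : R)%R)%:E = \int[P]_w (xi w + C)%:E)%E.
  rewrite (past_expectationM s0 st) ?Eh ?mule1//.
    exact: measurable_funD.
  by move=> w; have := xiC w; rewrite ler_norml => /andP[]; lra.
have L1 : (\int[P]_w ((xi w + C) * h (W t w - W s w : R)%R)%:E =
    \int[P]_w (xi w * h (W t w - W s w : R)%R)%:E + C%:E)%E.
  under eq_integral do rewrite mulrDl EFinD.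
  rewrite integralD//; last exact: (integrableZl measurableT C Ih).
  by under [X in (_ + X)%E]eq_integral do rewrite EFinM; rewrite integralZl// Eh mule1.
have L2 : (\int[P]_w (xi w + C)%:E = \int[P]_w (xi w)%:E + C%:E)%E.
  under eq_integral do rewrite EFinD.
  rewrite integralD//; last exact: finite_measure_integrable_cst.
  have -> : (\int[P]_w (C%:E : \bar R) = C%:E)%E.
    by rewrite integral_cst//= probability_setT mule1.
  by [].
move: E1; rewrite L1 L2.
have F1 := integrable_fin_num measurableT Ixi.
have F2 := integrable_fin_num measurableT Ixih.
move=> /= E1.
have -> : (\int[P]_x (xi x * h (W t x - W s x))%:E = \int[P]_x (xi x)%:E)%E.
  by move: E1 F1 F2; case: integral => //= r; case: integral => //= r' [] /addIr ->.
by rewrite subee.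
Qed.

End past.

(** * Continuous paths and their drawdown times *)

(** Continuity on the half-line only: values at negative times are unconstrained, and at 0 the
    condition is one-sided. *)
Definition path_continuous {R : realType} (x : R -> R) := forall t e : R, 0 <= t -> 0 < e ->
  exists2 delta : R, 0 < delta &
    forall u : R, 0 <= u -> `|u - t| < delta -> `|x u - x t| < e.

Section path_continuity.
Context {R : realType}.
Implicit Types (x y : R -> R) (s t u v e : R).

Lemma within_path_continuous x :
  {within `[0, +oo[, continuous x} -> path_continuous x.
Proof.
move=> /subspace_continuousP cx t e t0 e0.
have tA : `[0, +oo[%classic t by rewrite /= in_itv/= t0.
have /cvgrPdist_lt/(_ e e0) := cx t tA.
rewrite near_withinE => /nbhs_ballP[delta /= d0 hd].
exists delta => // u u0 ut; rewrite distrC; apply: hd => /=.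
  by rewrite /ball/= distrC.
by rewrite in_itv/= u0.
Qed.

(** Freezing the path on the negative half-line gives a function continuous on all of [R], ready for
    the extreme value theorem. *)
Lemma path_continuous_clamp x : path_continuous x ->
  continuous (fun t => x (Num.max 0 t)).
Proof.
move=> cx t; apply/cvgrPdist_lt => e e0.
have t0 : 0 <= Num.max 0 t by rewrite le_max lexx.
have [delta d0 hd] := cx _ e t0 e0.
near=> u; rewrite distrC; apply: hd; first by rewrite le_max lexx.
have : `|u - t| < delta.
  by near: u; exists delta => //= z /=; rewrite distrC.
apply: le_lt_trans.
have := ler_norm (u - t); have := ler_norm (- (u - t)); rewrite normrN.
by rewrite ler_norml /Num.max; case: (ltP 0 u) => ?; case: (ltP 0 t) => ?; lra.
Unshelve. all: by end_near. Qed.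

Lemma path_EVT_max x t : path_continuous x -> 0 <= t ->
  exists2 s, 0 <= s <= t & forall u, 0 <= u <= t -> x u <= x s.
Proof.
move=> cx t0; pose y := fun t => x (Num.max 0 t).
have cy : {within `[0, t], continuous y}.
  by apply: continuous_subspaceT; exact: path_continuous_clamp.
have [s] := EVT_max t0 cy; rewrite in_itv/= => st hs; exists s => // u ut.
have := hs u; rewrite in_itv/= => /(_ ut).
by rewrite /y !max_r//; [case/andP: st|case/andP: ut].
Qed.

(** Heine-Cantor from compactness of the segment: the covering property is applied to the filter of
    radii decreasing to 0. *)
Lemma path_Heine x t e : path_continuous x -> 0 < e ->
  exists2 delta : R, 0 < delta & forall u v : R, 0 <= u <= t -> 0 <= v <= t ->
    `|u - v| < delta -> `|x u - x v| < e.
Proof.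
move=> cx e0.
have /compact_near_coveringP := @segment_compact _ 0 t.
move=> /(_ R (0%R : R)^'+ (fun delta u => 0 <= u <= t -> forall v, 0 <= v <= t ->
  `|u - v| < delta -> `|x u - x v| < e)).
case.
  move=> u /=; rewrite in_itv/= => /andP[u0 ut].
  have [delta d0 hd] := cx u (e / 2) u0 (divr_gt0 e0 (ltr0n _ 2)).
  exists (ball u (delta / 2), [set r | r < delta / 2]) => /=.
    split; first by apply: nbhsx_ballx; rewrite divr_gt0.
    exact: nbhs_right_lt (divr_gt0 d0 _).
  move=> [v r] /= [uv rd] /andP[v0 vt] z /andP[z0 zt] vz.
  have h1 : `|x v - x u| < e / 2.
    apply: hd => //; move: uv; rewrite /ball/= distrC => /lt_trans; apply; lra.
  have h2 : `|x z - x u| < e / 2.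
    apply: hd => //; have -> : z - u = (z - v) + (v - u) by lra.
    apply: le_lt_trans (ler_normD _ _) _.
    by move: uv; rewrite /ball/= (distrC u) (distrC z); lra.
  have -> : x v - x z = (x v - x u) + (x u - x z) by lra.
  by apply: le_lt_trans (ler_normD _ _) _; rewrite (distrC _ (x z)); lra.
move=> r /= r0 hr; exists (r / 2); first by rewrite divr_gt0.
move=> u v ut; apply: (hr (r / 2)) => //=.
- by rewrite sub0r normrN gtr0_norm ?divr_gt0//; lra.
- by rewrite divr_gt0.
Qed.

Lemma path_continuousD x y : path_continuous x -> path_continuous y ->
  path_continuous (fun t => x t + y t).
Proof.
move=> cx cy t e t0 e0; have e20 : 0 < e / 2 by rewrite divr_gt0.
have [d1 d10 h1] := cx t _ t0 e20; have [d2 d20 h2] := cy t _ t0 e20.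
exists (Num.min d1 d2); first by rewrite lt_min d10.
move=> u u0; rewrite lt_min => /andP[/(h1 _ u0) H1 /(h2 _ u0) H2].
have -> : x u + y u - (x t + y t) = (x u - x t) + (y u - y t) by lra.
by apply: le_lt_trans (ler_normD _ _) _; lra.
Qed.

Lemma path_continuous_cst c : path_continuous (fun=> c : R).
Proof. by move=> t e t0 e0; exists 1 => // u _ _; rewrite subrr normr0. Qed.

Lemma path_continuousZ x k : path_continuous x -> path_continuous (fun t => k * x t).
Proof.
move=> cx t e t0 e0; have k0 : 0 < `|k| + 1 by rewrite ltr_wpDl.
have [d d0 h] := cx t (e / (`|k| + 1)) t0 (divr_gt0 e0 k0).
exists d => // u u0 /(h _ u0); rewrite ltr_pdivlMr// => H.
rewrite -mulrBr normrM; apply: le_lt_trans H; rewrite mulrC ler_wpM2l//; lra.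
Qed.

Lemma path_continuous_id : path_continuous (fun t => t : R).
Proof. by move=> t e t0 e0; exists e. Qed.

Lemma path_continuous_min x y : path_continuous x -> path_continuous y ->
  path_continuous (fun t => Num.min (x t) (y t)).
Proof.
move=> cx cy t e t0 e0.
have [d1 d10 h1] := cx t _ t0 e0; have [d2 d20 h2] := cy t _ t0 e0.
exists (Num.min d1 d2); first by rewrite lt_min d10.
move=> u u0; rewrite lt_min => /andP[/(h1 _ u0) H1 /(h2 _ u0) H2].
move: H1 H2; rewrite !ltr_norml /Num.min.
move=> /andP[? ?] /andP[? ?].
by case: (ltP (x u) (y u)) => ?; case: (ltP (x t) (y t)) => ?; apply/andP; split; lra.
Qed.

End path_continuity.

Section running_max_path.
Context {T : Type} {R : realType} (X : R -> T -> R) (w : T).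
Hypothesis cX : path_continuous (X ^~ w).
Implicit Types (s t u v e : R).
Local Notation x := (X ^~ w).
Local Notation M t := (running_max X t w).

Lemma running_max_attained t : 0 <= t ->
  exists2 s, 0 <= s <= t & M t = X s w.
Proof.
move=> t0; have [s st hs] := path_EVT_max cX t0; exists s => //.
apply/eqP; rewrite eq_le; apply/andP; split.
  apply: ge_sup; first by exists (X s w), s => //=; rewrite in_itv.
  by move=> y [u /=]; rewrite in_itv/= => /hs hu <-.
apply: ub_le_sup; last by exists s => //=; rewrite in_itv.
by exists (X s w) => y [u /=]; rewrite in_itv/= => /hs hu <-.
Qed.

Lemma le_running_max t u : 0 <= u <= t -> X u w <= M t.
Proof.
move=> /andP[u0 ut]; have t0 := le_trans u0 ut.
have [s st hs] := path_EVT_max cX t0.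
apply: ub_le_sup; last by exists u => //=; rewrite in_itv/= u0.
by exists (X s w) => y [v /=]; rewrite in_itv/= => /hs hu <-.
Qed.

Lemma running_max_mono s t : 0 <= s -> s <= t -> M s <= M t.
Proof.
move=> s0 st; have [u /andP[u0 us] ->] := running_max_attained s0.
by apply: le_running_max; rewrite u0 (le_trans us).
Qed.

Lemma running_max_new s t : 0 <= s -> s <= t -> M s < M t ->
  exists2 u, s < u <= t & X u w = M t.
Proof.
move=> s0 st Mst; have [u /andP[u0 ut] Mu] := running_max_attained (le_trans s0 st).
exists u => //; rewrite ut andbT ltNge; apply/negP => us.
by move: Mst; rewrite Mu ltNge le_running_max// u0 us.
Qed.

Lemma running_max0 : M 0 = X 0 w.
Proof.
have [s /andP[s0 s0'] ->] := running_max_attained (lexx 0).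
by congr (X _ w); apply/eqP; rewrite eq_le s0 s0'.
Qed.

(* A new maximum over [s, t] is reached inside [s, t]. *)
Lemma running_max_osc s t e : 0 <= s -> s <= t ->
  (forall u, s <= u <= t -> `|X u w - X s w| <= e) -> M t - M s <= e.
Proof.
move=> s0 st he; have := he s; rewrite lexx st => /(_ isT); rewrite subrr normr0 => e0.
have [Mst|] := ltP (M s) (M t); last lra.
have [u /andP[su ut] <-] := running_max_new s0 st Mst.
have := he u; rewrite ut ltW// => /(_ isT); rewrite ler_norml.
have : X s w <= M s by apply: le_running_max; rewrite s0 lexx.
lra.
Qed.

(** The rise of the maximum over an interval is at most the oscillation of the path there, which
    uniform continuity on [[0, t + 1]] makes small. *)
Lemma path_continuous_running_max : path_continuous (running_max X ^~ w).
Proof.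
move=> t e t0 e0; have e20 : 0 < e / 2 by rewrite divr_gt0.
have [d d0 h] := path_Heine (t + 1) cX e20.
exists (Num.min d 1); first by rewrite lt_min d0 ltr01.
move=> u u0; rewrite lt_min !ltr_norml => /andP[utd ut1].
have [tu|ut] := leP t u.
  have := running_max_mono t0 tu; rewrite -subr_ge0 => hM.
  rewrite subr_ge0 in hM.
  have : M u - M t <= e / 2.
    apply: running_max_osc => // v /andP[tv vu]; apply/ltW/h; rewrite ?ltr_norml; lra.
  lra.
have := running_max_mono u0 (ltW ut) => hM.
have : M t - M u <= e / 2.
  apply: running_max_osc => //; first exact: ltW.
  by move=> v /andP[tv vu]; apply/ltW/h; rewrite ?ltr_norml; lra.
lra.
Qed.

End running_max_path.

Section recovery_path.
Context {T : Type} {R : realType} (X : R -> T -> R) (w : T) (a : R).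
Hypothesis cX : path_continuous (X ^~ w).
Hypothesis a0 : 0 < a.
Implicit Types (r s t u v e : R).
Local Notation M t := (running_max X t w).
Local Notation D t := (running_max X t w - X t w).
Local Notation tau k := (recovery_drawdown X a k w).

Lemma path_continuous_drawdown : path_continuous (fun t => D t).
Proof.
apply: path_continuousD; first exact: path_continuous_running_max.
have -> : (fun t => - X t w) = (fun t => -1 * X t w) by apply/funext => t; rewrite mulN1r.
exact: path_continuousZ.
Qed.

(** The infimum is a minimum although one of its conditions is strict. The exact value [D t = a]
    fixes the position from which the next recovery starts. *)
Lemma recovery_drawdown_stepP r : 0 <= r ->
  let S' := recovery_drawdown_step X a w r%:E in
  (S' = +oo%E /\ forall t, r < t -> a <= D t -> ~ M r < M t) \/
  exists t, [/\ S' = t%:E, r < t, D t = a, M r < M t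
    & forall u, r < u -> a <= D u -> M r < M u -> t <= u].
Proof.
move=> r0 /=.
set E := [set t | [/\ r < t, a <= running_max X t w - X t w
                 & running_max X r w < running_max X t w]].
have [E0|/set0P[t1 Et1]] := eqVneq E set0.
  left; split; first by rewrite E0 image_set0 ereal_inf0.
  by move=> t rt aD Mrt; have : E t by []; rewrite E0.
have Elb : has_lbound E by exists r => t [/ltW].
have Einf : has_inf E by split=> //; exists t1.
right; exists (inf E); set t := inf E.
have rt : r <= t by apply: lb_le_inf => [|u [/ltW]//]; exists t1.
have t0 : 0 <= t by exact: le_trans rt.
have Eadh e : 0 < e -> exists2 u, E u & t <= u < t + e.
  move=> e0; have [u Eu ute] := inf_adherent e0 Einf.
  by exists u => //; rewrite ute andbT; apply: ge_inf.
(* The drawdown condition is closed, so it passes to the infimum by continuity. *)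
have aDt : a <= D t.
  apply/ler_addgt0Pr => e e0.
  have [d d0 hd] := path_continuous_drawdown t0 e0.
  have [u [ru aDu _] /andP[tu utd]] := Eadh _ d0.
  have := hd u (le_trans t0 tu); rewrite !ltr_norml.
  have -> : - d < u - t < d by lra.
move=> /(_ isT).
  lra.
(* The strict condition is not closed. If it failed at [t], an admissible [u] just after [t] would
   have its maximum attained inside []t, u]] and at least [a] above [X u w], against uniform
   continuity. *)
have Mrt : M r < M t.
  rewrite lt_neqAle running_max_mono// andbT; apply/eqP => Mrt.
  have [d d0 hd] := path_Heine (t + 1) cX a0.
  have [|u [ru aDu Mru] /andP[tu utd]] := Eadh (Num.min d 1).
    by rewrite lt_min d0 ltr01.
  have utd' : u < t + d by apply: (lt_le_trans utd); rewrite lerD2l ge_min lexx.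
  have ut1 : u < t + 1 by apply: (lt_le_trans utd); rewrite lerD2l ge_min lexx orbT.
  have [|v /andP[tv vu] Mv] := running_max_new cX t0 tu; first by rewrite -Mrt.
  have := hd u v; rewrite !ltr_norml -Mv in aDu *.
  have -> : 0 <= u <= t + 1 by lra.
move=> /(_ isT).
  have -> : 0 <= v <= t + 1 by lra.
move=> /(_ isT).
  have -> : - d < u - v < d by lra.
move=> /(_ isT).
  lra.
have rt' : r < t by rewrite lt_neqAle rt andbT; apply: contraTneq Mrt => ->; rewrite ltxx.
have tmin u : r < u -> a <= D u -> M r < M u -> t <= u.
  by move=> *; apply: ge_inf => //; split.
split => //; first by rewrite ereal_inf_EFin//; exists t1.
(* A drawdown above [a] at [t] would leave all conditions valid slightly before [t], against
   minimality. *)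
apply/eqP; rewrite eq_le aDt andbT leNgt; apply/negP => aDt'.
have aDt2 : 0 < D t - a by rewrite subr_gt0.
have Mrt2 : 0 < M t - M r by rewrite subr_gt0.
have [d1 d10 h1] := path_continuous_drawdown t0 aDt2.
have [d2 d20 h2] := path_continuous_running_max cX t0 Mrt2.
(* The midpoint keeps [u] after [r]; the other two terms keep it in both continuity neighbourhoods
   of [t]. *)
pose u := Num.max ((r + t) / 2) (Num.max (t - d1 / 2) (t - d2 / 2)).
have ut : u < t by rewrite /u !gt_max; lra.
have [u1 u2 u3] : [/\ (r + t) / 2 <= u, t - d1 / 2 <= u & t - d2 / 2 <= u].
  by rewrite /u !le_max !lexx !orbT.
have u0 : 0 <= u by lra.
have := h1 u u0; have := h2 u u0; rewrite !ltr_norml.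
have -> : - d1 < u - t < d1 by lra.
have -> : - d2 < u - t < d2 by lra.
move=> /(_ isT)/andP[H1 H2] /(_ isT)/andP[H3 H4].
have := tmin u; have -> : r < u by lra.
move=> /(_ isT).
have -> : a <= D u by lra.
move=> /(_ isT).
have -> : M r < M u by lra.
move=> /(_ isT).
lra.
Qed.

Lemma recovery_drawdown_ge0 k : (0 <= tau k)%E.
Proof.
elim: k => [|k IH]; first by rewrite /recovery_drawdown/= lexx.
rewrite /recovery_drawdown iterS -/(recovery_drawdown X a k w).
case: (tau k) IH => [r|//|//]; rewrite lee_fin => r0.
have [[-> _]//|[t [-> rt _ _ _]]] := recovery_drawdown_stepP r0.
by rewrite lee_fin (le_trans r0)// ltW.
Qed.

Lemma recovery_drawdown_fineK k : (tau k < +oo)%E -> tau k = (fine (tau k))%:E.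
Proof. by have := recovery_drawdown_ge0 k; case: (tau k). Qed.

Lemma fine_recovery_drawdown_ge0 k : 0 <= fine (tau k).
Proof. by have := recovery_drawdown_ge0 k; case: (tau k). Qed.

Lemma recovery_drawdownS_y k : tau k = +oo%E -> tau k.+1 = +oo%E.
Proof.
by rewrite /recovery_drawdown iterS => ->.
Qed.

Lemma recovery_drawdownS_spec k r : tau k = r%:E ->
  (tau k.+1 = +oo%E /\ forall t, r < t -> a <= D t -> ~ M r < M t) \/
  exists t, [/\ tau k.+1 = t%:E, r < t, D t = a, M r < M t
    & forall u, r < u -> a <= D u -> M r < M u -> t <= u].
Proof.
move=> tk; have := recovery_drawdown_ge0 k; rewrite tk lee_fin => r0.
have := recovery_drawdown_stepP r0.
by rewrite -tk /recovery_drawdown iterS.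
Qed.

Lemma drawdown_at_recovery_drawdown k : (tau k.+1 < +oo)%E ->
  D (fine (tau k.+1)) = a.
Proof.
case tk : (tau k) => [r| |] //.
- by have [[-> _]//|[t [-> rt Dt _ _] _]] := recovery_drawdownS_spec tk.
- by rewrite recovery_drawdownS_y.
- by have := recovery_drawdown_ge0 k; rewrite tk.
Qed.

Lemma recovery_drawdownS_gt k : (tau k.+1 < +oo)%E -> (tau k < tau k.+1)%E.
Proof.
case tk : (recovery_drawdown X a k w) => [r| |].
- have [[-> _]|[t [-> rt Dt _ _]]] := recovery_drawdownS_spec tk; first by [].
  by rewrite lte_fin.
- by rewrite recovery_drawdownS_y.
- by have := recovery_drawdown_ge0 k; rewrite tk.
Qed.

(** A form of the event free of infima, on which measurability rests. That [u] comes after [tau k]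
    follows from the strict increase of the monotone running maximum. *)
Lemma recovery_drawdownS_leP k t : (tau k.+1 <= t%:E)%E <->
  (tau k <= t%:E)%E /\
  exists u, [/\ 0 <= u <= t, a <= D u & M (fine (tau k)) < M u].
Proof.
case tk : (recovery_drawdown X a k w) => [r| |].
- have := recovery_drawdown_ge0 k; rewrite tk lee_fin => r0.
  have [[-> h]|[s [-> rs Ds Ms h]]] := recovery_drawdownS_spec tk.
    split => // -[_ [u [/andP[u0 ut] aD Mu]]]; exfalso.
    apply: (h u _ aD Mu); rewrite ltNge; apply/negP => ur.
    by move: Mu; rewrite ltNge running_max_mono.
  rewrite !lee_fin; split => [st|[rt [u [/andP[u0 ut] aD Mu]]]].
    split; first by rewrite (le_trans _ st)// ltW.
    by exists s; rewrite st Ds lexx Ms (le_trans r0 (ltW rs)).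
  apply: le_trans ut; apply: h => //; rewrite ltNge; apply/negP => ur.
  by move: Mu; rewrite ltNge running_max_mono.
- by rewrite recovery_drawdownS_y// leye_eq/=; split => [|[]].
- by have := recovery_drawdown_ge0 k; rewrite tk.
Qed.

End recovery_path.

Arguments recovery_drawdown : simpl never.

(** * Measurability of the running maximum and adaptedness of the drawdown times *)

Lemma measurable_fun_gt {d} {S : measurableType d} {R : realType} (f : S -> R) :
  (forall y, measurable [set w | y < f w]) -> measurable_fun setT f.
Proof.
move=> h mT; apply: (measurability _ (RGenOInfty.measurableE R)) => //.
move=> _ [_ [y ->] <-]; rewrite setTI.
have -> : f @^-1` `]y, +oo[ = [set w | y < f w] by apply/seteqP; split => w /=; rewrite in_itv/= andbT.
exact: h.
Qed.

Lemma measurable_gt {d} {S : measurableType d} {R : realType} (f : S -> R) y :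
  measurable_fun setT f -> measurable [set w | y < f w].
Proof.
move=> mf; have -> : [set w | y < f w] = setT `&` f @^-1` `]y, +oo[.
  by rewrite setTI; apply/seteqP; split => w /=; rewrite in_itv/= andbT.
by apply: mf => //; exact: measurable_itv.
Qed.

(** By continuity the maximum exceeds [y] exactly when the path does so at a rational time or at the
    endpoint. The sigma-algebra on [S] is arbitrary, so that the past at time [t] is allowed. *)
Lemma measurable_running_max {d} {S : measurableType d} {R : realType}
    (Y : R -> S -> R) (t : R) : 0 <= t -> (forall w, path_continuous (Y ^~ w)) ->
  (forall u, 0 <= u <= t -> measurable_fun setT (Y u)) ->
  measurable_fun setT (running_max Y t).
Proof.
move=> t0 cY mY; apply: measurable_fun_gt => y.
(* Rationals outside [[0, t]] stand for the endpoint [t], which may be irrational. *)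
pose h (r : rat) := if 0 <= (ratr r : R) <= t then Y (ratr r) else Y t.
have -> : [set w | y < running_max Y t w] = \bigcup_r [set w | y < h r w].
  apply/seteqP; split => w /=.
    have [s /andP[s0 st] ->] := running_max_attained (cY w) t0 => ys.
    have [ts|] := leP t s.
      exists (-1) => //=; rewrite /h; have -> : 0 <= (ratr (-1) : R) <= t = false.
        by rewrite rmorphN1; apply/negbTE; lra.
      by have <- : s = t by apply/eqP; rewrite eq_le st.
    move=> {}st; have ys' : 0 < Y s w - y by rewrite subr_gt0.
    have [e e0 he] := cY w s _ s0 ys'.
    have /rat_in_itvoo[q] : s < Num.min (s + e) t by rewrite lt_min st ltrDl e0.
    rewrite in_itv/= lt_min => /andP[sq /andP[qe qt]].
    exists q => //=; rewrite /h; have -> : 0 <= (ratr q : R) <= t by lra.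
    have q0 : 0 <= (ratr q : R) by lra.
    have qs : - e < ratr q - s < e by lra.
    have := he _ q0; rewrite !ltr_norml qs => /(_ isT)/andP[? ?]; lra.
  move=> [q _ /= hy]; apply: lt_le_trans hy _; rewrite /h; case: ifP => hq.
    exact: le_running_max.
  by apply: le_running_max => //; rewrite t0 lexx.
apply: bigcupT_measurable_rat => q; apply: measurable_gt; rewrite /h.
by case: ifP => hq; apply: mY => //; rewrite t0 lexx.
Qed.

Section past_recovery.
Context {d : measure_display} {T : measurableType d} {R : realType}.
Variables (P : probability T R) (W : R -> {RV P >-> R}) (mu sigma a : R).
Hypothesis hW : standard_brownian_motion W.
Hypothesis a0 : 0 < a.
Local Notation Wt := (fun t w => W t w).
Local Notation X := (drifted mu sigma Wt).
Local Notation M t w := (running_max X t w).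
Local Notation tau := (recovery_drawdown X a).
Local Notation pastT t := (g_sigma_algebraType (past_cylinder Wt t)).

Lemma brownian_path_continuous w : path_continuous (Wt ^~ w).
Proof. by case: hW => _ cW _ _; apply: within_path_continuous; exact: cW. Qed.

Lemma drifted_path_continuous w : path_continuous (X ^~ w).
Proof.
apply: path_continuousD; first exact: path_continuousZ path_continuous_id.
exact: path_continuousZ (brownian_path_continuous w).
Qed.
Local Notation cX := drifted_path_continuous.

Lemma past_drifted s t : 0 <= s <= t -> past_measurable Wt t (X s).
Proof.
move=> st; apply: measurable_funD; first exact: measurable_cst.
by apply: measurable_funM; [exact: measurable_cst|exact: past_measurable_path].
Qed.

Lemma past_running_max s t : 0 <= s <= t -> past_measurable Wt t (running_max X s).
Proof.
move=> /andP[s0 st].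
apply: (@measurable_running_max _ (pastT t)) => // [w|u /andP[u0 us]].
  exact: cX.
by apply: past_drifted; rewrite u0 (le_trans us).
Qed.

(** The cut at [t] turns the maximum at [tau k] into a function of the path up to time [t]. *)
Definition stopped_max k t w :=
  if (tau k w <= t%:E)%E then M (fine (tau k w)) w else 0.

(** The event asks for a time [u] in [[0, t]] satisfying a closed and a strict inequality. Writing
    the strict one as a union over margins [1 / (p + 1)] turns existence of [u] into nonnegativity
    of the running maximum of a minimum of two continuous processes. *)
Lemma past_recovery_step k t : 0 <= t ->
  @measurable _ (pastT t) [set w | (tau k w <= t%:E)%E] ->
  past_measurable Wt t (stopped_max k t) ->
  @measurable _ (pastT t) [set w | (tau k.+1 w <= t%:E)%E].
Proof.
move=> t0 mk mM.
pose Y p u w := Num.min (M u w - X u w + - a)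
  (M u w + - (stopped_max k t w + p.+1%:R^-1)).
have cY p w : path_continuous (Y p ^~ w).
  apply: path_continuous_min; apply: path_continuousD; do ?exact: path_continuous_cst.
    by apply: path_continuous_drawdown; exact: cX.
  by apply: path_continuous_running_max; exact: cX.
have -> : [set w | (tau k.+1 w <= t%:E)%E] = [set w | (tau k w <= t%:E)%E] `&`
    \bigcup_p [set w | 0 <= running_max (Y p) t w].
  apply/seteqP; split => w /=.
    move=> /(recovery_drawdownS_leP (cX w) a0)[tk [u [ut aD Mu]]]; split => //.
    have {}Mu : 0 < M u w - stopped_max k t w by rewrite /stopped_max tk subr_gt0.
    have [p pM] : exists p, p.+1%:R^-1 < M u w - stopped_max k t w.
      have [p pM] := ltr_add_invr Mu; exists p; by rewrite add0r in pM.
    exists p => //=; apply: le_trans (le_running_max (cY p w) ut).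
    rewrite /Y le_min; apply/andP; split; first lra.
    by rewrite subr_ge0 addrC -lerBrDr ltW.
  move=> [tk [p _ /= hp]]; apply/(recovery_drawdownS_leP (cX w) a0); split => //.
  have [u ut Yu] := running_max_attained (cY p w) t0.
  move: hp; rewrite Yu /Y le_min => /andP[h1 h2]; exists u; split => //; first lra.
  move: h2; rewrite /stopped_max tk subr_ge0; apply: lt_le_trans.
  by rewrite ltrDl invr_gt0.
apply: measurableI => //; apply: bigcupT_measurable => p.
have mY : @measurable_fun _ _ (pastT t) R setT (running_max (Y p) t).
  apply: measurable_running_max => // u ut; apply: measurable_minr.
    apply: measurable_funD; last exact: measurable_cst.
    by apply: measurable_funB; [exact: past_running_max|exact: past_drifted].
  apply: measurable_funD; first exact: past_running_max.
  apply: measurable_funN; apply: measurable_funD => //; exact: measurable_cst.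
have -> : [set w | 0 <= running_max (Y p) t w] = setT `&` running_max (Y p) t @^-1` `[0, +oo[.
  by rewrite setTI; apply/seteqP; split => w /=; rewrite in_itv/= andbT.
by apply: mY => //; exact: measurable_itv.
Qed.

(** By continuity, the maximum at [tau k.+1] exceeds [y] exactly when it already does at some
    rational time before [tau k.+1]; positivity of [tau k.+1] leaves room for such rationals. *)
Lemma past_stopped_maxS k t : 0 <= t ->
  (forall s, 0 <= s -> @measurable _ (pastT s) [set w | (tau k.+1 w <= s%:E)%E]) ->
  past_measurable Wt t (stopped_max k.+1 t).
Proof.
move=> t0 mk.
apply: (@measurable_fun_gt _ (pastT t)) => y.
pose h (r : rat) : set T := if 0 <= (ratr r : R) <= t then
  [set w | y < running_max X (ratr r) w] `\` [set w | (tau k.+1 w <= (ratr r)%:E)%E] else set0.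
have -> : [set w | y < stopped_max k.+1 t w] =
    ([set w | (tau k.+1 w <= t%:E)%E] `&` \bigcup_r h r) `|`
    (~` [set w | (tau k.+1 w <= t%:E)%E] `&` [set w | y < 0]).
  apply/seteqP; split => w /=; rewrite /stopped_max.
    case: ifPn => [kt yM|/negP kt y0]; last by right.
    left; split => //.
    have tE : tau k.+1 w = (fine (tau k.+1 w))%:E.
      apply: (recovery_drawdown_fineK (cX w) a0); exact: le_lt_trans kt (ltry _).
    set s := fine (tau k.+1 w) in tE yM.
    have s0 : 0 < s.
      rewrite -lte_fin -tE; apply: le_lt_trans (recovery_drawdown_ge0 (cX w) a0 k) _.
      by apply: (recovery_drawdownS_gt (cX w) a0); rewrite tE ltry.
    have st : s <= t by rewrite -lee_fin -tE.
    have yM' : 0 < M s w - y by rewrite subr_gt0.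
    have [e e0 he] := path_continuous_running_max (cX w) (ltW s0) yM'.
    have /rat_in_itvoo[q] : Num.max 0 (s - e) < s by rewrite gt_max s0 ltrBlDr ltrDl.
    rewrite in_itv/= gt_max => /andP[/andP[q0 qe] qs].
    exists q => //; rewrite /h; have -> /= : 0 <= (ratr q : R) <= t by lra.
    split; last by rewrite tE lee_fin; apply/negP; rewrite -ltNge.
    have qs' : - e < ratr q - s < e by lra.
    have := he _ (ltW q0); rewrite !ltr_norml qs' => /(_ isT)/andP[? ?]; lra.
  move=> [[kt [q _]]|[/negP/negbTE -> //]]; rewrite /h kt; case: ifP => // /andP[q0 qt] /= [yM].
  have tE : tau k.+1 w = (fine (tau k.+1 w))%:E.
    apply: (recovery_drawdown_fineK (cX w) a0); exact: le_lt_trans kt (ltry _).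
  rewrite tE lee_fin => /negP; rewrite -ltNge => qs.
  apply: lt_le_trans yM _; apply: running_max_mono (ltW qs) => //; exact: cX.
have mst : @measurable _ (pastT t) [set w | (tau k.+1 w <= t%:E)%E] by exact: mk.
apply: measurableU; last first.
  apply: measurableI; first exact: measurableC.
  have [y0|y0] := boolP (y < 0).
    by have -> : [set w : T | true] = setT by apply/seteqP; split.
  by have -> : [set w : T | false] = set0 by apply/seteqP; split.
apply: measurableI => //; apply: bigcupT_measurable_rat => q; rewrite /h.
case: ifP => // qt; apply: measurableD.
  by apply: measurable_gt; exact: past_running_max.
case/andP: qt => q0 qt; apply: (past_set_mono qt); exact: mk.
Qed.

(** [tau k] is a stopping time. Both claims go through one induction, since the event for [tau k.+1]
    compares the running maximum with its value at [tau k]. *)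
Lemma past_recovery_drawdown k t : 0 <= t ->
  @measurable _ (pastT t) [set w | (tau k w <= t%:E)%E] /\
  past_measurable Wt t (stopped_max k t).
Proof.
elim: k t => [|k IH] t t0.
  have E w : (tau 0%N w <= t%:E)%E by rewrite /recovery_drawdown/= lee_fin.
  split.
    have -> : [set w | (tau 0%N w <= t%:E)%E] = setT by apply/seteqP; split => w //= _; exact: E.
    exact: measurableT.
  have -> : stopped_max 0%N t = running_max X 0.
    by apply/funext => w; rewrite /stopped_max E.
  by apply: past_running_max; rewrite lexx.
have mk s : 0 <= s -> @measurable _ (pastT s) [set w | (tau k.+1 w <= s%:E)%E].
  by move=> s0; have [? ?] := IH s s0; exact: past_recovery_step.
by split; [exact: mk|exact: past_stopped_maxS].
Qed.

End past_recovery.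

(** * Discretization and a maximal inequality *)

Section grid.
Context {R : realType}.
Implicit Types (t s : R) (N i j : nat).

Definition grid t N i : R := i%:R * (t / N.+1%:R).

Lemma grid0 t N : grid t N 0 = 0. Proof. by rewrite /grid mul0r. Qed.

Lemma gridN t N : grid t N N.+1 = t.
Proof. by rewrite /grid mulrCA divff ?mulr1// pnatr_eq0. Qed.

Lemma gridS t N i : grid t N i.+1 = grid t N i + t / N.+1%:R.
Proof. by rewrite /grid -natr1 mulrDl mul1r. Qed.

Lemma grid_step_gt0 t N : 0 < t -> 0 < t / N.+1%:R.
Proof. by move=> t0; rewrite divr_gt0. Qed.

Lemma grid_ltS t N i : 0 < t -> grid t N i < grid t N i.+1.
Proof. by move=> t0; rewrite gridS ltrDl grid_step_gt0. Qed.

Lemma grid_le t N i j : 0 < t -> (i <= j)%N -> grid t N i <= grid t N j.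
Proof. by move=> t0 ij; rewrite ler_wpM2r ?ler_nat// ltW// grid_step_gt0. Qed.

Lemma grid_ge0 t N i : 0 < t -> 0 <= grid t N i.
Proof. by move=> t0; rewrite -(grid0 t N) grid_le. Qed.

(** [j] is the first index whose grid point is at or after [S], with [N.+1] as fallback when [S]
    lies beyond [t]. The equivalence stops at [N] because the fallback index need not satisfy it. *)
Lemma grid_index t N (S : \bar R) : 0 < t -> (0 <= S)%E ->
  exists j, [/\ (j <= N.+1)%N,
    forall i, (i <= N)%N -> (S <= (grid t N i)%:E)%E = (j <= i)%N,
    forall s, S = s%:E -> s <= t -> s <= grid t N j < s + t / N.+1%:R
    & (t%:E < S)%E -> j = N.+1].
Proof.
move=> t0 S0.
pose p i := (S <= (grid t N i)%:E)%E || (i == N.+1).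
have pex : exists i, p i by exists N.+1; rewrite /p eqxx orbT.
case: (ex_minnP pex) => j pj jmin; exists j.
have jN : (j <= N.+1)%N by apply: jmin; rewrite /p eqxx orbT.
split => //.
- move=> i iN; apply/idP/idP => [Si|ji]; first by apply: jmin; rewrite /p Si.
  move: pj; rewrite /p (_ : (j == N.+1) = false) ?orbF; last first.
    by apply/negbTE; rewrite neq_ltn ltnS (leq_trans ji).
  by move=> /le_trans; apply; rewrite lee_fin grid_le.
- move=> s Ss st; apply/andP; split.
    by move: pj; rewrite /p Ss lee_fin => /orP[//|/eqP ->]; rewrite gridN.
  move: S0 jmin; rewrite Ss lee_fin => s0 jmin.
  case: j pj jmin {jN} => [|j] pj jmin.
    by rewrite grid0 ltr_wpDl// grid_step_gt0.
  rewrite gridS ltrD2r ltNge; apply/negP => sj.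
  by have := jmin j; rewrite /p Ss lee_fin sj ltnn => /(_ isT).
- move=> tS; move: pj; rewrite /p => /orP[Sj|/eqP//]; exfalso.
  move: tS; rewrite ltNge => /negP; apply; apply: le_trans Sj _.
  by rewrite lee_fin -[leRHS](gridN t N) grid_le.
Qed.

Lemma grid_step_lt t e : 0 < t -> 0 < e ->
  \forall N \near \oo, t / N.+1%:R < e.
Proof.
move=> t0 e0.
have [n _ nP] : \forall N \near \oo, (t / e < N.+1%:R :> R).
  near=> N; apply: lt_le_trans (_ : N%:R <= _); last by rewrite ler_nat.
  by near: N; exact: nbhs_infty_gtr.
exists n => // N /nP; rewrite ltr_pdivrMr// mulrC => ?.
by rewrite ltr_pdivrMr.
Unshelve. all: by end_near. Qed.

End grid.

Section grid_max.
Context {R : realType}.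

Fixpoint seq_max (y : nat -> R) N : R :=
  if N is N'.+1 then Num.max (seq_max y N') (y N) else y 0%N.

Lemma le_seq_max y i N : (i <= N)%N -> y i <= seq_max y N.
Proof.
elim: N => [|N IH]; first by rewrite leqn0 => /eqP->.
by rewrite leq_eqVlt => /orP[/eqP->|/IH h]; rewrite /= le_max ?lexx ?orbT// h.
Qed.

Lemma seq_max_le y N c : (forall i, (i <= N)%N -> y i <= c) -> seq_max y N <= c.
Proof.
elim: N => [|N IH] h; first exact: h.
by rewrite /= ge_max h// andbT IH// => i iN; rewrite h// ltnW.
Qed.

Lemma expR_seq_max y N : expR (seq_max y N) = seq_max (expR \o y) N.
Proof.
elim: N => //= N <-; rewrite /Num.max ltr_expR.
by case: ifP.
Qed.

(* The trajectorial form of Doob's L2 maximal inequality. *)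
Lemma trajectorial_doob (s : nat -> R) N : (forall i, 0 <= s i) ->
  seq_max s N ^+ 2 + 4 * \sum_(0 <= j < N) seq_max s j * s j.+1 <=
  4 * s N ^+ 2 + 4 * \sum_(0 <= j < N) seq_max s j * s j.
Proof.
move=> s0.
(* Discrete summation by parts: the maximum moves only by jumping to the current value, and a jump
   leaves the square [(s N.+1 - m) ^+ 2] to spare. The square of [seq_max s N - 2 * s N] then
   removes the mixed product. *)
have : seq_max s N ^+ 2 <= 2 * (seq_max s N * s N) +
   2 * \sum_(0 <= j < N) seq_max s j * s j - 2 * \sum_(0 <= j < N) seq_max s j * s j.+1.
  elim: N => [|N IH]; first by rewrite !big_geq//= expr2; have := mulr_ge0 (s0 0%N) (s0 0%N); lra.
  rewrite !big_nat_recr//=; set m := seq_max s N in IH *.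
  set A := \sum_(0 <= j < N) _ in IH *; set B := \sum_(0 <= j < N) _ in IH *.
  have := sqr_ge0 (s N.+1 - m).
  by rewrite /Num.max; case: (ltP m (s N.+1)) => h; nra.
have := sqr_ge0 (seq_max s N - 2 * s N).
set A := \sum_(0 <= j < N) _; set B := \sum_(0 <= j < N) _; nra.
Qed.

Lemma seq_max_cvg_running_max {T : Type} (Y : R -> T -> R) w t : 0 < t ->
  path_continuous (Y ^~ w) ->
  seq_max (fun i => Y (grid t N i) w) N.+1 @[N --> \oo] --> running_max Y t w.
Proof.
move=> t0 cY; apply/cvgrPdist_le => e e0.
have [s /andP[s0 st] Ms] := running_max_attained cY (ltW t0).
have [d d0 hd] := cY s e s0 e0.
near=> N.
have Nd : t / N.+1%:R < d by near: N; exact: grid_step_lt.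
have [j [jN _ /(_ s erefl st)/andP[sj js] _]] := @grid_index _ t N s%:E t0 s0.
have jt : 0 <= grid t N j by exact: grid_ge0.
have upper : seq_max (fun i => Y (grid t N i) w) N.+1 <= running_max Y t w.
  apply: seq_max_le => i iN; apply: le_running_max => //.
  by rewrite grid_ge0//= -[leRHS](gridN t N) grid_le.
have lower : Y (grid t N j) w <= seq_max (fun i => Y (grid t N i) w) N.+1.
  exact: (@le_seq_max (fun i => Y (grid t N i) w)).
have js' : grid t N j < s + d by apply: lt_trans js _; rewrite ltrD2l.
have hs : - d < grid t N j - s < d by lra.
have := hd _ jt; rewrite !ltr_norml hs => /(_ isT)/andP[h1 h2].
rewrite ger0_norm ?subr_ge0// Ms; rewrite Ms in upper; lra.
Unshelve. all: by end_near. Qed.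

End grid_max.

Section exp_sup.
Context {d : measure_display} {T : measurableType d} {R : realType}.
Variables (P : probability T R) (W : R -> {RV P >-> R}).
Hypothesis hW : standard_brownian_motion W.
Local Notation Wt := (fun t w => W t w).

Lemma brownian_exp_moment (t th : R) : 0 < t ->
  (\int[P]_w (expR (th * W t w))%:E = (expR (th ^+ 2 * t / 2))%:E)%E.
Proof.
move=> t0; have := increment_exp_moment hW th (lexx 0) t0.
rewrite subr0 => <-; apply: eq_integral => w _.
by case: hW => W0 _ _ _; rewrite W0 subr0.
Qed.

Section doob.
Variables (th t : R) (N : nat).
Hypothesis t0 : 0 < t.
Let s i w := expR (th * W (grid t N i) w).
Let mx j w := seq_max (s ^~ w) j.

Let s0 i w : 0 <= s i w. Proof. exact: expR_ge0. Qed.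
Let mx0 j w : 0 <= mx j w.
Proof. by apply: (le_trans (s0 0 w)); exact: (@le_seq_max _ (s ^~ w)). Qed.

Let past_s i j : (i <= j)%N -> past_measurable Wt (grid t N j) (s i).
Proof.
move=> ij; apply: measurableT_comp => //; apply: measurable_funM; first exact: measurable_cst.
by apply: past_measurable_path; rewrite grid_ge0//= grid_le.
Qed.

Let past_mx i j : (i <= j)%N -> past_measurable Wt (grid t N j) (mx i).
Proof.
elim: i => [|i IH] ij; first exact: past_s.
apply: measurable_maxr; [exact: IH (ltnW ij)|exact: past_s].
Qed.

Let ms i : measurable_fun setT (s i).
Proof. exact: (past_measurableW (past_s (leqnn i))). Qed.

Let mmx i : measurable_fun setT (mx i).
Proof. exact: (past_measurableW (past_mx (leqnn i))). Qed.

(** Submartingale property of [expR (th * W)]: the next value carries an independent factor of mean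
    at least 1. *)
Let s_step i (xi : T -> R) : past_measurable Wt (grid t N i) xi -> (forall w, 0 <= xi w) ->
  (\int[P]_w (xi w * s i w)%:E <= \int[P]_w (xi w * s i.+1 w)%:E)%E.
Proof.
move=> mxi xi0.
pose h (y : R) := expR (th * y).
have -> : (\int[P]_w (xi w * s i.+1 w)%:E = \int[P]_w ((xi w * s i w) *
    h (W (grid t N i.+1) w - W (grid t N i) w : R)%R)%:E)%E.
  apply: eq_integral => w _; rewrite /s /h -mulrA -expRD; congr (_ * expR _)%:E; lra.
rewrite (@past_expectationM _ _ _ P W hW _ _ (fun w => xi w * s i w) h) //.
- rewrite increment_exp_moment ?grid_ge0 ?grid_ltS//.
  apply: lee_pemulr; first by apply: integral_ge0 => w _; rewrite lee_fin mulr_ge0.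
  rewrite lee_fin -expR0 ler_expR.
  by rewrite divr_ge0// mulr_ge0 ?sqr_ge0// subr_ge0 ltW// grid_ltS.
- exact: grid_ge0.
- exact: grid_ltS.
- by apply: measurable_funM => //; exact: past_s.
- by move=> w; rewrite mulr_ge0.
- by apply: measurableT_comp => //; exact: measurable_funM.
- by move=> y; exact: expR_ge0.
Qed.

Let s2_fin i : (\int[P]_w (s i w ^+ 2)%:E < +oo)%E.
Proof.
have [i0|i0] := leqP i 0.
  have -> : (\int[P]_w (s i w ^+ 2)%:E = \int[P]_w (cst 1%E) w)%E.
    apply: eq_integral => w _; move: i0; rewrite leqn0 => /eqP ->.
    by case: hW => W0 _ _ _; rewrite /s grid0 W0 mulr0 expR0 expr1n.
  by rewrite integral_cst//= probability_setT mule1 ltry.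
have -> : (\int[P]_w (s i w ^+ 2)%:E = \int[P]_w (expR ((2 * th) * W (grid t N i) w))%:E)%E.
  by apply: eq_integral => w _; rewrite /s expr2 -expRD; congr (expR _)%:E; lra.
rewrite brownian_exp_moment ?ltry//.
by have := @grid_ltS R t N i.-1 t0; rewrite prednK//; apply: le_lt_trans; exact: grid_ge0.
Qed.

(** A crude induction whose bound grows with [i]; it only licenses the cancellation of sums in
    [doob_exp]. *)
Let mx2_fin i : (\int[P]_w (mx i w ^+ 2)%:E < +oo)%E.
Proof.
elim: i => [|i IH]; first exact: s2_fin.
apply: (@le_lt_trans _ _ (\int[P]_w ((mx i w ^+ 2)%:E + (s i.+1 w ^+ 2)%:E))%E).
  apply: ge0_le_integral => //.
  - by move=> w _; rewrite lee_fin sqr_ge0.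
  - by apply/measurable_EFinP; exact: measurable_funX.
  - by apply: emeasurable_funD; apply/measurable_EFinP; exact: measurable_funX.
  - move=> w _; rewrite -EFinD lee_fin /mx/=.
    rewrite /Num.max; case: ifP => _; by rewrite ?lerDl ?lerDr sqr_ge0.
rewrite ge0_integralD//.
- exact: lte_add_pinfty.
- by move=> w _; rewrite lee_fin sqr_ge0.
- by apply/measurable_EFinP; exact: measurable_funX.
- by move=> w _; rewrite lee_fin sqr_ge0.
- by apply/measurable_EFinP; exact: measurable_funX.
Qed.

Let ge0_integral_sumE (F : nat -> T -> R) n : (forall i w, 0 <= F i w) ->
  (forall i, measurable_fun setT (F i)) ->
  (\int[P]_w (\sum_(0 <= j < n) F j w)%:E = \sum_(0 <= j < n) \int[P]_w (F j w)%:E)%E.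
Proof.
move=> F0 mF; under eq_integral do rewrite -sumEFin.
by rewrite ge0_integral_sum// => [i|i w _]; [exact/measurable_EFinP|rewrite lee_fin].
Qed.

(** The trajectorial inequality is integrated. By [s_step] the sum on its left dominates the sum on
    its right, and the latter, being finite, cancels. The resulting bound does not depend on [N]. *)
Lemma doob_exp : (\int[P]_w (mx N.+1 w ^+ 2)%:E <= 4%:E * (expR (2 * th ^+ 2 * t))%:E)%E.
Proof.
have mA : measurable_fun setT (fun w => \sum_(0 <= j < N.+1) mx j w * s j.+1 w).
  by apply: measurable_sum => j; exact: measurable_funM.
have mB : measurable_fun setT (fun w => \sum_(0 <= j < N.+1) mx j w * s j w).
  by apply: measurable_sum => j; exact: measurable_funM.
have A0 w : 0 <= \sum_(0 <= j < N.+1) mx j w * s j.+1 w.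
  by apply: sumr_ge0 => j _; rewrite mulr_ge0.
have B0 w : 0 <= \sum_(0 <= j < N.+1) mx j w * s j w.
  by apply: sumr_ge0 => j _; rewrite mulr_ge0.
have main : (\int[P]_w ((mx N.+1 w ^+ 2)%:E + 4%:E * (\sum_(0 <= j < N.+1) mx j w * s j.+1 w)%:E)
   <= \int[P]_w (4%:E * (s N.+1 w ^+ 2)%:E + 4%:E * (\sum_(0 <= j < N.+1) mx j w * s j w)%:E))%E.
  apply: ge0_le_integral => //.
  - by move=> w _; rewrite lee_fin addr_ge0 ?sqr_ge0// mulr_ge0.
  - by apply/measurable_EFinP; apply: measurable_funD; [exact: measurable_funX|exact: measurable_funM].
  - by apply/measurable_EFinP; apply: measurable_funD;
      apply: measurable_funM => //; exact: measurable_funX.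
  - by move=> w _; rewrite lee_fin; exact: (@trajectorial_doob _ (s ^~ w)).
move: main; rewrite ge0_integralD//; last 4 first.
- by move=> w _; rewrite lee_fin sqr_ge0.
- by apply/measurable_EFinP; exact: measurable_funX.
- by move=> w _; rewrite lee_fin mulr_ge0.
- by apply/measurable_EFinP; exact: measurable_funM.
rewrite ge0_integralD//; last 4 first.
- by move=> w _; rewrite lee_fin mulr_ge0 ?sqr_ge0.
- by apply/measurable_EFinP; apply: measurable_funM => //; exact: measurable_funX.
- by move=> w _; rewrite lee_fin mulr_ge0.
- by apply/measurable_EFinP; exact: measurable_funM.
rewrite !ge0_integralZl//; last 6 first.
- exact/measurable_EFinP.
- by move=> w _; rewrite lee_fin.
- by apply/measurable_EFinP; exact: measurable_funX.
- by move=> w _; rewrite lee_fin sqr_ge0.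
- exact/measurable_EFinP.
- by move=> w _; rewrite lee_fin.
rewrite !ge0_integral_sumE//; last 4 first.
- by move=> i w; rewrite mulr_ge0.
- by move=> i; exact: measurable_funM.
- by move=> i w; rewrite mulr_ge0.
- by move=> i; exact: measurable_funM.
have -> : (\int[P]_w (s N.+1 w ^+ 2)%:E = (expR (2 * th ^+ 2 * t))%:E)%E.
  have -> : (\int[P]_w (s N.+1 w ^+ 2)%:E = \int[P]_w (expR ((2 * th) * W t w))%:E)%E.
    by apply: eq_integral => w _; rewrite /s gridN expr2 -expRD; congr (expR _)%:E; lra.
  rewrite brownian_exp_moment//; congr (expR _)%:E; lra.
set K := (\sum_(0 <= j < N.+1) \int[P]_w (mx j w * s j w)%:E)%E.
set L := (\sum_(0 <= j < N.+1) \int[P]_w (mx j w * s j.+1 w)%:E)%E.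
have KL : (K <= L)%E.
  by apply: lee_sum => j _; apply: s_step => //; exact: past_mx.
have K0 : (0 <= K)%E.
  by apply: sume_ge0 => j _; apply: integral_ge0 => w _; rewrite lee_fin mulr_ge0.
have Kfin : (K < +oo)%E.
  apply: lte_sum_pinfty => j _; apply: le_lt_trans (mx2_fin j).
  apply: ge0_le_integral => //.
  - by move=> w _; rewrite lee_fin mulr_ge0.
  - by apply/measurable_EFinP; exact: measurable_funM.
  - by apply/measurable_EFinP; exact: measurable_funX.
  - by move=> w _; rewrite lee_fin expr2 ler_wpM2l// (@le_seq_max _ (s ^~ w)).
have Kf : K \is a fin_num by rewrite ge0_fin_numE.
move=> main; have : (\int[P]_w (mx N.+1 w ^+ 2)%:E + 4%:E * K <= 4%:E * (expR (2 * th ^+ 2 * t))%:E + 4%:E * K)%E.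
  by apply: le_trans main; apply: leeD => //; exact: lee_wpmul2l.
by rewrite leeD2rE// fin_numM.
Qed.

End doob.
End exp_sup.

Section exp_sup2.
Context {d : measure_display} {T : measurableType d} {R : realType}.
Variables (P : probability T R) (W : R -> {RV P >-> R}).
Hypothesis hW : standard_brownian_motion W.
Local Notation Wt := (fun t w => W t w).

Let scaled_path_continuous th w : path_continuous (fun u => th * W u w).
Proof. by apply: path_continuousZ; exact: (brownian_path_continuous hW). Qed.

Lemma measurable_running_max_brownian th t : 0 <= t ->
  measurable_fun setT (running_max (fun u w => th * W u w) t).
Proof.
move=> t0; apply: measurable_running_max => // u _; exact: measurable_funM.
Qed.

(** Fatou along the grids: the integrand is the square of the maximum of [expR (th * W)], so Doob's
    bound is uniform in the mesh. *)
Lemma exp_running_max_finite th t : 0 < t ->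
  (\int[P]_w (expR (2 * running_max (fun u w => th * W u w) t w))%:E < +oo)%E.
Proof.
move=> t0; pose mx N w := seq_max (fun i => th * W (grid t N i) w) N.+1.
have mxE N w : expR (2 * mx N w) = seq_max (fun i => expR (th * W (grid t N i) w)) N.+1 ^+ 2.
  by rewrite -expR_seq_max -expRM_natl.
have mmx N : measurable_fun setT (mx N).
  suff h n : measurable_fun setT (fun w => seq_max (fun i => th * W (grid t N i) w) n) by exact: h.
  elim: n => [|n IH] /=; first exact: measurable_funM.
  by apply: measurable_maxr => //; exact: measurable_funM.
have me N : measurable_fun setT (fun w => (expR (2 * mx N w))%:E).
  by apply/measurable_EFinP; apply: measurableT_comp => //; exact: measurable_funM.
have cv w : (expR (2 * mx N w))%:E @[N --> \oo] -->
    (expR (2 * running_max (fun u w => th * W u w) t w))%:E.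
  apply: cvg_EFin; first exact: nearW.
  apply: (cvg_comp _ expR); last exact: continuous_expR.
  apply: cvgMl_tmp; exact: (seq_max_cvg_running_max t0 (scaled_path_continuous th w)).
have := @fatou _ T R P setT measurableT (fun N w => (expR (2 * mx N w))%:E) me.
have e0 N w : setT w -> (0 <= (expR (2 * mx N w))%:E)%E by rewrite lee_fin expR_ge0.
move=> /(_ e0).
have einfE w : limn_einf (fun N => (expR (2 * mx N w))%:E) =
    (expR (2 * running_max (fun u w => th * W u w) t w))%:E.
  have cw := cv w; rewrite is_cvg_limn_einfE; last exact: cvgP cw.
  exact: cvg_lim.
under eq_integral do rewrite einfE.
move=> h; apply: le_lt_trans h _.
apply: (@le_lt_trans _ _ (4%:E * (expR (2 * th ^+ 2 * t))%:E)%E); last by rewrite -EFinM ltry.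
rewrite limn_einf_lim; apply: lime_le; first exact: is_cvg_einfs.
apply: nearW => N; apply: le_trans (doob_exp hW th N t0).
apply: ge_ereal_inf; exists (\int[P]_x (expR (2 * mx N x))%:E)%E; first by exists N => /=.
by under eq_integral do rewrite mxE.
Unshelve. all: by end_near. Qed.

(** One integrable function bounds all times at once. The absolute value is split into the maxima of
    [th * W] and of [- th * W]. *)
Lemma exp_sup_integrable (mu sigma C t : R) : 0 < t -> 0 <= C ->
  exists2 g : T -> R, P.-integrable setT (EFin \o g) &
    forall w u, 0 <= u <= t -> expR (C * `|drifted mu sigma Wt u w|) <= g w.
Proof.
(* Halved because the available moment is that of [expR] of twice the maximum. *)
move=> t0 C0; pose th := C * sigma / 2.
pose Mx th w := running_max (fun u w => th * W u w) t w.
exists (fun w => expR (C * `|mu| * t) * (expR (2 * Mx th w) + expR (2 * Mx (- th) w))).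
  have I th' : P.-integrable setT (fun w => (expR (2 * Mx th' w))%:E).
    apply/integrableP; split.
      apply/measurable_EFinP; apply: measurableT_comp => //; apply: measurable_funM => //.
      exact: measurable_running_max_brownian (ltW t0).
    under eq_integral do rewrite gee0_abs ?lee_fin ?expR_ge0//.
    exact: exp_running_max_finite.
  exact: (integrableZl measurableT _ (integrableD measurableT (I th) (I (- th)))).
move=> w u /andP[u0 ut].
have hM th' : th' * W u w <= Mx th' w.
  apply: (@le_running_max _ _ (fun u w => th' * W u w)); last by rewrite u0.
  exact: scaled_path_continuous.
have h1 : C * `|drifted mu sigma Wt u w| <= C * `|mu| * t + `|2 * (th * W u w)|.
  have -> : `|2 * (th * W u w)| = C * `|sigma * W u w|.
    rewrite -[in RHS](ger0_norm C0) -normrM; congr `|_|; rewrite /th; lra.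
  rewrite -mulrA -mulrDr ler_wpM2l// /drifted.
  apply: le_trans (ler_normD _ _) _; rewrite lerD2r normrM ler_wpM2l//.
  by rewrite ger0_norm.
apply: (@le_trans _ _ (expR (C * `|mu| * t + `|2 * (th * W u w)|))); first by rewrite ler_expR.
rewrite expRD ler_wpM2l ?expR_ge0//.
have := hM th; have := hM (- th) => k1 k2.
case: (ger0P (2 * (th * W u w))) => _.
  by rewrite ler_wpDr ?expR_ge0// ler_expR; lra.
by rewrite ler_wpDl ?expR_ge0// ler_expR; lra.
Qed.

End exp_sup2.

(** * The value function of one phase *)

Section exp_estimates.
Context {R : realType}.
Implicit Types x y r : R.

Lemma expR_sub1_le x r : `|x| <= r -> `|expR x - 1| <= r * expR r.
Proof.
rewrite ler_norml => /andP[xr1 xr2]; have r0 : 0 <= r by lra.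
have e1 : 1 <= expR r by rewrite -expR0 ler_expR.
have h1 := expR_ge1Dx x; have h2 := expR_ge1Dx (- x).
have ex := expR_gt0 x.
have h3 : expR x - 1 <= x * expR x.
  have : (1 - x) * expR x <= expR (- x) * expR x by rewrite ler_wpM2r// ltW.
  by rewrite -expRD addNr expR0; lra.
rewrite ler_norml; apply/andP; split; first by nra.
apply: (le_trans h3); apply: (@le_trans _ _ (r * expR x)); first by rewrite ler_wpM2r// ltW.
by rewrite ler_wpM2l// ler_expR.
Qed.

(** Convexity puts [expR y - expR x] between [expR x * (y - x)] and [expR y * (y - x)], and both
    factors are close to 1. *)
Lemma expR_sub_le x y r : `|x| <= r -> `|y| <= r ->
  `|expR y - expR x - (y - x)| <= `|y - x| * (r * expR r).
Proof.
move=> xr yr.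
have h x' y' : expR x' * (y' - x') <= expR y' - expR x'.
  have := expR_ge1Dx (y' - x'); rewrite -(ler_pM2l (expR_gt0 x')) -expRD subrKC; lra.
have h1 := h x y; have h2 := h y x.
have := expR_sub1_le xr; have := expR_sub1_le yr.
move: (r * expR r) => e; rewrite !ler_norml => /andP[h3 h4] /andP[h5 h6].
by case: (ger0P (y - x)) => h7; apply/andP; split; nra.
Qed.

End exp_estimates.

Section phase.
Context {R : realType}.
Variables (bp bm b c K : R) (G f : R -> R).
Hypothesis bpm : 0 < bp - bm.
Hypothesis GK : forall m, `|G m| <= K.
Hypothesis fK : forall m, `|f m| <= K.
Hypothesis Glip : forall m m', `|G m' - G m| <= K * `|m' - m|.
Hypothesis flip : forall m m', `|f m' - f m| <= K * `|m' - m|.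
Hypothesis Gder : forall m m', m <= m' ->
  `|G m' - G m - (b * G m - c * f m) * (m' - m)| <= K * (m' - m) ^+ 2.

(** [coefp] and [coefm] solve [coefp + coefm = G] and [bp * coefp + bm * coefm = b * G - c * f].
    These prescribe the value and the slope in [y] of [fall m] at [y = m]; the slope being [G'], the
    derivative in [m] vanishes on the diagonal. *)
Definition coefp m := ((b - bm) * G m - c * f m) / (bp - bm).
Definition coefm m := ((bp - b) * G m + c * f m) / (bp - bm).

Definition fall m y := coefp m * expR (bp * (y - m)) + coefm m * expR (bm * (y - m)).

Let k := `|bp| + `|bm|.
Let C1 := (`|b| + `|c| + k) * K / (bp - bm).

Let K0 : 0 <= K. Proof. exact: le_trans (normr_ge0 _) (GK 0). Qed.
Let k0 : 0 <= k. Proof. exact: addr_ge0. Qed.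

(** A common source for the bounds ([e = 1]) and the Lipschitz estimates ([e] the distance) of both
    coefficients, with the same constant [C1]. *)
Let lincomb_le u v g h e : `|u| <= `|b| + k -> `|v| <= `|c| -> `|g| <= K * e -> `|h| <= K * e ->
  0 <= e -> `|(u * g + v * h) / (bp - bm)| <= C1 * e.
Proof.
move=> hu hv hg hh e0; rewrite normrM normfV (gtr0_norm bpm) /C1 mulrAC ler_pM2r ?invr_gt0//.
apply: le_trans (ler_normD _ _) _; rewrite !normrM.
have : `|u| * `|g| <= (`|b| + k) * (K * e) by apply: ler_pM.
have : `|v| * `|h| <= `|c| * (K * e) by apply: ler_pM.
lra.
Qed.

Let ub1 : `|b - bm| <= `|b| + k.
Proof. by apply: le_trans (ler_normB _ _) _; rewrite lerD2l /k lerDr. Qed.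

Let ub2 : `|bp - b| <= `|b| + k.
Proof. by apply: le_trans (ler_normB _ _) _; rewrite addrC lerD2l /k lerDl. Qed.

Lemma coefp_le m : `|coefp m| <= C1.
Proof.
rewrite -[C1]mulr1 /coefp -mulNr; apply: lincomb_le; rewrite ?mulr1 ?normrN//.
Qed.

Lemma coefm_le m : `|coefm m| <= C1.
Proof. by rewrite -[C1]mulr1 /coefm; apply: lincomb_le; rewrite ?mulr1. Qed.

Lemma coefp_lip m m' : `|coefp m' - coefp m| <= C1 * `|m' - m|.
Proof.
have -> : coefp m' - coefp m = ((b - bm) * (G m' - G m) + (- c) * (f m' - f m)) / (bp - bm).
  by rewrite /coefp; field; rewrite gt_eqF.
by apply: lincomb_le; rewrite ?normrN.
Qed.

Lemma coefm_lip m m' : `|coefm m' - coefm m| <= C1 * `|m' - m|.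
Proof.
have -> : coefm m' - coefm m = ((bp - b) * (G m' - G m) + c * (f m' - f m)) / (bp - bm).
  by rewrite /coefm; field; rewrite gt_eqF.
exact: lincomb_le.
Qed.

Lemma coefpDm m : coefp m + coefm m = G m.
Proof. by rewrite /coefp /coefm; field; rewrite gt_eqF. Qed.

Lemma coefpm_der m : bp * coefp m + bm * coefm m = b * G m - c * f m.
Proof. by rewrite /coefp /coefm; field; rewrite gt_eqF. Qed.

Let expk u o : `|u| <= o -> 0 <= o -> `|bp * u| <= k * o /\ `|bm * u| <= k * o.
Proof.
move=> uo o0; rewrite !normrM; split; apply: ler_pM => //; rewrite /k ?lerDl ?lerDr//.
Qed.

Lemma fall_near_diag m y o : `|y - m| <= o ->
  `|fall m y - G m| <= 2 * C1 * (k * o * expR (k * o)).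
Proof.
move=> yo; have o0 := le_trans (normr_ge0 _) yo.
have [/expR_sub1_le h1 /expR_sub1_le h2] := expk yo o0.
have -> : fall m y - G m = coefp m * (expR (bp * (y - m)) - 1) + coefm m * (expR (bm * (y - m)) - 1).
  by rewrite -(coefpDm m) /fall; ring.
apply: le_trans (ler_normD _ _) _; rewrite (normrM (coefp m)) (normrM (coefm m)).
have := ler_pM (normr_ge0 _) (normr_ge0 _) (coefp_le m) h1.
have := ler_pM (normr_ge0 _) (normr_ge0 _) (coefm_le m) h2.
lra.
Qed.

Lemma fall_bound m y o : `|y - m| <= o -> `|fall m y| <= 2 * C1 * expR (k * o).
Proof.
move=> yo; have o0 := le_trans (normr_ge0 _) yo.
have [h1 h2] := expk yo o0.
apply: le_trans (ler_normD _ _) _; rewrite (normrM (coefp m)) (normrM (coefm m)) !(ger0_norm (expR_ge0 _)).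
have e1 : expR (bp * (y - m)) <= expR (k * o) by rewrite ler_expR (le_trans (ler_norm _)).
have e2 : expR (bm * (y - m)) <= expR (k * o) by rewrite ler_expR (le_trans (ler_norm _)).
have := ler_pM (normr_ge0 _) (expR_ge0 _) (coefp_le m) e1.
have := ler_pM (normr_ge0 _) (expR_ge0 _) (coefm_le m) e2.
lra.
Qed.

(* The first-order terms in [m' - m] cancel by [Gder]: the reflection condition at the maximum. *)
Lemma fall_reflect m m' y o : m <= m' -> m' - m <= o -> `|y - m| <= o -> `|y - m'| <= o ->
  `|fall m' y - fall m y| <= (K + 2 * C1 * k + 2 * C1 * k ^+ 2) * o * expR (k * o) * (m' - m).
Proof.
move=> mm' dm ym ym'; have o0 := le_trans (normr_ge0 _) ym.
set dl := m' - m in dm *; have dl0 : 0 <= dl by rewrite subr_ge0.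
set eta := k * o * expR (k * o).
have ko0 : 0 <= k * o by rewrite mulr_ge0.
have e1 : 1 <= expR (k * o) by rewrite -expR0 ler_expR.
have eta0 : 0 <= eta by rewrite mulr_ge0// expR_ge0.
have [p1 m1] := expk ym o0; have [p2 m2] := expk ym' o0.
have hp := expR_sub1_le p2; have hm := expR_sub1_le m2.
have hp' := expR_sub_le p1 p2; have hm' := expR_sub_le m1 m2.
rewrite -/eta in hp hm hp' hm'.
have Ep : bp * (y - m') - bp * (y - m) = - (bp * dl) by rewrite /dl; ring.
have Em : bm * (y - m') - bm * (y - m) = - (bm * dl) by rewrite /dl; ring.
rewrite Ep Em !normrN !normrM (ger0_norm dl0) in hp' hm'.
set A := expR (bp * (y - m')) in hp hp' *; set A0 := expR (bp * (y - m)) in hp' *.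
set B := expR (bm * (y - m')) in hm hm' *; set B0 := expR (bm * (y - m)) in hm' *.
(* Three groups: the remainder of [G], products of a coefficient change with the deviation of an
   exponential from 1, and the remainders of the exponentials. The linear terms cancel through
   [coefpm_der]. *)
have -> : fall m' y - fall m y =
    (G m' - G m - (b * G m - c * f m) * dl) +
    ((coefp m' - coefp m) * (A - 1) + (coefm m' - coefm m) * (B - 1)) +
    (coefp m * (A - A0 - - (bp * dl)) + coefm m * (B - B0 - - (bm * dl))).
  by rewrite -coefpm_der -(coefpDm m') -(coefpDm m) /fall -/A -/A0 -/B -/B0; ring.
have t1 := Gder mm'.
have t2 : `|(coefp m' - coefp m) * (A - 1)| <= C1 * dl * eta.
  by rewrite normrM ler_pM// (le_trans (coefp_lip _ _))// ger0_norm.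
have t3 : `|(coefm m' - coefm m) * (B - 1)| <= C1 * dl * eta.
  by rewrite normrM ler_pM// (le_trans (coefm_lip _ _))// ger0_norm.
have kp : `|bp| <= k by rewrite /k lerDl.
have km : `|bm| <= k by rewrite /k lerDr.
have t4 : `|coefp m * (A - A0 - - (bp * dl))| <= C1 * (k * dl * eta).
  rewrite normrM ler_pM ?coefp_le// (le_trans hp')// ler_wpM2r// ler_wpM2r//.
have t5 : `|coefm m * (B - B0 - - (bm * dl))| <= C1 * (k * dl * eta).
  rewrite normrM ler_pM ?coefm_le// (le_trans hm')// ler_wpM2r// ler_wpM2r//.
apply: (@le_trans _ _ (K * dl ^+ 2 + (C1 * dl * eta + C1 * dl * eta) +
  (C1 * (k * dl * eta) + C1 * (k * dl * eta)))).
  do 2 (apply: le_trans (ler_normD _ _) _; apply: lerD => //);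
  by apply: le_trans (ler_normD _ _) _; apply: lerD.
have : K * dl ^+ 2 <= K * o * expR (k * o) * dl.
  rewrite expr2 mulrA ler_wpM2r// -mulrA ler_wpM2l//.
  by apply: (le_trans dm); rewrite ler_peMr.
have -> : (K + 2 * C1 * k + 2 * C1 * k ^+ 2) * o * expR (k * o) * dl =
  K * o * expR (k * o) * dl + (2 * C1 * dl * eta + 2 * C1 * (k * dl * eta)).
  by rewrite /eta; ring.
lra.
Qed.

(** Unlike in [fall_reflect], the bound carries no factor [m' - m]: the two regimes agree near the
    diagonal only up to order [o]. *)
Lemma recovery_to_fall m m' y o : m <= m' -> m' - m <= o -> `|y - m| <= o -> `|y - m'| <= o ->
  `|fall m' y - G m * expR (bp * (y - m))| <=
    (K + (2 * C1 + K) * k) * o * expR (k * o).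
Proof.
move=> mm' dm ym ym'; have o0 := le_trans (normr_ge0 _) ym.
have [/expR_sub1_le h1 _] := expk ym o0.
have h2 := fall_near_diag ym'.
have e1 : 1 <= expR (k * o) by rewrite -expR0 ler_expR mulr_ge0.
have h3 : `|G m' - G m| <= K * o * expR (k * o).
  apply: (le_trans (Glip _ _)); rewrite -mulrA ler_wpM2l// ger0_norm ?subr_ge0//.
  by apply: (le_trans dm); rewrite ler_peMr.
have h4 : `|G m * (expR (bp * (y - m)) - 1)| <= K * (k * o * expR (k * o)).
  by rewrite normrM ler_pM.
have -> : fall m' y - G m * expR (bp * (y - m)) = (fall m' y - G m') + (G m' - G m) -
  G m * (expR (bp * (y - m)) - 1) by ring.
apply: le_trans (ler_normB _ _) _.
apply: (@le_trans _ _ (2 * C1 * (k * o * expR (k * o)) + K * o * expR (k * o) + K * (k * o * expR (k * o)))).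
  apply: lerD => //; apply: le_trans (ler_normD _ _) _; exact: lerD.
by rewrite le_eqVlt; apply/orP; left; apply/eqP; ring.
Qed.

End phase.

(** The minimum of [s] and [t] as a real number, for nonnegative [s]. *)
Definition capped {R : realType} (s : \bar R) (t : R) : R :=
  if (s <= t%:E)%E then fine s else t.

Lemma path_cvg {R : realType} (x : R -> R) (u : nat -> R) (s : R) : path_continuous x ->
  (forall n, 0 <= u n) -> 0 <= s -> u n @[n --> \oo] --> s ->
  x (u n) @[n --> \oo] --> x s.
Proof.
move=> cx u0 s0 us; apply/cvgrPdist_lt => e e0.
have [d d0 hd] := cx s e s0 e0.
move/cvgrPdist_lt : us => /(_ d d0) us.
by near=> n; rewrite distrC; apply: hd => //; rewrite distrC; near: n.
Unshelve. all: by end_near. Qed.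

Lemma indicator_telescope {R : realType} (F : nat -> R) i j n : (i <= j)%N ->
  \sum_(0 <= m < n) ((i <= m) && (m < j))%N%:R * (F m.+1 - F m) =
  F (minn j n) - F (minn i n).
Proof.
move=> ij; elim: n => [|n IH]; first by rewrite big_geq// !minn0 subrr.
rewrite big_nat_recr//= IH; case: (leqP i n) => [i_n|n_i] /=; last first.
  rewrite mul0r addr0 !(minn_idPr _)//; try lia.
  by rewrite !subrr.
rewrite (minn_idPl (leqW i_n)).
case: (ltnP n j) => nj; last by rewrite mul0r addr0 !(minn_idPl _)//; lia.
by rewrite mul1r (minn_idPr nj); ring.
Qed.

Lemma lipschitz_real_continuous {R : realType} (h : R -> R) K :
  (forall m m', `|h m' - h m| <= K * `|m' - m|) -> continuous h.
Proof.
move=> hK m; apply/cvgrPdist_le => e e0.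
have K1 : 0 < `|K| + 1 by rewrite ltr_wpDl.
near=> m'; rewrite distrC; apply: (le_trans (hK _ _)).
have hm : `|m' - m| < e / (`|K| + 1).
  near: m'; exists (e / (`|K| + 1)); first by rewrite /= divr_gt0.
  by move=> z /=; rewrite distrC.
apply: (@le_trans _ _ ((`|K| + 1) * `|m' - m|)).
  by rewrite ler_wpM2r// (le_trans (ler_norm _))// lerDl.
by rewrite mulrC -ler_pdivlMr// ltW.
Unshelve. all: by end_near. Qed.

(** * One phase along a fixed path *)

Section phase_path.
Context {T : Type} {R : realType}.
Variables (bp bm b c K : R) (G f : R -> R).
Hypothesis bpm : 0 < bp - bm.
Hypothesis bp0 : 0 <= bp.
Hypothesis GK : forall m, `|G m| <= K.
Hypothesis fK : forall m, `|f m| <= K.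
Hypothesis Glip : forall m m', `|G m' - G m| <= K * `|m' - m|.
Hypothesis flip : forall m m', `|f m' - f m| <= K * `|m' - m|.
Hypothesis Gder : forall m m', m <= m' ->
  `|G m' - G m - (b * G m - c * f m) * (m' - m)| <= K * (m' - m) ^+ 2.
Variables (l a : R) (X : R -> T -> R) (w : T) (k : nat).
Hypothesis l0 : 0 < l.
Hypothesis a0 : 0 < a.
Hypothesis cX : path_continuous (X ^~ w).
Local Notation M t := (running_max X t w).
Local Notation S := (recovery_drawdown X a k w).
Local Notation S' := (recovery_drawdown X a k.+1 w).
Local Notation fallv := (fall bp bm b c G f).
Local Notation kk := (`|bp| + `|bm|).
Local Notation C1 := ((`|b| + `|c| + kk) * K / (bp - bm)).

Definition level := running_max X (fine S) w.

(* The value function, with the maximum frozen at time [t] and the position taken at time [u]. *)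
Definition value t u :=
  if M t <= level then G level * expR (bp * (X u w - level)) else fallv (M t) (X u w).

Definition dvalue t := expR (- (l * t)) * value t t.

Let K0 : 0 <= K. Proof. exact: le_trans (normr_ge0 _) (GK 0). Qed.
Let C10 : 0 <= C1.
Proof. by apply: divr_ge0; [apply: mulr_ge0 => //; rewrite !addr_ge0|exact: ltW]. Qed.

Lemma level_le t : (S <= t%:E)%E -> level <= M t.
Proof.
move=> St; have SE := recovery_drawdown_fineK cX a0 (le_lt_trans St (ltry _)).
apply: running_max_mono => //; first exact: fine_recovery_drawdown_ge0.
by move: St; rewrite SE lee_fin.
Qed.

(** A drawdown above [a] would persist slightly before [t] together with [level < M], and [S'] would
    fall strictly before [t]. *)
Lemma drawdown_le_recovering t : 0 <= t -> (t%:E <= S')%E -> (S <= t%:E)%E -> level < M t ->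
  M t - X t w <= a.
Proof.
move=> t0 tS' St Mt; rewrite leNgt; apply/negP => aD.
have aD' : 0 < M t - X t w - a by lra.
have Mt' : 0 < M t - level by rewrite subr_gt0.
have [d1 d10 h1] := path_continuous_drawdown cX t0 aD'.
have [d2 d20 h2] := path_continuous_running_max cX t0 Mt'.
(* Room to the left of [t] is required; at time 0 the maximum cannot exceed [level]. *)
have tgt0 : 0 < t.
  rewrite lt_neqAle t0 andbT; apply/eqP => t00; move: Mt; rewrite ltNge => /negP; apply.
  have S0 : (0%:E <= S)%E by exact: recovery_drawdown_ge0.
  rewrite /level; apply: running_max_mono => //.
  by rewrite -t00; exact: fine_recovery_drawdown_ge0.
pose u := Num.max 0 (Num.max (t - d1 / 2) (t - d2 / 2)).
have ut : u < t by rewrite /u !gt_max; lra.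
have [u1 u2 u3] : [/\ 0 <= u, t - d1 / 2 <= u & t - d2 / 2 <= u].
  by rewrite /u !le_max !lexx !orbT.
have := h1 u u1; have := h2 u u1; rewrite !ltr_norml.
have -> : - d1 < u - t < d1 by lra.
have -> : - d2 < u - t < d2 by lra.
move=> /(_ isT)/andP[H1 H2] /(_ isT)/andP[H3 H4].
have aDu : a <= M u - X u w by lra.
have Mu : level < M u by lra.
have Su : (S <= u%:E)%E.
  have SE := recovery_drawdown_fineK cX a0 (le_lt_trans St (ltry _)).
  rewrite SE lee_fin leNgt; apply/negP => uS.
  by move: Mu; rewrite ltNge running_max_mono// ltW.
have : (S' <= u%:E)%E.
  by apply/recovery_drawdownS_leP => //; split => //; exists u; rewrite lexx u1.
by move=> /(le_trans tS'); rewrite lee_fin; lra.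
Qed.

(** Uniform in the path: before the level is exceeded the exponent is nonpositive, and afterwards
    the drawdown stays below [a]. This bound dominates when the horizon tends to infinity. *)
Lemma value_bound t : 0 <= t -> (t%:E <= S')%E -> (S <= t%:E)%E ->
  `|value t t| <= K + 2 * C1 * expR (kk * a).
Proof.
move=> t0 tS' St; rewrite /value; case: ifPn => [Mt|]; last first.
  rewrite -ltNge => Mt; have D := drawdown_le_recovering t0 tS' St Mt.
  have h : `|X t w - M t| <= a.
    have := le_running_max cX (t := t) (u := t); rewrite t0 lexx => /(_ isT) XM.
    by rewrite ler_norml; lra.
  by apply: (le_trans (fall_bound b c bpm GK fK h)); rewrite lerDr.
have e0 : 0 <= 2 * C1 * expR (kk * a) by apply: mulr_ge0; [exact: mulr_ge0|exact: expR_ge0].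
have : `|G level * expR (bp * (X t w - level))| <= K; last lra.
rewrite normrM (ger0_norm (expR_ge0 _)) -[leRHS]mulr1 ler_pM ?expR_ge0//.
rewrite -expR0 ler_expR mulr_ge0_le0// subr_le0 (le_trans _ Mt)//.
by apply: le_running_max => //; rewrite t0 lexx.
Qed.

Lemma dvalue_bound t : 0 <= t -> (t%:E <= S')%E -> (S <= t%:E)%E ->
  `|dvalue t| <= expR (- (l * t)) * (K + 2 * C1 * expR (kk * a)).
Proof.
move=> t0 tS' St; rewrite /dvalue normrM (ger0_norm (expR_ge0 _)).
by rewrite ler_wpM2l ?expR_ge0// value_bound.
Qed.

(* No constraint relating [t] to the drawdown times. *)
Lemma value_bound_sup t u B : 0 <= t -> 0 <= B -> `|M t| <= B -> `|X u w| <= B -> `|level| <= B ->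
  `|value t u| <= (K + 2 * C1) * expR (2 * kk * B).
Proof.
move=> t0 B0 MB XB LB.
have e1 : 0 <= expR (2 * kk * B) by exact: expR_ge0.
have h m : `|m| <= B -> `|X u w - m| <= 2 * B.
  by move=> mB; apply: le_trans (ler_normB _ _) _; lra.
rewrite /value; case: ifPn => _; last first.
  have := fall_bound b c bpm GK fK (h _ MB).
  have -> : kk * (2 * B) = 2 * kk * B by lra.
  by move=> /le_trans; apply; rewrite ler_wpM2r// lerDr.
rewrite normrM (ger0_norm (expR_ge0 _)).
apply: (@le_trans _ _ (K * expR (2 * kk * B))); last first.
  by rewrite ler_wpM2r// lerDl mulr_ge0.
apply: ler_pM => //; rewrite ?expR_ge0// ler_expR.
apply: le_trans (ler_norm _) _; rewrite normrM.
have -> : 2 * kk * B = kk * (2 * B) by lra.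
by apply: ler_pM => //; [rewrite lerDl|exact: h].
Qed.

Let Ce := (K + 2 * C1 * kk + 2 * C1 * kk ^+ 2) + (K + (2 * C1 + K) * kk).
Let kk0 : 0 <= kk. Proof. exact: addr_ge0. Qed.
Let p1 : 0 <= K + 2 * C1 * kk + 2 * C1 * kk ^+ 2.
Proof.
have C2 : 0 <= 2 * C1 by exact: mulr_ge0.
by apply: addr_ge0; [apply: addr_ge0 => //; exact: mulr_ge0|apply: mulr_ge0 => //; exact: sqr_ge0].
Qed.
Let p2 : 0 <= K + (2 * C1 + K) * kk.
Proof. by apply: addr_ge0 => //; apply: mulr_ge0 => //; apply: addr_ge0 => //; exact: mulr_ge0. Qed.
Let Ce0 : 0 <= Ce. Proof. exact: addr_ge0. Qed.
(** The maximum plus a unit jump when it first exceeds [level]. Its increments dominate both kinds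
    of error: those of the fall, proportional to the increase of [M], and the single switch of
    regime. *)
Let potential t := M t + (level < M t)%R%:R.

Let potential_mono s t : 0 <= s -> s <= t -> potential s <= potential t.
Proof.
move=> s0 st; have Mst := running_max_mono cX s0 st.
apply: lerD => //; rewrite ler_nat; case: ltP => // h.
by rewrite (lt_le_trans h Mst).
Qed.

(** If the maximum is unchanged there is no error. Otherwise a new maximum is reached within the
    step, so position and both maxima lie within the oscillation [o]; [fall_reflect] or
    [recovery_to_fall] applies according to whether the level was already exceeded. *)
Lemma value_step_error t t' o : 0 <= t -> t <= t' -> (S <= t%:E)%E ->
  (forall u, t <= u <= t' -> forall v, t <= v <= t' -> `|X u w - X v w| <= o) ->
  `|dvalue t' - expR (- (l * t')) * value t t'| <=
     Ce * (o * expR (kk * o)) * (potential t' - potential t).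
Proof.
move=> t0 tt' St osc.
have o0 : 0 <= o by have := osc t _ t _; rewrite subrr normr0; apply; rewrite lexx.
have oe0 : 0 <= o * expR (kk * o) by rewrite mulr_ge0// expR_ge0.
have Mtt' := running_max_mono cX t0 tt'.
rewrite /dvalue -mulrBr normrM (ger0_norm (expR_ge0 _)).
have el : expR (- (l * t')) <= 1.
  by rewrite -expR0 ler_expR oppr_le0 mulr_ge0 ?(ltW l0)// (le_trans t0).
have red : forall q r, 0 <= q -> q <= r -> expR (- (l * t')) * q <= r.
  move=> q r q0 qr; apply: le_trans qr; rewrite -[leRHS]mul1r ler_wpM2r//.
apply: red => //.
have [MM|] := eqVneq (M t) (M t').
  rewrite /value MM subrr normr0 !mulr_ge0// subr_ge0; exact: potential_mono.
move=> neM; have {neM} Mlt : M t < M t' by rewrite lt_neqAle neM.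
have [u /andP[tu ut'] Xu] := running_max_new cX t0 tt' Mlt.
have XtM : X t w <= M t by apply: le_running_max => //; rewrite t0 lexx.
have XtM' : X t' w <= M t' by apply: le_running_max => //; rewrite lexx (le_trans t0).
have := osc u _ t _; rewrite (ltW tu) ut' lexx tt' => /(_ isT isT); rewrite Xu => o1.
have := osc u _ t' _; rewrite (ltW tu) ut' lexx tt' => /(_ isT isT); rewrite Xu => o2.
have := osc t' _ t _; rewrite !lexx tt' => /(_ isT isT) => o3.
have d1 : M t' - M t <= o by move: o1; rewrite ler_norml; lra.
have d2 : `|X t' w - M t'| <= o by rewrite distrC.
have d3 : `|X t' w - M t| <= o.
  by move: o2 o3; rewrite !ler_norml => /andP[? ?] /andP[? ?]; apply/andP; split; lra.
have LM := level_le St.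
rewrite /value; have -> : (M t' <= level) = false by apply/negbTE; rewrite -ltNge (le_lt_trans LM).
have pe : 0 <= Ce * (o * expR (kk * o)) by rewrite mulr_ge0.
case: ifPn => [ML|]; last first.
  rewrite -ltNge => ML.
  have -> : potential t' - potential t = M t' - M t.
    by rewrite /potential ML (lt_trans ML Mlt); lra.
  have := fall_reflect bpm GK fK Glip flip Gder (ltW Mlt) d1 d3 d2.
  move=> /le_trans; apply; rewrite ler_wpM2r ?subr_ge0// -mulrA ler_wpM2r//.
  by rewrite lerDl.
have LE : level = M t by apply/eqP; rewrite eq_le LM ML.
have pp : 1 <= potential t' - potential t.
  by rewrite /potential LE Mlt ltxx/= mulr1n mulr0n; lra.
rewrite LE; have := recovery_to_fall b c bpm GK fK Glip (ltW Mlt) d1 d3 d2.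
move=> /le_trans; apply.
apply: (@le_trans _ _ (Ce * (o * expR (kk * o)))); last by rewrite ler_peMr.
by rewrite -mulrA ler_wpM2r// lerDr.
Qed.

Section sums.
Variables (t : R) (N : nat).
Hypothesis t0 : 0 < t.
Local Notation gr := (grid t N).

Definition active j : R := ((S <= (gr j)%:E)%E && ((gr j)%:E < S')%E)%:R.

(** Regime and coefficients are those of the left grid point, which makes the terms martingale
    differences; [error_sum] collects the corrections at the right grid point. *)
Definition frozen_sum := \sum_(0 <= j < N.+1)
  active j * (expR (- (l * gr j.+1)) * value (gr j) (gr j.+1) - dvalue (gr j)).

Definition error_sum := \sum_(0 <= j < N.+1)
  active j * (dvalue (gr j.+1) - expR (- (l * gr j.+1)) * value (gr j) (gr j.+1)).

Lemma tau_leS : (S <= S')%E.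
Proof.
have [S'oo|] := eqVneq S' +oo%E; first by rewrite S'oo leey.
by rewrite -ltey => /(recovery_drawdownS_gt cX a0); exact: ltW.
Qed.

(** The active cells are those from the grid index [i] of [S] up to the index [j] of [S'], so the
    increments of [dvalue] telescope. The last conjunct keeps the description of both indices for
    the passage to the limit. *)
Lemma frozen_sumE : exists i j : nat, [/\ (i <= N.+1)%N, (j <= N.+1)%N,
  frozen_sum = dvalue (gr j) - dvalue (gr i) - error_sum &
  forall (s : \bar R) h, (s, h) = (S, i) \/ (s, h) = (S', j) ->
    [/\ forall i', (i' <= N)%N -> (s <= (gr i')%:E)%E = (h <= i')%N,
     forall s', s = s'%:E -> s' <= t -> s' <= gr h < s' + t / N.+1%:R
    & (t%:E < s)%E -> h = N.+1]].
Proof.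
have [i [iN hi1 hi2 hi3]] := grid_index N t0 (recovery_drawdown_ge0 cX a0 k).
have [j [jN hj1 hj2 hj3]] := grid_index N t0 (recovery_drawdown_ge0 cX a0 k.+1).
exists i, j; split => //; last by move=> s h [] [-> ->].
have ij : (i <= j)%N.
  have [jN'|] := leqP j N; last by move=> Nj; rewrite (leq_trans iN).
  by rewrite -hi1// (le_trans tau_leS)// hj1.
rewrite /frozen_sum /error_sum; apply/eqP; rewrite -subr_eq0 opprB addrA [X in X - _]addrC.
have -> : \sum_(0 <= j < N.+1) active j * (dvalue (gr j.+1) - expR (- (l * gr j.+1)) * value (gr j) (gr j.+1))
  + \sum_(0 <= j < N.+1) active j * (expR (- (l * gr j.+1)) * value (gr j) (gr j.+1) - dvalue (gr j))
  = \sum_(0 <= j < N.+1) active j * (dvalue (gr j.+1) - dvalue (gr j)).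
  by rewrite -big_split/=; apply: eq_bigr => i' _; rewrite -mulrDr; congr (_ * _); ring.
rewrite (eq_big_nat _ _ (F2 := fun i' => ((i <= i') && (i' < j))%N%:R * (dvalue (gr i'.+1) - dvalue (gr i')))).
  by rewrite indicator_telescope// !(minn_idPl _)// subrr.
move=> i' /andP[_]; rewrite ltnS => i'N.
by rewrite /active hi1// [X in _ && X]ltNge hj1// -ltnNge.
Qed.

(** The cell errors telescope through [potential], whose total increase is at most
    [M t - M 0 + 1]. *)
Lemma error_sum_le o :
  (forall u, 0 <= u <= t -> forall v, 0 <= v <= t -> `|u - v| <= t / N.+1%:R -> `|X u w - X v w| <= o) ->
  `|error_sum| <= Ce * (o * expR (kk * o)) * (M t - M 0 + 1).
Proof.
move=> osc.
have o0 : 0 <= o.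
  have := osc 0 _ 0 _; rewrite subrr normr0 lexx (ltW t0) subrr normr0; apply => //.
  exact: ltW (grid_step_gt0 N t0).
have pe : 0 <= Ce * (o * expR (kk * o)).
  by apply: mulr_ge0 => //; apply: mulr_ge0 => //; exact: expR_ge0.
apply: le_trans (ler_norm_sum _ _ _) _.
apply: (@le_trans _ _ (\sum_(0 <= j < N.+1) Ce * (o * expR (kk * o)) * (potential (gr j.+1) - potential (gr j)))).
  rewrite big_nat_cond [leRHS]big_nat_cond; apply: ler_sum => j /andP[/andP[_ jN] _].
  have g0 : 0 <= gr j by exact: grid_ge0.
  have gS : gr j <= gr j.+1 by exact: ltW (grid_ltS N j t0).
  have gt : gr j.+1 <= t by rewrite -[leRHS](gridN t N) grid_le.
  rewrite /active normrM; have [/andP[Sj _]|_] := boolP ((_ <= _)%E && (_ < _)%E); last first.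
    by rewrite normr0 mul0r mulr_ge0// subr_ge0 potential_mono.
  rewrite normr1 mul1r; apply: value_step_error => // u /andP[u1 u2] v /andP[v1 v2].
  apply: osc; rewrite ?(le_trans g0)//= ?(le_trans _ gt)//.
  have -> : t / N.+1%:R = gr j.+1 - gr j by rewrite gridS addrAC subrr add0r.
  by rewrite ler_norml; apply/andP; split; lra.
rewrite -mulr_sumr telescope_sumr// gridN grid0 ler_wpM2l// /potential.
have : ((level < M t)%R%:R : R) <= 1 by rewrite lern1; case: (_ < _).
have : (0 : R) <= (level < M 0)%R%:R by [].
lra.
Qed.

End sums.

Lemma error_sum_cvg t : 0 < t -> error_sum t N @[N --> \oo] --> 0.
Proof.
move=> t0; apply/cvgrPdist_le => e e0.
(* The factor [expR kk] covers [expR (kk * o)] for [o <= 1]; the final 1 makes [Q] positive. *)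
set Q := `|Ce| * expR kk * `|M t - M 0 + 1| + 1.
have Q0 : 0 < Q by rewrite ltr_wpDl// !mulr_ge0// expR_ge0.
pose o := Num.min 1 (e / Q).
have o0 : 0 < o by rewrite lt_min ltr01 divr_gt0.
have [d d0 hd] := path_Heine t cX o0.
near=> N; rewrite sub0r normrN.
have Nd : t / N.+1%:R < d by near: N; exact: grid_step_lt.
have := @error_sum_le t N t0 o; move=> h; apply: (le_trans (h _)).
  by move=> u u0 v v0 uv; apply/ltW/hd => //; exact: le_lt_trans Nd.
apply: le_trans (ler_norm _) _; rewrite !normrM (ger0_norm (ltW o0)) (ger0_norm (expR_ge0 _)).
have o1 : o <= 1 by rewrite ge_min lexx.
have oQ : o <= e / Q by rewrite ge_min lexx orbT.
apply: (@le_trans _ _ (o * (Q - 1))).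
  have -> : `|Ce| * (o * expR (kk * o)) * `|M t - M 0 + 1| = o * (`|Ce| * expR (kk * o) * `|M t - M 0 + 1|) by ring.
  rewrite ler_wpM2l ?(ltW o0)// /Q addrK ler_wpM2r// ler_wpM2l// ler_expR.
  by rewrite ler_piMr.
apply: (@le_trans _ _ (e / Q * Q)); last by rewrite divfK// gt_eqF.
by apply: ler_pM => //; [exact: ltW|rewrite subr_ge0 /Q lerDr !mulr_ge0// expR_ge0|lra].
Unshelve. all: by end_near. Qed.

Let Gcont : continuous G. Proof. exact: lipschitz_real_continuous Glip. Qed.
Let fcont : continuous f. Proof. exact: lipschitz_real_continuous flip. Qed.

(** Above the level the fall regime persists after [s]. In recovery, [X s w < M s] keeps the maximum
    unchanged for a short while, so the regime does not switch immediately. *)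
Lemma dvalue_cvg_right (s : R) (u : nat -> R) : 0 <= s -> (forall n, s <= u n) ->
  u n @[n --> \oo] --> s -> level < M s \/ M s <= level /\ X s w < M s ->
  dvalue (u n) @[n --> \oo] --> dvalue s.
Proof.
move=> s0 su us.
have u0 n : 0 <= u n by exact: le_trans (su n).
have cXu : X (u n) w @[n --> \oo] --> X s w by exact: (path_cvg cX).
have cMu : M (u n) @[n --> \oo] --> M s.
  by apply: (path_cvg (x := fun t => M t)) => //; exact: path_continuous_running_max.
have cE : expR (- (l * u n)) @[n --> \oo] --> expR (- (l * s)).
  apply: (cvg_comp _ expR); last exact: continuous_expR.
  by apply: cvgN; exact: cvgMl_tmp.
have cexp beta (v : nat -> R) v0 : v n @[n --> \oo] --> v0 ->
    expR (beta * (X (u n) w - v n)) @[n --> \oo] --> expR (beta * (X s w - v0)).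
  move=> cv; apply: (cvg_comp _ expR); last exact: continuous_expR.
  by apply: cvgMl_tmp; exact: cvgB.
case=> [Ms|[Ms XM]].
  have E n : dvalue (u n) = expR (- (l * u n)) * fallv (M (u n)) (X (u n) w).
    rewrite /dvalue /value; case: ifPn => //; rewrite leNgt (lt_le_trans Ms)//.
    exact: running_max_mono.
  rewrite (_ : dvalue s = expR (- (l * s)) * fallv (M s) (X s w)); last first.
    by rewrite /dvalue /value leNgt Ms.
  rewrite (eq_cvg _ _ E); apply: cvgM => //.
  have cG : G (M (u n)) @[n --> \oo] --> G (M s) by exact: (cvg_comp _ _ cMu (@Gcont _)).
  have cf : f (M (u n)) @[n --> \oo] --> f (M s) by exact: (cvg_comp _ _ cMu (@fcont _)).
  apply: cvgD; (apply: cvgM; last exact: cexp).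
    by apply: cvgMr_tmp; apply: cvgB; exact: cvgMl_tmp.
  by apply: cvgMr_tmp; apply: cvgD; exact: cvgMl_tmp.
rewrite (_ : dvalue s = expR (- (l * s)) * (G level * expR (bp * (X s w - level)))); last first.
  by rewrite /dvalue /value Ms.
apply: (@cvg_trans _ (expR (- (l * u n)) * (G level * expR (bp * (X (u n) w - level))) @[n --> \oo])); last first.
  apply: cvgM; [exact: cE|apply: cvgMl_tmp].
  by apply: cexp; exact: cvg_cst.
have XM0 : 0 < M s - X s w by rewrite subr_gt0.
have [d d0 hd] := cX s0 XM0.
apply: near_eq_cvg; near=> n.
have und : `|s - u n| < d by near: n; move/cvgrPdist_lt: us; exact.
suff ME : M (u n) = M s by rewrite /dvalue /value ME Ms.
apply/eqP; rewrite eq_le [X in _ && X]running_max_mono// andbT leNgt; apply/negP => MM.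
have [v /andP[sv vu] Xv] := running_max_new cX s0 (su n) MM.
have v0 : 0 <= v by rewrite (le_trans s0)// ltW.
have vsd : `|v - s| < d.
  by move: und; rewrite !ltr_norml => /andP[? ?]; apply/andP; split; lra.
by have := hd v v0 vsd; rewrite Xv ltr_norml; lra.
Unshelve. all: by end_near. Qed.

(** The grid points approach [s] from the right. The time 0, where the path sits at its maximum, is
    treated apart: it is itself a grid point, so no limit is taken. *)
Lemma dvalue_grid_cvg t (s : \bar R) (i : nat -> nat) : 0 < t -> (0 <= s)%E ->
  (forall N, [/\ forall i', (i' <= N)%N -> (s <= (grid t N i')%:E)%E = (i N <= i')%N,
     forall s', s = s'%:E -> s' <= t -> s' <= grid t N (i N) < s' + t / N.+1%:R
    & (t%:E < s)%E -> i N = N.+1]) ->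
  (forall s', s = s'%:E -> s' = 0 \/ level < M s' \/ M s' <= level /\ X s' w < M s') ->
  dvalue (grid t N (i N)) @[N --> \oo] --> dvalue (capped s t).
Proof.
move=> t0 s0 hi hs; rewrite /capped; case: ifPn => [|]; last first.
  rewrite -ltNge => ts; have E N : dvalue (grid t N (i N)) = dvalue t.
    by have [_ _ /(_ ts) ->] := hi N; rewrite gridN.
  by rewrite (eq_cvg _ _ E); exact: cvg_cst.
case: s s0 hi hs => // s s0 hi hs; rewrite lee_fin => st /=; rewrite lee_fin in s0.
have [s'0|{}hs] := hs s erefl; first rewrite s'0.
  have E N : dvalue (grid t N (i N)) = dvalue 0.
    have [h _ _] := hi N; move: (h 0%N (leq0n _)).
    by rewrite grid0 s'0 lexx leqn0 => /esym/eqP ->; rewrite grid0.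
  by rewrite (eq_cvg _ _ E); exact: cvg_cst.
apply: dvalue_cvg_right => //.
  by move=> N; have [_ /(_ s erefl st)/andP[]] := hi N.
apply/cvgrPdist_lt => e e0; near=> N.
have [_ /(_ s erefl st)/andP[h1 h2] _] := hi N.
have h3 : t / N.+1%:R < e by near: N; exact: grid_step_lt.
have h4 : grid t N (i N) < s + e by apply: lt_trans h2 _; rewrite ltrD2l.
by rewrite distrC ger0_norm ?subr_ge0//; lra.
Unshelve. all: by end_near. Qed.

Lemma frozen_sum_cvg t : 0 < t ->
  frozen_sum t N @[N --> \oo] --> dvalue (capped S' t) - dvalue (capped S t).
Proof.
move=> t0.
have h N : exists ij : nat * nat, frozen_sum t N =
    dvalue (grid t N ij.2) - dvalue (grid t N ij.1) - error_sum t N /\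
    forall (s : \bar R) h, (s, h) = (S, ij.1) \/ (s, h) = (S', ij.2) ->
    [/\ forall i', (i' <= N)%N -> (s <= (grid t N i')%:E)%E = (h <= i')%N,
     forall s', s = s'%:E -> s' <= t -> s' <= grid t N h < s' + t / N.+1%:R
    & (t%:E < s)%E -> h = N.+1].
  by have [i [j [_ _ E hij]]] := frozen_sumE N t0; exists (i, j).
have [ij hij] := choice h.
have E N : frozen_sum t N = dvalue (grid t N (ij N).2) - dvalue (grid t N (ij N).1) - error_sum t N.
  by have [] := hij N.
rewrite (eq_cvg _ _ E) -[dvalue (capped S' t) - _]subr0.
apply: cvgB; last exact: error_sum_cvg.
apply: cvgB.
  apply: dvalue_grid_cvg => //; first exact: recovery_drawdown_ge0.
    by move=> N; have [_ hN] := hij N; apply: hN; right.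
  move=> s' S's'; right; left.
  have [Sy|] := eqVneq S +oo%E; first by move: S's'; rewrite recovery_drawdownS_y.
  rewrite -ltey => /(recovery_drawdown_fineK cX a0) SE.
  have [[S'y _]|[s1 [S's1 _ _ Ms1 _]]] := recovery_drawdownS_spec cX a0 SE.
    by rewrite S'y in S's'.
  by have <- : s1 = s' by move: S's'; rewrite S's1 => -[].
apply: dvalue_grid_cvg => //; first exact: recovery_drawdown_ge0.
  by move=> N; have [_ hN] := hij N; apply: hN; left.
move=> s' Ss'; have levelE : level = M s' by rewrite /level Ss'.
(* [S] is 0 for the first phase; later the path is at distance [a > 0] below its maximum at [S]. *)
case: k Ss' levelE => [|k'] Ss' levelE; first by left; case: Ss'.
right; right; rewrite levelE lexx; split => //.
have := drawdown_at_recovery_drawdown cX a0 (k := k'); rewrite Ss' ltry => /(_ isT) /=.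
by move=> DE; rewrite -subr_gt0 DE.
Qed.

End phase_path.

(** * Expectation over one phase *)

Section dct.
Context {d : measure_display} {T : measurableType d} {R : realType} (P : probability T R).

Lemma integral_cvg_dominated (F : nat -> T -> R) (h g : T -> R) :
  (forall n, measurable_fun setT (F n)) ->
  (forall w, F n w @[n --> \oo] --> h w) ->
  P.-integrable setT (EFin \o g) -> (forall n w, `|F n w| <= g w) ->
  [/\ measurable_fun setT h, P.-integrable setT (EFin \o h) &
    (\int[P]_w (F n w)%:E)%E @[n --> \oo] --> (\int[P]_w (h w)%:E)%E].
Proof.
move=> mF Fh ig Fg.
have mh : measurable_fun setT h by apply: (measurable_fun_cvg mF) => w _; exact: Fh.
have [|||||ih _ ch] := @dominated_convergence _ _ _ P setT measurableT
  (fun n w => (F n w)%:E) (EFin \o h) (EFin \o g).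
- by move=> n; exact/measurable_EFinP.
- exact/measurable_EFinP.
- by apply: aeW => w _; apply: cvg_EFin; [exact: nearW|exact: Fh].
- exact: ig.
- by apply: aeW => w n _; rewrite lee_fin.
- by split.
Qed.

End dct.

Section phase_expectation.
Context {d : measure_display} {T : measurableType d} {R : realType}.
Variables (P : probability T R) (W : R -> {RV P >-> R}).
Hypothesis hW : standard_brownian_motion W.
Variables (bp bm b c K : R) (G f : R -> R).
Hypothesis bpm : 0 < bp - bm.
Hypothesis bp0 : 0 <= bp.
Hypothesis GK : forall m, `|G m| <= K.
Hypothesis fK : forall m, `|f m| <= K.
Hypothesis Glip : forall m m', `|G m' - G m| <= K * `|m' - m|.
Hypothesis flip : forall m m', `|f m' - f m| <= K * `|m' - m|.
Hypothesis Gder : forall m m', m <= m' ->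
  `|G m' - G m - (b * G m - c * f m) * (m' - m)| <= K * (m' - m) ^+ 2.
Variables (l a mu sigma : R) (k : nat).
Hypothesis l0 : 0 < l.
Hypothesis a0 : 0 < a.
Hypothesis hbp : mu * bp + (bp * sigma) ^+ 2 / 2 = l.
Hypothesis hbm : mu * bm + (bm * sigma) ^+ 2 / 2 = l.
Local Notation Wt := (fun t w => W t w).
Local Notation X := (drifted mu sigma Wt).
Local Notation M t w := (running_max X t w).
Local Notation S := (recovery_drawdown X a k).
Local Notation S' := (recovery_drawdown X a k.+1).
Local Notation kk := (`|bp| + `|bm|).
Local Notation C1 := ((`|b| + `|c| + kk) * K / (bp - bm)).
Local Notation dval := (dvalue bp bm b c G f l a X).
Local Notation coefP := (coefp bp bm b c G f).
Local Notation coefM := (coefm bp bm b c G f).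

Let cX w : path_continuous (X ^~ w). Proof. exact: drifted_path_continuous. Qed.
Let K0 : 0 <= K. Proof. exact: le_trans (normr_ge0 _) (GK 0). Qed.
Let C10 : 0 <= C1.
Proof. by apply: divr_ge0; [apply: mulr_ge0 => //; rewrite !addr_ge0|exact: ltW]. Qed.
Let kk0 : 0 <= kk. Proof. exact: addr_ge0. Qed.
Let mG : measurable_fun setT G.
Proof. by apply: continuous_measurable_fun; exact: lipschitz_real_continuous Glip. Qed.
Let mf : measurable_fun setT f.
Proof. by apply: continuous_measurable_fun; exact: lipschitz_real_continuous flip. Qed.

Section one_horizon.
Variable t : R.
Hypothesis t0 : 0 < t.

Let act N j w := active a X w k t N j.

(** Factor of the [bp] exponential's martingale difference on cell [j]. It uses [stopped_max] in
    place of [level], which is the same on active cells but known at the grid time. During recovery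
    only [bp] occurs, so [weightm] is then 0. *)
Let weightp N j w := act N j w *
  ((if M (grid t N j) w <= stopped_max W mu sigma a k (grid t N j) w
    then G (stopped_max W mu sigma a k (grid t N j) w) *
         expR (bp * (X (grid t N j) w - stopped_max W mu sigma a k (grid t N j) w))
    else coefP (M (grid t N j) w) * expR (bp * (X (grid t N j) w - M (grid t N j) w)))
  * expR (- (l * grid t N j))).

Let weightm N j w := act N j w *
  ((if M (grid t N j) w <= stopped_max W mu sigma a k (grid t N j) w then 0
    else coefM (M (grid t N j) w) * expR (bm * (X (grid t N j) w - M (grid t N j) w)))
  * expR (- (l * grid t N j))).

Let past_act N j : past_measurable Wt (grid t N j) (act N j).
Proof.
have g0 : 0 <= grid t N j by exact: grid_ge0.
have -> : act N j = \1_([set w | (S w <= (grid t N j)%:E)%E] `\` [set w | (S' w <= (grid t N j)%:E)%E]).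
  apply/funext => w; rewrite /act /active indicE; congr (nat_of_bool _)%:R.
  rewrite ltNge; apply/idP/idP => [/andP[h1 h2]|].
    by rewrite inE; split => //; exact/negP.
  by rewrite inE => -[h1 /negP h2]; apply/andP.
apply: measurable_indic; apply: measurableD.
  by have [] := past_recovery_drawdown mu sigma hW a0 k g0.
by have [] := past_recovery_drawdown mu sigma hW a0 k.+1 g0.
Qed.

Let past_pieces N j :
  [/\ past_measurable Wt (grid t N j) (running_max X (grid t N j)),
      past_measurable Wt (grid t N j) (X (grid t N j)) &
      past_measurable Wt (grid t N j) (stopped_max W mu sigma a k (grid t N j))].
Proof.
have g0 : 0 <= grid t N j by exact: grid_ge0.
split.
- by apply: (past_running_max _ _ hW); rewrite g0 lexx.
- by apply: past_drifted; rewrite g0 lexx.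
- by have [] := past_recovery_drawdown mu sigma hW a0 k g0.
Qed.

Let pastT N j := g_sigma_algebraType (past_cylinder Wt (grid t N j)).

Let measurable_exp_diff N j beta (u v : T -> R) :
  past_measurable Wt (grid t N j) u -> past_measurable Wt (grid t N j) v ->
  past_measurable Wt (grid t N j) (fun w => expR (beta * (u w - v w))).
Proof.
move=> mu' mv; apply: (@measurableT_comp _ _ _ (pastT N j) _ _ expR) => //.
by apply: measurable_funM; [exact: measurable_cst|exact: measurable_funB].
Qed.

Let mcoefP : measurable_fun setT coefP.
Proof.
by apply: measurable_funM => //; apply: measurable_funB; exact: measurable_funM.
Qed.

Let mcoefM : measurable_fun setT coefM.
Proof.
by apply: measurable_funM => //; apply: measurable_funD; exact: measurable_funM.
Qed.

Let past_weightp N j : past_measurable Wt (grid t N j) (weightp N j).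
Proof.
have [mM mX mS] := past_pieces N j.
apply: measurable_funM; first exact: past_act.
apply: measurable_funM; last exact: measurable_cst.
apply: (@measurable_fun_ifT _ _ (pastT N j) R); first exact: measurable_fun_ler.
  apply: measurable_funM; last exact: measurable_exp_diff.
  exact: (@measurableT_comp _ _ _ (pastT N j) _ _ G).
apply: measurable_funM; last exact: measurable_exp_diff.
exact: (@measurableT_comp _ _ _ (pastT N j) _ _ coefP).
Qed.

Let past_weightm N j : past_measurable Wt (grid t N j) (weightm N j).
Proof.
have [mM mX mS] := past_pieces N j.
apply: measurable_funM; first exact: past_act.
apply: measurable_funM; last exact: measurable_cst.
apply: (@measurable_fun_ifT _ _ (pastT N j) R); first exact: measurable_fun_ler.
  exact: measurable_cst.
apply: measurable_funM; last exact: measurable_exp_diff.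
exact: (@measurableT_comp _ _ _ (pastT N j) _ _ coefM).
Qed.

Let level_stopped N j w : act N j w != 0 ->
  [/\ (S w <= (grid t N j)%:E)%E, ((grid t N j)%:E < S' w)%E &
   stopped_max W mu sigma a k (grid t N j) w = level a X w k].
Proof.
rewrite /act /active; case: (boolP (_ && _)) => [/andP[h1 h2] _|]; last by rewrite eqxx.
by split => //; rewrite /stopped_max h1.
Qed.

Let el_le1 N j : expR (- (l * grid t N j)) <= 1.
Proof. by rewrite -expR0 ler_expR oppr_le0 mulr_ge0 ?grid_ge0 ?(ltW l0). Qed.

Let act01 N j w : `|act N j w| <= 1.
Proof. by rewrite /act /active; case: (_ && _); rewrite ?normr1 ?normr0. Qed.

Let weight_aux (x y C : R) : `|x| <= 1 -> 0 <= y -> y <= 1 -> forall z : R, `|z| <= C -> `|x * (z * y)| <= C.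
Proof.
move=> x1 y0 y1 z zC; have C0 := le_trans (normr_ge0 _) zC.
rewrite !normrM (ger0_norm y0) -[leRHS]mul1r ler_pM ?mulr_ge0//.
by rewrite -[leRHS]mulr1 ler_pM.
Qed.

Let fall_exp N j (beta C : R) w : act N j w != 0 -> `|beta| <= kk -> forall z : R, `|z| <= C ->
  ~~ (M (grid t N j) w <= level a X w k) ->
  `|z * expR (beta * (X (grid t N j) w - M (grid t N j) w))| <= C * expR (kk * a).
Proof.
move=> /level_stopped[h1 h2 _] bk z zC; rewrite -ltNge => Mt.
have g0 : 0 <= grid t N j by exact: grid_ge0.
have D := drawdown_le_recovering a0 (cX w) g0 (ltW h2) h1 Mt.
have XM := le_running_max (cX w) (t := grid t N j) (u := grid t N j).
rewrite g0 lexx in XM; have {}XM := XM isT.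
rewrite normrM (ger0_norm (expR_ge0 _)) ler_pM ?expR_ge0// ler_expR.
apply: le_trans (ler_norm _) _; rewrite normrM ler_pM//.
by rewrite ler0_norm ?subr_le0// opprB.
Qed.

Let weightp_le N j w : `|weightp N j w| <= K + C1 * expR (kk * a).
Proof.
have e0 : 0 <= C1 * expR (kk * a) by apply: mulr_ge0 => //; exact: expR_ge0.
have [a0'|a0'] := eqVneq (act N j w) 0.
  by rewrite /weightp a0' mul0r normr0 addr_ge0.
apply: weight_aux => //.
have [h1 h2 ->] := level_stopped a0'.
case: ifPn => Mt.
  apply: (@le_trans _ _ K); last by rewrite lerDl.
  rewrite normrM (ger0_norm (expR_ge0 _)) -[leRHS]mulr1 ler_pM ?expR_ge0//.
  rewrite -expR0 ler_expR mulr_ge0_le0// subr_le0 (le_trans _ Mt)//.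
  by apply: le_running_max => //; rewrite grid_ge0// lexx.
apply: (@le_trans _ _ (C1 * expR (kk * a))); last by rewrite lerDr.
apply: fall_exp => //; first by rewrite lerDl.
exact: coefp_le.
Qed.

Let weightm_le N j w : `|weightm N j w| <= K + C1 * expR (kk * a).
Proof.
have e0 : 0 <= C1 * expR (kk * a) by apply: mulr_ge0 => //; exact: expR_ge0.
have [a0'|a0'] := eqVneq (act N j w) 0.
  by rewrite /weightm a0' mul0r normr0 addr_ge0.
apply: weight_aux => //.
have [h1 h2 ->] := level_stopped a0'.
case: ifPn => Mt; first by rewrite normr0 addr_ge0.
apply: (@le_trans _ _ (C1 * expR (kk * a))); last by rewrite lerDr.
apply: fall_exp => //; first by rewrite lerDr.
exact: coefm_le.
Qed.

Let mart beta N j w :=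
  expR ((beta * sigma) * (W (grid t N j.+1) w - W (grid t N j) w : R) -
     (beta * sigma) ^+ 2 * (grid t N j.+1 - grid t N j) / 2) - 1.

(** By the equation [mu * beta + (beta * sigma) ^+ 2 / 2 = l], one step multiplies the discounted
    exponential by exactly [mart + 1]. *)
Let frozen_term N j w :
  act N j w * (expR (- (l * grid t N j.+1)) * value bp bm b c G f a X w k (grid t N j) (grid t N j.+1)
    - dval w k (grid t N j)) =
  weightp N j w * mart bp N j w + weightm N j w * mart bm N j w.
Proof.
have [a0'|a0'] := eqVneq (act N j w) 0; first by rewrite /weightp /weightm a0' !mul0r addr0.
have [_ _ E] := level_stopped a0'.
have shift beta m : mu * beta + (beta * sigma) ^+ 2 / 2 = l ->
    expR (- (l * grid t N j.+1)) * expR (beta * (X (grid t N j.+1) w - m)) =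
    expR (- (l * grid t N j)) * expR (beta * (X (grid t N j) w - m)) * (mart beta N j w + 1).
  by move=> hb; rewrite /mart subrK -!expRD; congr expR; rewrite -hb /drifted; field.
rewrite /weightp /weightm. rewrite E /dvalue /value; case: ifPn => _.
  have := shift bp (level a X w k) hbp; set e1 := expR (- _); set e2 := expR (bp * _).
  set e3 := expR (- _); set e4 := expR (bp * _) => h.
  have -> : e1 * (G (level a X w k) * e2) = G (level a X w k) * (e1 * e2) by ring.
  rewrite h; ring.
have := shift bp (M (grid t N j) w) hbp; have := shift bm (M (grid t N j) w) hbm.
rewrite /fall; set e1 := expR (- _); set e2 := expR (bm * _).
set e3 := expR (- _); set e4 := expR (bm * _); set e5 := expR (bp * _); set e6 := expR (bp * _) => h1 h2.
set cp := coefP _; set cm := coefM _.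
have -> : e1 * (cp * e5 + cm * e2) = cp * (e1 * e5) + cm * (e1 * e2) by ring.
rewrite h1 h2; ring.
Qed.

Let frozen_term_martingale N j :
  P.-integrable setT (fun w => (weightp N j w * mart bp N j w + weightm N j w * mart bm N j w)%:E) /\
  (\int[P]_w (weightp N j w * mart bp N j w + weightm N j w * mart bm N j w)%:E = 0)%E.
Proof.
have g0 : 0 <= grid t N j by exact: grid_ge0.
have gS := grid_ltS N j t0.
have [Ip Ep] := exp_martingale hW (bp * sigma) g0 gS (@past_weightp N j) (@weightp_le N j).
have [Im Em] := exp_martingale hW (bm * sigma) g0 gS (@past_weightm N j) (@weightm_le N j).
split; first exact: (integrableD measurableT Ip Im).
under eq_integral do rewrite EFinD.
rewrite integralD//.
by rewrite -[0%E]add0e; congr (_ + _)%E; [exact: Ep|exact: Em].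
Qed.

Lemma frozen_sum_martingale N :
  P.-integrable setT (fun w => (frozen_sum bp bm b c G f l a X w k t N)%:E) /\
  (\int[P]_w (frozen_sum bp bm b c G f l a X w k t N)%:E = 0)%E.
Proof.
pose h j w := (weightp N j w * mart bp N j w + weightm N j w * mart bm N j w)%:E.
have E w : (frozen_sum bp bm b c G f l a X w k t N)%:E = (\sum_(j < N.+1) h j w)%E.
  rewrite /frozen_sum big_mkord -sumEFin; apply: eq_bigr => j _.
  by rewrite /h -frozen_term.
have -> : (fun w => (frozen_sum bp bm b c G f l a X w k t N)%:E) = (fun w => (\sum_(j < N.+1) h j w)%E).
  by apply/funext => w; exact: E.
split.
  by apply: (@integrable_sum _ _ _ P setT measurableT) => j _; exact: (frozen_term_martingale N j).1.
rewrite integral_sum//=; last by move=> j; exact: (frozen_term_martingale N j).1.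
by rewrite big1// => j _; exact: (frozen_term_martingale N j).2.
Qed.

Let Ce := (K + 2 * C1 * kk + 2 * C1 * kk ^+ 2) + (K + (2 * C1 + K) * kk).
Let Ce0 : 0 <= Ce.
Proof.
have C2 : 0 <= 2 * C1 by exact: mulr_ge0.
apply: addr_ge0.
  by apply: addr_ge0; [apply: addr_ge0 => //; exact: mulr_ge0|apply: mulr_ge0 => //; exact: sqr_ge0].
by apply: addr_ge0 => //; apply: mulr_ge0 => //; exact: addr_ge0.
Qed.

(** A bound independent of [N], obtained from the telescoped form rather than term by term: two
    boundary values, and the error sum with the trivial oscillation [2 * B]. *)
Lemma frozen_sum_le N w B : 0 <= B -> (forall u, 0 <= u <= t -> `|X u w| <= B) ->
  `|frozen_sum bp bm b c G f l a X w k t N| <=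
  (2 * (K + 2 * C1) + Ce) * expR ((2 * kk + 4) * B).
Proof.
move=> B0 XB.
have C2 : 0 <= 2 * C1 by exact: mulr_ge0.
have MB s : 0 <= s <= t -> `|M s w| <= B.
  move=> /andP[s0 st]; have [u /andP[u0 us] ->] := running_max_attained (cX w) s0.
  by apply: XB; rewrite u0 (le_trans us).
have [St|tS] := leP (S w) t%:E; last first.
  have -> : frozen_sum bp bm b c G f l a X w k t N = 0.
    rewrite /frozen_sum big_nat_cond big1// => j /andP[/andP[_ jN] _].
    rewrite /active leNgt (_ : (_ < S w)%E) ?mul0r//.
    apply: le_lt_trans tS; rewrite lee_fin -[leRHS](gridN t N).
    by apply: grid_le => //; exact: ltnW.
  rewrite normr0 mulr_ge0 ?expR_ge0// addr_ge0// mulr_ge0// addr_ge0//.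
have LB : `|level a X w k| <= B.
  rewrite /level; apply: MB; rewrite fine_recovery_drawdown_ge0//=.
  have SE := recovery_drawdown_fineK (cX w) a0 (le_lt_trans St (ltry _)).
  by rewrite -lee_fin -SE.
have dB s : 0 <= s <= t -> `|dval w k s| <= (K + 2 * C1) * expR (2 * kk * B).
  move=> st; have /andP[s0 _] := st; rewrite /dvalue normrM (ger0_norm (expR_ge0 _)).
  have := value_bound_sup b c bpm GK fK s0 B0 (MB _ st) (XB _ st) LB => h.
  rewrite -[leRHS]mul1r ler_pM// ?expR_ge0//.
  by rewrite -expR0 ler_expR oppr_le0 mulr_ge0// ltW.
have [i [j [iN jN -> _]]] := frozen_sumE bp bm b c G f l k a0 (cX w) N t0.
have gi i' : (i' <= N.+1)%N -> 0 <= grid t N i' <= t.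
  by move=> iN'; rewrite grid_ge0//= -[leRHS](gridN t N) grid_le.
have h1 := dB _ (gi _ jN); have h2 := dB _ (gi _ iN).
have := error_sum_le bpm GK fK Glip flip Gder k l0 a0 (cX w) (N := N) t0 (o := 2 * B).
have osc : forall u, 0 <= u <= t -> forall v, 0 <= v <= t ->
   `|u - v| <= t / N.+1%:R -> `|X u w - X v w| <= 2 * B.
  move=> u ut v vt _; apply: le_trans (ler_normB _ _) _.
  by have := XB u ut; have := XB v vt; lra.
move=> /(_ osc); rewrite -/Ce => h3.
have e1 : 2 * B <= expR (2 * B) by have := expR_ge1Dx (2 * B); lra.
have e2 : M t w - M 0 w + 1 <= expR (2 * B).
  have := expR_ge1Dx (2 * B); have := MB t; have := MB 0; rewrite !lexx (ltW t0) !ler_norml.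
  by move=> /(_ isT)/andP[? ?] /(_ isT)/andP[? ?]; lra.
(* The factors [2 * B] and [M t w - M 0 w + 1] are each at most [expR (2 * B)], hence the 4 in the
   exponent. *)
have e3 : Ce * (2 * B * expR (kk * (2 * B))) * (M t w - M 0 w + 1) <=
   Ce * expR ((2 * kk + 4) * B).
  rewrite -mulrA ler_wpM2l//.
  have -> : (2 * kk + 4) * B = 2 * B + kk * (2 * B) + 2 * B by ring.
  rewrite !expRD ler_pM//; first by rewrite mulr_ge0 ?mulr_ge0 ?expR_ge0.
    by rewrite addr_ge0// subr_ge0 running_max_mono// ltW.
  by rewrite ler_wpM2r ?expR_ge0.
have e4 : (K + 2 * C1) * expR (2 * kk * B) <= (K + 2 * C1) * expR ((2 * kk + 4) * B).
  by rewrite ler_wpM2l ?addr_ge0// ler_expR ler_wpM2r// lerDl.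
rewrite mulrDl; apply: le_trans (ler_normB _ _) _; apply: lerD; last exact: le_trans h3 e3.
apply: le_trans (ler_normB _ _) _; rewrite -mulrA mulr_natl mulr2n.
by apply: lerD; [exact: le_trans h1 e4|exact: le_trans h2 e4].
Qed.

(** Optional stopping at a fixed horizon: the mesh tends to 0 in sums of mean zero, under a bound
    independent of the mesh. *)
Lemma stopped_value_martingale :
  [/\ measurable_fun setT (fun w => dval w k (capped (S' w) t) - dval w k (capped (S w) t)),
     P.-integrable setT (fun w => (dval w k (capped (S' w) t) - dval w k (capped (S w) t))%:E) &
  (\int[P]_w (dval w k (capped (S' w) t) - dval w k (capped (S w) t))%:E = 0)%E].
Proof.
have kk4 : 0 <= 2 * kk + 4 by rewrite addr_ge0// mulr_ge0.
have [g Ig gX] := exp_sup_integrable hW mu sigma t0 kk4.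
pose Q := 2 * (K + 2 * C1) + Ce.
have Q0 : 0 <= Q by rewrite addr_ge0// mulr_ge0// addr_ge0// mulr_ge0.
have [|||N w|mh ih ch] := @integral_cvg_dominated _ _ _ P
  (fun N w => frozen_sum bp bm b c G f l a X w k t N)
  (fun w => dval w k (capped (S' w) t) - dval w k (capped (S w) t)) (fun w => Q * g w).
- move=> N; apply/measurable_EFinP.
  by have /measurable_int := (frozen_sum_martingale N).1.
- by move=> w; apply: frozen_sum_cvg.
- exact: (integrableZl measurableT Q Ig).
(* [B] is the value of the modulus at a maximizing time, where the dominating function applies. *)
- have caX : path_continuous (fun u => `|X u w|).
    move=> u e u0 e0; have [dl dl0 hd] := cX w u0 e0; exists dl => // v v0 vu.
    by apply: le_lt_trans (hd v v0 vu); exact: ler_dist_dist.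
  have [s st hs] := path_EVT_max caX (ltW t0).
  apply: (le_trans (@frozen_sum_le N w `|X s w| _ hs)) => //.
  by rewrite ler_wpM2l// gX.
split => //; apply: cvg_unique ch _ => //.
rewrite (_ : (fun N => _) = fun=> 0%E); first exact: cvg_cst.
apply/funext => N.
exact: (frozen_sum_martingale N).2.
Qed.

End one_horizon.

Lemma capped_eventually (s : \bar R) : (s < +oo)%E -> (0 <= s)%E ->
  \forall n \near \oo, capped s (n.+1%:R : R) = fine s.
Proof.
case: s => // s _ _; near=> n; rewrite /capped lee_fin.
rewrite (_ : s <= n.+1%:R)// (@le_trans _ _ n%:R) ?ler_nat//.
by near: n; exact: nbhs_infty_ger.
Unshelve. all: by end_near. Qed.

(** [k] fixes the phase, [j] the end at which it is evaluated ([k] or [k.+1]). The value 0 at an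
    infinite time is the limit produced by discounting. *)
Definition final_value j w := if (recovery_drawdown X a j w < +oo)%E then
  dval w k (fine (recovery_drawdown X a j w)) else 0.

(** The horizon tends to infinity under the uniform bound [2 * CV]. When [S] is finite and [S']
    infinite, the value at the horizon is killed by the discount, thanks to [0 < l]. *)
Lemma phase_final_value :
  (\int[P]_w (final_value k.+1 w - final_value k w)%:E = 0)%E.
Proof.
pose CV := K + 2 * C1 * expR (kk * a).
have CV0 : 0 <= CV.
  by apply: addr_ge0 => //; apply: mulr_ge0; [exact: mulr_ge0|exact: expR_ge0].
have n0 n : (0 : R) < n.+1%:R by [].
have Sle w := tau_leS k a0 (cX w).
have S0 w := recovery_drawdown_ge0 (cX w) a0 k.
have S'0 w := recovery_drawdown_ge0 (cX w) a0 k.+1.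
have [|||n w|mh ih ch] := @integral_cvg_dominated _ _ _ P
  (fun n w => dval w k (capped (S' w) n.+1%:R) - dval w k (capped (S w) n.+1%:R))
  (fun w => final_value k.+1 w - final_value k w) (fun w => 2 * CV).
- by move=> n; have [] := stopped_value_martingale (n0 n).
- move=> w; rewrite /final_value.
  have [Sy|] := eqVneq (S w) +oo%E.
    rewrite (recovery_drawdownS_y Sy) Sy ltxx subrr.
    rewrite (_ : (fun n => _) = fun=> 0); first exact: cvg_cst.
    by apply/funext => n; rewrite subrr.
  rewrite -ltey => Sfin; rewrite Sfin.
  have cS : dval w k (capped (S w) n.+1%:R) @[n --> \oo] --> dval w k (fine (S w)).
    apply: (@cvg_trans _ ((fun=> dval w k (fine (S w))) @ \oo)); last exact: cvg_cst.
    apply: near_eq_cvg; near=> n.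
    by rewrite (near (capped_eventually Sfin (S0 w)) n).
  apply: cvgB => //.
  case: ifPn => [S'fin|].
    apply: (@cvg_trans _ ((fun=> dval w k (fine (S' w))) @ \oo)); last exact: cvg_cst.
    apply: near_eq_cvg; near=> n.
    by rewrite (near (capped_eventually S'fin (S'0 w)) n).
  rewrite ltey negbK => /eqP S'y.
  apply/cvgrPdist_le => e e0; near=> n; rewrite sub0r normrN S'y /capped/=.
  have SE := recovery_drawdown_fineK (cX w) a0 Sfin.
  have nS : (S w <= n.+1%:R%:E)%E.
    rewrite SE lee_fin (@le_trans _ _ n%:R) ?ler_nat//.
    by near: n; exact: nbhs_infty_ger.
  have := @dvalue_bound _ _ bp bm b c K G f bpm bp0 GK fK l a X w k a0 (cX w) n.+1%:R (ltW (n0 n)).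
  rewrite S'y leey => /(_ isT nS) => h; apply: (le_trans h); rewrite -/CV.
  (* The threshold comes from [expR (l * n) >= l * n]. *)
  have Qn : CV / (l * e) <= n.+1%:R.
    by rewrite (@le_trans _ _ n%:R) ?ler_nat//; near: n; exact: nbhs_infty_ger.
  rewrite expRN mulrC ler_pdivrMr ?expR_gt0//.
  have ex := expR_ge1Dx (l * n.+1%:R).
  apply: (@le_trans _ _ (e * (l * n.+1%:R))); last by rewrite ler_wpM2l ?(ltW e0)//; lra.
  by move: Qn; rewrite ler_pdivrMr ?mulr_gt0//; lra.
- exact: finite_measure_integrable_cst.
- have [Sn|nS] := leP (S w) n.+1%:R%:E; last first.
    have nS' : (n.+1%:R%:E < S' w)%E by exact: lt_le_trans nS (Sle w).
    rewrite /capped (_ : (S' w <= _)%E = false); last by apply/negbTE; rewrite -ltNge.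
    rewrite (_ : (S w <= _)%E = false); last by apply/negbTE; rewrite -ltNge.
    by rewrite subrr normr0 mulr_ge0.
  have SE := recovery_drawdown_fineK (cX w) a0 (le_lt_trans Sn (ltry _)).
  have bnd s : 0 <= s -> (s%:E <= S' w)%E -> (S w <= s%:E)%E -> `|dval w k s| <= CV.
    move=> s0 sS' Ss; apply: (le_trans (dvalue_bound b c bpm bp0 GK fK l a0 (cX w) s0 sS' Ss)).
    rewrite -/CV -[leRHS]mul1r ler_wpM2r// -expR0 ler_expR oppr_le0 mulr_ge0// ltW//.
  apply: le_trans (ler_normB _ _) _; rewrite mulr_natl mulr2n; apply: lerD; apply: bnd.
  + rewrite /capped; case: ifP => _; [exact: fine_recovery_drawdown_ge0|exact: ltW].
  + rewrite /capped; case: ifPn => [S'n|]; last by rewrite -ltNge => /ltW.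
    by rewrite -(recovery_drawdown_fineK (cX w) a0 (le_lt_trans S'n (ltry _))).
  + rewrite /capped; case: ifPn => [S'n|//].
    by rewrite -(recovery_drawdown_fineK (cX w) a0 (le_lt_trans S'n (ltry _))).
  + by rewrite /capped Sn; exact: fine_recovery_drawdown_ge0.
  + by rewrite /capped Sn -SE.
  + by rewrite /capped Sn -SE.
apply: cvg_unique ch _ => //.
rewrite (_ : (fun n => _) = fun=> 0%E); first exact: cvg_cst.
by apply/funext => n; have [] := stopped_value_martingale (n0 n).
Unshelve. all: by end_near. Qed.

End phase_expectation.

(** * Discounted expectations at the drawdown times *)

Section discounted.
Context {d : measure_display} {T : measurableType d} {R : realType}.
Variables (P : probability T R) (W : R -> {RV P >-> R}).
Hypothesis hW : standard_brownian_motion W.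
Variables (mu sigma a : R).
Hypothesis a0 : 0 < a.
Local Notation Wt := (fun t w => W t w).
Local Notation X := (drifted mu sigma Wt).
Local Notation M t w := (running_max X t w).
Local Notation tau := (recovery_drawdown X a).

Let cX w : path_continuous (X ^~ w). Proof. exact: drifted_path_continuous. Qed.

Definition discounted (l : R) (h : R -> R) k w :=
  if (tau k w < +oo)%E then expR (- (l * fine (tau k w))) * h (max_at_drawdown X a k w)
  else 0.

Lemma measurable_recovery_drawdown_le k t : measurable [set w | (tau k w <= t%:E)%E].
Proof.
have [t0|t0] := leP 0 t.
  have [h _] := past_recovery_drawdown mu sigma hW a0 k t0.
  exact: (past_set_measurable h).
rewrite (_ : [set w | _] = set0)//; apply/seteqP; split => // w /=.
by rewrite leNgt (lt_le_trans _ (recovery_drawdown_ge0 (cX w) a0 k))// lte_fin.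
Qed.

Lemma recovery_drawdown_finE k : [set w | (tau k w < +oo)%E] = \bigcup_n [set w | (tau k w <= n%:R%:E)%E].
Proof.
apply/seteqP; split => w /=; last first.
  by move=> [n _] /= h; exact: le_lt_trans h (ltry _).
move=> /(recovery_drawdown_fineK (cX w) a0) E.
exists (Num.bound (fine (tau k w))) => //=; rewrite E lee_fin ltW//.
exact: (archi_boundP (fine_recovery_drawdown_ge0 (cX w) a0 k)).
Qed.

Lemma measurable_recovery_drawdown_fin k : measurable [set w | (tau k w < +oo)%E].
Proof.
rewrite recovery_drawdown_finE; apply: bigcupT_measurable => n.
exact: measurable_recovery_drawdown_le.
Qed.

Lemma measurable_fine_recovery_drawdown k : measurable_fun setT (fun w => fine (tau k w)).
Proof.
apply: measurable_fun_gt => y; have [y0|y0] := ltP y 0.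
  rewrite (_ : [set w | _] = setT)//; apply/seteqP; split => // w _ /=.
  by apply: (lt_le_trans y0); exact: fine_recovery_drawdown_ge0.
rewrite (_ : [set w | _] = [set w | (tau k w < +oo)%E] `\` [set w | (tau k w <= y%:E)%E]).
  apply: measurableD; first exact: measurable_recovery_drawdown_fin.
  exact: measurable_recovery_drawdown_le.
apply/seteqP; split => w /=.
  have [|] := ltP (tau k w) +oo%E.
    move=> h yt; split => //; rewrite (recovery_drawdown_fineK (cX w) a0 h) lee_fin.
    by apply/negP; rewrite -ltNge.
  by rewrite leye_eq => /eqP ->/=; rewrite ltNge y0.
move=> [h]; rewrite {1}(recovery_drawdown_fineK (cX w) a0 h) lee_fin => /negP.
by rewrite -ltNge.
Qed.

(** Setting the maximum to 0 at an infinite time gives a measurable function that agrees with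
    [max_at_drawdown] wherever [discounted] uses it. *)
Let maxfin k w := if (tau k w < +oo)%E then max_at_drawdown X a k w else 0.

Let measurable_maxfin k : measurable_fun setT (maxfin k).
Proof.
apply: measurable_fun_gt => y.
rewrite (_ : [set w | _] = (\bigcup_n ([set w | (tau k w <= n%:R%:E)%E] `&`
    [set w | y < stopped_max W mu sigma a k n%:R w])) `|`
    (~` [set w | (tau k w < +oo)%E] `&` [set w | y < 0])).
  apply: measurableU; last first.
    apply: measurableI; first by apply: measurableC; exact: measurable_recovery_drawdown_fin.
    have [y0|y0] := boolP (y < 0).
      by have -> : [set w : T | true] = setT by apply/seteqP; split.
    by have -> : [set w : T | false] = set0 by apply/seteqP; split.
  apply: bigcupT_measurable => n; apply: measurableI.
    exact: measurable_recovery_drawdown_le.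
  apply: measurable_gt.
  have [_ h] := past_recovery_drawdown mu sigma hW a0 k (ler0n R n).
  exact: (past_measurableW h).
apply/seteqP; split => w /=; rewrite /maxfin.
  case: ifPn => h yM; last by right; split => //; exact/negP.
  have : [set w | (tau k w < +oo)%E] w by [].
  rewrite recovery_drawdown_finE => -[n _ /= hn]; left; exists n => //; split => //=.
  by rewrite /stopped_max hn.
move=> [[n _ /= [h1 h2]]|[/negP/negbTE -> //]].
by rewrite (le_lt_trans h1 (ltry _)); move: h2; rewrite /stopped_max h1.
Qed.

Lemma discountedE (l : R) (h : R -> R) k w : discounted l h k w =
  \1_[set w | (tau k w < +oo)%E] w * (expR (- (l * fine (tau k w))) * h (maxfin k w)).
Proof.
rewrite /discounted indicE /maxfin; case: ifPn => tk; last first.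
  by rewrite memNset ?mul0r//; exact/negP.
by rewrite mem_set ?mul1r.
Qed.

Lemma measurable_discounted (l : R) (h : R -> R) k : measurable_fun setT h ->
  measurable_fun setT (discounted l h k).
Proof.
move=> mh; rewrite (_ : discounted l h k = (fun w => \1_[set w | (tau k w < +oo)%E] w *
   (expR (- (l * fine (tau k w))) * h (maxfin k w)))); last by apply/funext => w; exact: discountedE.
apply: measurable_funM.
  by apply: measurable_indic; exact: measurable_recovery_drawdown_fin.
apply: measurable_funM; last exact: (measurableT_comp mh (measurable_maxfin k)).
apply: measurableT_comp => //.
apply: measurable_funN; apply: measurable_funM => //; exact: measurable_fine_recovery_drawdown.
Qed.

Lemma discounted_le (l : R) (h : R -> R) k (C : R) w : 0 <= l -> 0 <= C -> (forall m, `|h m| <= C) -> `|discounted l h k w| <= C.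
Proof.
move=> l0 C0 hC; rewrite /discounted; case: ifPn => _; last by rewrite normr0.
rewrite normrM (ger0_norm (expR_ge0 _)) -[leRHS]mul1r ler_pM ?expR_ge0//.
by rewrite -expR0 ler_expR oppr_le0 mulr_ge0// fine_recovery_drawdown_ge0.
Qed.

Lemma integrable_discounted (l : R) (h : R -> R) k (C : R) : 0 <= l -> 0 <= C -> measurable_fun setT h ->
  (forall m, `|h m| <= C) -> P.-integrable setT (EFin \o discounted l h k).
Proof.
move=> l0 C0 mh hC.
apply: (le_integrable measurableT (g := cst C%:E)).
- by apply/measurable_EFinP; exact: measurable_discounted.
- by move=> w _ /=; rewrite lee_fin (ger0_norm C0) discounted_le.
- exact: finite_measure_integrable_cst.
Qed.

Section phase_identity.
Variables (bp bm b c K : R) (G f : R -> R).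
Hypothesis bpm : 0 < bp - bm.
Hypothesis bp0 : 0 <= bp.
Hypothesis GK : forall m, `|G m| <= K.
Hypothesis fK : forall m, `|f m| <= K.
Hypothesis Glip : forall m m', `|G m' - G m| <= K * `|m' - m|.
Hypothesis flip : forall m m', `|f m' - f m| <= K * `|m' - m|.
Hypothesis Gder : forall m m', m <= m' ->
  `|G m' - G m - (b * G m - c * f m) * (m' - m)| <= K * (m' - m) ^+ 2.
Variables (l : R) (k : nat).
Hypothesis l0 : 0 < l.
Hypothesis hbp : mu * bp + (bp * sigma) ^+ 2 / 2 = l.
Hypothesis hbm : mu * bm + (bm * sigma) ^+ 2 / 2 = l.
Hypothesis fall_a : forall m, fall bp bm b c G f m (m - a) = f m.

(** At the end of the phase the path is [a] below its maximum, so [fall_a] returns [f]; at its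
    beginning it is [a] below the level, or at the level when [k = 0], which gives the factor of
    [G]. *)
Lemma phase_identity :
  (\int[P]_w (discounted l f k.+1 w)%:E =
   (if k is 0%N then 1 else expR (- (bp * a)))%:E * \int[P]_w (discounted l G k w)%:E)%E.
Proof.
have K0 : 0 <= K by exact: le_trans (normr_ge0 _) (GK 0).
have mG : measurable_fun setT G.
  by apply: continuous_measurable_fun; exact: lipschitz_real_continuous Glip.
have mf : measurable_fun setT f.
  by apply: continuous_measurable_fun; exact: lipschitz_real_continuous flip.
set q := (if k is 0%N then _ else _).
have E1 w : final_value W bp bm b c G f l a mu sigma k k.+1 w = discounted l f k.+1 w.
  rewrite /final_value /discounted; case: ifPn => // S'fin.
  have [Sy|] := eqVneq (tau k w) +oo%E; first by rewrite recovery_drawdownS_y in S'fin.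
  rewrite -ltey => /(recovery_drawdown_fineK (cX w) a0) SE.
  have [[S'y _]|[s [S's rs Ds Ms _]]] := recovery_drawdownS_spec (cX w) a0 SE.
    by rewrite S'y in S'fin.
  rewrite /dvalue /value /level /max_at_drawdown S's/= leNgt Ms/=.
  by rewrite -[in RHS]fall_a; congr (_ * fall _ _ _ _ _ _ _ _); rewrite -Ds; ring.
have E2 w : final_value W bp bm b c G f l a mu sigma k k w = q * discounted l G k w.
  rewrite /final_value /discounted; case: ifPn => [Sfin|_]; last by rewrite mulr0.
  rewrite /dvalue /value /level /max_at_drawdown lexx [RHS]mulrCA; congr (_ * _).
  rewrite [LHS]mulrC; congr (_ * _); rewrite /q.
  case: k Sfin => [|k'] Sfin.
    by rewrite /recovery_drawdown/= running_max0// subrr mulr0 expR0.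
  have := drawdown_at_recovery_drawdown (cX w) a0 Sfin.
  by move=> DE; rewrite -[in RHS]DE -mulrN opprB.
have := phase_final_value hW bpm bp0 GK fK Glip flip Gder k l0 a0 hbp hbm.
under eq_integral do rewrite E1 E2 EFinB EFinM.
have I1 := integrable_discounted k.+1 (ltW l0) K0 mf fK.
have I2 := integrable_discounted k (ltW l0) K0 mG GK.
rewrite integralB//; last exact: (integrableZl measurableT q I2).
rewrite integralZl//.
have F1 := integrable_fin_num measurableT I1; have F2 := integrable_fin_num measurableT I2.
rewrite -(fineK F1) -(fineK F2) -!EFinM -EFinB => -[] /eqP.
by rewrite subr_eq0 => /eqP ->.
Qed.

End phase_identity.
End discounted.

(** * Gamma tails *)

Section gamma_tail.
Context {R : realType}.
Implicit Types (z : R) (i j : nat).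

Definition poisson_mass i z : R := z ^+ i / i`!%:R * expR (- z).

(** The probability that a Gamma variable of shape [j] and rate 1 exceeds [z], equivalently that a
    Poisson variable of mean [z] is below [j]. *)
Definition gamma_tail j z : R := \sum_(0 <= i < j) poisson_mass i z.

Lemma gamma_tailS j z : gamma_tail j.+1 z = gamma_tail j z + poisson_mass j z.
Proof. by rewrite /gamma_tail big_nat_recr. Qed.

Lemma gamma_tail1 z : gamma_tail 1 z = expR (- z).
Proof. by rewrite gamma_tailS /gamma_tail big_geq// /poisson_mass add0r expr0 fact0 divr1 mul1r. Qed.

Lemma poisson_mass_ge0 i z : 0 <= z -> 0 <= poisson_mass i z.
Proof. by move=> z0; rewrite mulr_ge0 ?expR_ge0// divr_ge0// exprn_ge0. Qed.

Lemma poisson_mass0 i : (0 < i)%N -> poisson_mass i 0 = 0.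
Proof. by case: i => // i _; rewrite /poisson_mass expr0n/= !mul0r. Qed.

Lemma gamma_tail0 j : (0 < j)%N -> gamma_tail j 0 = 1.
Proof.
case: j => // j _; elim: j => [|j IH]; first by rewrite gamma_tail1 oppr0 expR0.
by rewrite gamma_tailS IH poisson_mass0 ?addr0.
Qed.

Let is_derive_expN z : is_derive z 1 (fun z => expR (- z)) (- expR (- z)).
Proof.
have := is_derive1_comp (is_derive_expR (- z)) (is_deriveN (is_derive_id z (1 : R))).
by move=> h; apply: (is_derive_eq h); rewrite mulrN1.
Qed.

Lemma is_derive_poisson_mass i z :
  is_derive z 1 (poisson_mass i.+1) (poisson_mass i z - poisson_mass i.+1 z).
Proof.
have h1 : is_derive z 1 (fun z : R => z ^+ i.+1) (i.+1%:R * z ^+ i).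
  have := is_deriveX i.+1 (is_derive_id z (1 : R)).
  have -> : (fun z : R => z ^+ i.+1) = (@idfun R) ^+ i.+1 by apply/funext => y; rewrite exprfctE.
  by move=> h; apply: (is_derive_eq h); rewrite /GRing.scale/= mulr1.
have h2 := is_deriveM h1 (is_derive_expN z).
have h3 := is_deriveZ (i.+1`!%:R^-1) h2.
have E : poisson_mass i.+1 = (i.+1`!%:R^-1 \*: ((fun z : R => z ^+ i.+1) * (fun z : R => expR (- z)))).
  by apply/funext => y; rewrite /poisson_mass /= mulrAC mulrC.
rewrite [X in is_derive _ _ X _]E; apply: (is_derive_eq h3).
rewrite /poisson_mass /GRing.scale/= factS natrM exprS.
have : (i`!%:R : R) != 0 by rewrite pnatr_eq0 -lt0n fact_gt0.
have : (i.+1%:R : R) != 0 by rewrite pnatr_eq0.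
move: (i.+1%:R) (i`!%:R) (z ^+ i) (expR (- z)) => n p zi e n0 p0.
by field; rewrite n0 p0.
Qed.

(** The derivatives of the Poisson masses telescope, leaving minus the Gamma density of shape
    [j + 1]. *)
Lemma is_derive_gamma_tail j z : is_derive z 1 (gamma_tail j.+1) (- poisson_mass j z).
Proof.
elim: j => [|j IH].
  have -> : gamma_tail 1 = (fun z => expR (- z)) by apply/funext => y; exact: gamma_tail1.
  apply: (is_derive_eq (is_derive_expN z)).
  by rewrite /poisson_mass expr0 fact0 divr1 mul1r.
have -> : gamma_tail j.+2 = gamma_tail j.+1 + poisson_mass j.+1.
  by apply/funext => y; rewrite gamma_tailS.
by apply: (is_derive_eq (is_deriveD IH (is_derive_poisson_mass j z))); lra.
Qed.

Lemma gamma_tail_MVT j u v : 0 <= u -> u <= v ->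
  exists2 s, u <= s <= v & gamma_tail j.+1 v - gamma_tail j.+1 u = - poisson_mass j s * (v - u).
Proof.
move=> u0 uv.
have [||s] := @MVT_segment R (gamma_tail j.+1) (fun s => - poisson_mass j s) u v uv.
- by move=> s _; exact: is_derive_gamma_tail.
- apply: continuous_subspaceT => s; apply: differentiable_continuous.
  apply/derivable1_diffP.
  by have [] := is_derive_gamma_tail j s.
by rewrite in_itv/= => h E; exists s.
Qed.

Lemma gamma_tail_ge0 j z : 0 <= z -> 0 <= gamma_tail j z.
Proof. by move=> z0; apply: sumr_ge0 => i _; exact: poisson_mass_ge0. Qed.

Lemma gamma_tail_le1 j z : 0 <= z -> gamma_tail j z <= 1.
Proof.
move=> z0; case: j => [|j]; first by rewrite /gamma_tail big_geq.
have [s /andP[s0 sz] E] := gamma_tail_MVT j (lexx 0) z0.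
have := poisson_mass_ge0 j s0; rewrite gamma_tail0// in E; nra.
Qed.

Lemma poisson_mass_le1 i z : 0 <= z -> poisson_mass i z <= 1.
Proof.
move=> z0; apply: le_trans (gamma_tail_le1 i.+1 z0).
by rewrite gamma_tailS lerDr gamma_tail_ge0.
Qed.

Lemma gamma_tail_lip j u v : 0 <= u -> 0 <= v -> (0 < j)%N ->
  `|gamma_tail j v - gamma_tail j u| <= `|v - u|.
Proof.
case: j => // j u0 v0 _; wlog uv : u v u0 v0 / u <= v => [h|].
  have [|/ltW] := leP u v; first exact: h.
  by move=> vu; rewrite distrC [leRHS]distrC; exact: h.
have [s /andP[us sv] ->] := gamma_tail_MVT j u0 uv.
have s0 := le_trans u0 us.
rewrite normrM normrN -[leRHS]mul1r ler_wpM2r// ger0_norm ?poisson_mass_le1//.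
exact: poisson_mass_ge0.
Qed.

(** A mass is the difference of two consecutive tails, each 1-Lipschitz; hence the 2. *)
Lemma poisson_mass_lip j u v : 0 <= u -> 0 <= v -> (0 < j)%N ->
  `|poisson_mass j v - poisson_mass j u| <= 2 * `|v - u|.
Proof.
move=> u0 v0 j0.
have E z : poisson_mass j z = gamma_tail j.+1 z - gamma_tail j z.
  by rewrite gamma_tailS addrC addKr.
have -> : poisson_mass j v - poisson_mass j u =
  (gamma_tail j.+1 v - gamma_tail j.+1 u) - (gamma_tail j v - gamma_tail j u).
  by rewrite !E; ring.
apply: le_trans (ler_normB _ _) _.
have := gamma_tail_lip u0 v0 j0; have := gamma_tail_lip u0 v0 (ltn0Sn j); lra.
Qed.

(** The mean value theorem gives the mass at an intermediate point, which the Lipschitz bound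
    compares with the mass at [u]. Both orders of [u] and [v] are needed, as the argument decreases
    when the maximum grows. *)
Lemma gamma_tail_taylor j u v : 0 <= u -> 0 <= v -> (0 < j)%N ->
  `|gamma_tail j.+1 v - gamma_tail j.+1 u + poisson_mass j u * (v - u)| <= 2 * (v - u) ^+ 2.
Proof.
move=> u0 v0 j0.
have [s [s0 su E]] : exists s, [/\ 0 <= s, `|s - u| <= `|v - u| &
    gamma_tail j.+1 v - gamma_tail j.+1 u = - poisson_mass j s * (v - u)].
  have [uv|vu] := leP u v.
    have [s /andP[us sv] E] := gamma_tail_MVT j u0 uv.
    by exists s; split => //; [exact: le_trans us|rewrite !ger0_norm ?subr_ge0// lerD2r].
  have [s /andP[us sv] E] := gamma_tail_MVT j v0 (ltW vu).
  exists s; split => //; [exact: le_trans us| |by rewrite -opprB E; ring].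
  by rewrite !ler0_norm ?subr_le0 ?(ltW vu)// lerN2 lerD2r.
have -> : gamma_tail j.+1 v - gamma_tail j.+1 u + poisson_mass j u * (v - u) =
  - (poisson_mass j s - poisson_mass j u) * (v - u) by rewrite E; ring.
rewrite normrM normrN -(real_normK (num_real (v - u))) expr2 mulrA ler_wpM2r//.
apply: le_trans (poisson_mass_lip u0 s0 j0) _; lra.
Qed.

Section tail_of_max.
Variables (b x : R).
Hypothesis b0 : 0 < b.

(* P(m + Y > x) for a Gamma(j, b) variable Y. *)
Definition max_tail j m := gamma_tail j (b * Num.max (x - m) 0).

Let arg m := b * Num.max (x - m) 0.
Let arg_ge0 m : 0 <= arg m.
Proof. by rewrite mulr_ge0 ?(ltW b0)// le_max lexx orbT. Qed.

Let arg_lip m m' : `|arg m' - arg m| <= b * `|m' - m|.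
Proof.
rewrite -mulrBr normrM (gtr0_norm b0) ler_wpM2l ?(ltW b0)//.
have := ler_norm (m' - m); have := ler_norm (- (m' - m)); rewrite normrN => h1 h2.
rewrite ler_norml /Num.max.
by case: (ltP (x - m') 0) => ?; case: (ltP (x - m) 0) => ?; apply/andP; split; lra.
Qed.

Lemma max_tail_bound j m : `|max_tail j m| <= 1.
Proof. by rewrite ger0_norm; [exact: (gamma_tail_le1 j (arg_ge0 m))|exact: (gamma_tail_ge0 j (arg_ge0 m))]. Qed.

Lemma max_tail_lip j m m' : (0 < j)%N -> `|max_tail j m' - max_tail j m| <= b * `|m' - m|.
Proof.
move=> j0; apply: le_trans (arg_lip m m').
exact: (gamma_tail_lip (arg_ge0 m) (arg_ge0 m') j0).
Qed.

(** The equation [G' = b * (G - F)] for tails [G], [F] of consecutive shapes, with quadratic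
    remainder. The cut at [x] creates no kink in [G], because the mass of positive index vanishes at
    0. *)
Lemma max_tail_der j m m' : (0 < j)%N -> m <= m' ->
  `|max_tail j.+1 m' - max_tail j.+1 m - b * (max_tail j.+1 m - max_tail j m) * (m' - m)| <=
  2 * b ^+ 2 * (m' - m) ^+ 2.
Proof.
move=> j0 mm'; have PE : max_tail j.+1 m - max_tail j m = poisson_mass j (arg m).
  by rewrite /max_tail gamma_tailS addrC addKr.
rewrite PE; have T := gamma_tail_taylor (arg_ge0 m) (arg_ge0 m') j0.
have L := poisson_mass_lip (lexx 0) (arg_ge0 m) j0.
rewrite poisson_mass0// !subr0 in L.
rewrite (ger0_norm (poisson_mass_ge0 _ (arg_ge0 m))) (ger0_norm (arg_ge0 m)) in L.
have p0 := poisson_mass_ge0 j (arg_ge0 m).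
have [xm|mx] := leP x m.
  have z0 : arg m = 0 by rewrite /arg max_r ?mulr0// subr_le0.
  have z0' : arg m' = 0 by rewrite /arg max_r ?mulr0// subr_le0 (le_trans xm).
  rewrite /max_tail -!/(arg _) z0 z0' poisson_mass0// !subrr mulr0 mul0r subrr normr0.
  by rewrite mulr_ge0 ?sqr_ge0// mulr_ge0// sqr_ge0.
have zm : arg m = b * (x - m) by rewrite /arg max_l// subr_ge0 ltW.
have [m'x|xm'] := leP m' x.
  have zm' : arg m' = b * (x - m') by rewrite /arg max_l// subr_ge0.
  have zz : arg m' - arg m = - (b * (m' - m)) by rewrite zm zm'; ring.
  rewrite zz in T; apply: le_trans (_ : _ <= 2 * (- (b * (m' - m))) ^+ 2) _; last first.
    by rewrite le_eqVlt; apply/orP; left; apply/eqP; ring.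
  by move: T; rewrite mulrN [poisson_mass _ _ * _]mulrCA mulrA.
have zm' : arg m' = 0 by rewrite /arg max_r ?mulr0// subr_le0 ltW.
rewrite zm' sub0r in T.
rewrite /max_tail -!/(arg _) zm'.
set p := poisson_mass j (arg m) in T L p0 *.
(* Here [x] lies between [m] and [m']. The Taylor remainder covers the part up to [x]; the excess
   beyond [x] is multiplied by [p], which is at most [2 * arg m] by [L]. *)
have -> : gamma_tail j.+1 0 - gamma_tail j.+1 (arg m) - b * p * (m' - m) =
  (gamma_tail j.+1 0 - gamma_tail j.+1 (arg m) + p * - arg m) - p * (b * (m' - x)).
  by rewrite zm; ring.
apply: le_trans (ler_normB _ _) _.
apply: le_trans (lerD T (lexx _)) _.
rewrite (ger0_norm (mulr_ge0 p0 _)); last by rewrite mulr_ge0 ?(ltW b0)// subr_ge0 ltW.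
apply: (@le_trans _ _ (2 * (- arg m) ^+ 2 + 2 * arg m * (b * (m' - x)))).
  rewrite lerD2l ler_wpM2r// mulr_ge0 ?(ltW b0)// subr_ge0 ltW//.
have -> : 2 * (- arg m) ^+ 2 + 2 * arg m * (b * (m' - x)) = 2 * b ^+ 2 * ((x - m) * (m' - m)).
  by rewrite zm; ring.
rewrite ler_wpM2l//; first by rewrite mulr_ge0// sqr_ge0.
by rewrite expr2 ler_wpM2r ?subr_ge0// lerD2r ltW.
Qed.

End tail_of_max.
End gamma_tail.

(** * Evaluation of the Laplace transforms *)

Section constants.
Context {R : realType}.
Variables (mu sigma a l : R).
Hypothesis sigma0 : 0 < sigma.
Hypothesis a0 : 0 < a.
Hypothesis l0 : 0 < l.
Local Notation bp := (betap mu sigma l).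
Local Notation bm := (betam mu sigma l).
Local Notation b := (b_frac mu sigma a l).
Local Notation c := (c_frac mu sigma a l).

Let s := Num.sqrt (mu ^+ 2 + 2 * l * sigma ^+ 2).

Let sgt : `|mu| < s.
Proof.
rewrite -sqrtr_sqr ltr_sqrt; first by rewrite ltrDl !mulr_gt0.
by rewrite ltr_wpDl ?sqr_ge0// !mulr_gt0.
Qed.

Let s2 : s ^+ 2 = mu ^+ 2 + 2 * l * sigma ^+ 2.
Proof. by rewrite sqr_sqrtr// addr_ge0 ?sqr_ge0// !mulr_ge0// ltW. Qed.

Lemma betap_gt0 : 0 < bp.
Proof.
rewrite divr_gt0 ?exprn_gt0//; have := ler_norm mu; have := sgt; rewrite /s; lra.
Qed.

Lemma betam_lt0 : bm < 0.
Proof.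
rewrite pmulr_llt0 ?invr_gt0 ?exprn_gt0//.
have := ler_norm (- mu); rewrite normrN; have := sgt; rewrite /s; lra.
Qed.

Let sigman0 : sigma != 0. Proof. by rewrite gt_eqF. Qed.

Lemma betap_root : mu * bp + (bp * sigma) ^+ 2 / 2 = l.
Proof.
have -> : mu * bp + (bp * sigma) ^+ 2 / 2 = (s ^+ 2 - mu ^+ 2) / (2 * sigma ^+ 2).
  by rewrite /betap -/s; field.
by rewrite s2; field.
Qed.

Lemma betam_root : mu * bm + (bm * sigma) ^+ 2 / 2 = l.
Proof.
have -> : mu * bm + (bm * sigma) ^+ 2 / 2 = (s ^+ 2 - mu ^+ 2) / (2 * sigma ^+ 2).
  by rewrite /betam -/s; field.
by rewrite s2; field.
Qed.

Lemma beta_diff_gt0 : 0 < bp - bm.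
Proof. by rewrite subr_gt0 (lt_trans betam_lt0 betap_gt0). Qed.

Let den : 0 < expR (- bm * a) - expR (- bp * a).
Proof.
by rewrite subr_gt0 ltr_expR !mulNr ltrN2 ltr_pM2r// -subr_gt0 beta_diff_gt0.
Qed.

Lemma b_frac_gt0 : 0 < b.
Proof.
rewrite divr_gt0// subr_gt0; apply: (@lt_trans _ _ 0).
  by rewrite pmulr_llt0 ?expR_gt0// betam_lt0.
by rewrite mulr_gt0 ?expR_gt0// betap_gt0.
Qed.

Lemma c_frac_gt0 : 0 < c.
Proof. by rewrite divr_gt0// beta_diff_gt0. Qed.

(** The origin of both constants: [b_frac] is the number for which the coefficient of [G m] vanishes
    at [y = m - a], and [c_frac] the one for which the coefficient of [f m] is 1. *)
Lemma fall_drawdown (G f : R -> R) m : fall bp bm b c G f m (m - a) = f m.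
Proof.
rewrite /fall /coefp /coefm /b_frac /c_frac.
have -> : bp * (m - a - m) = - bp * a by ring.
have -> : bm * (m - a - m) = - bm * a by ring.
have dn : expR (- bm * a) - expR (- bp * a) != 0 by rewrite gt_eqF.
have bn : bp - bm != 0 by rewrite gt_eqF// beta_diff_gt0.
move: (expR (- bm * a)) (expR (- bp * a)) dn bn => E e dn bn.
by field; rewrite bn dn.
Qed.

End constants.

Section laplace.
Context {d : measure_display} {T : measurableType d} {R : realType}.
Variables (P : probability T R) (W : R -> {RV P >-> R}).
Hypothesis hW : standard_brownian_motion W.
Variables (mu sigma a l : R).
Hypothesis sigma0 : 0 < sigma.
Hypothesis a0 : 0 < a.
Hypothesis l0 : 0 < l.
Local Notation Wt := (fun t w => W t w).
Local Notation X := (drifted mu sigma Wt).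
Local Notation bp := (betap mu sigma l).
Local Notation bm := (betam mu sigma l).
Local Notation b := (b_frac mu sigma a l).
Local Notation c := (c_frac mu sigma a l).
Local Notation disc := (discounted W mu sigma a l).

Let b0 : 0 < b. Proof. exact: b_frac_gt0. Qed.
Let c0 : 0 < c. Proof. exact: c_frac_gt0. Qed.

Lemma measurable_max_tail x j : (0 < j)%N -> measurable_fun setT (max_tail b x j).
Proof.
move=> j0; apply: continuous_measurable_fun.
by apply: (@lipschitz_real_continuous _ _ b) => m m'; exact: max_tail_lip.
Qed.

(** With [f] equal to [b / c] times the tail of shape [j], the expression [b * G - c * f] is the
    derivative of the tail of shape [j + 1], so [phase_identity] applies to this pair. *)
Lemma discounted_max_tail_step x j k : (0 < j)%N ->
  (\int[P]_w (disc (max_tail b x j) k.+1 w)%:E =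
   (c / b * if k is 0%N then 1 else expR (- (bp * a)))%:E *
     \int[P]_w (disc (max_tail b x j.+1) k w)%:E)%E.
Proof.
move=> j0; pose f m := b / c * max_tail b x j m.
pose G := max_tail b x j.+1.
have bc0 : 0 < b / c by rewrite divr_gt0.
(* The sum of all individual bounds, so that a single constant serves every hypothesis. *)
pose K := 1 + b / c + b + b / c * b + 2 * b ^+ 2.
have [K1 K2 K3 [K4 K5]] : [/\ 1 <= K, b / c <= K, b <= K & b / c * b <= K /\ 2 * b ^+ 2 <= K].
  have aux (r y : R) : 0 < r -> 0 < y -> [/\ 1 <= 1 + r + y + r * y + 2 * y ^+ 2,
      r <= 1 + r + y + r * y + 2 * y ^+ 2, y <= 1 + r + y + r * y + 2 * y ^+ 2 &
      r * y <= 1 + r + y + r * y + 2 * y ^+ 2 /\ 2 * y ^+ 2 <= 1 + r + y + r * y + 2 * y ^+ 2].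
    move=> r0 y0; have := mulr_gt0 r0 y0; have := exprn_gt0 2 y0.
    by move=> h1 h2; split; [lra|lra|lra|split; lra].
  exact: aux.
have GK m : `|G m| <= K by apply: le_trans K1; exact: max_tail_bound.
have fK m : `|f m| <= K.
  rewrite /f normrM (gtr0_norm bc0); apply: le_trans K2.
  by rewrite ler_piMr ?(ltW bc0)// max_tail_bound.
have Glip m m' : `|G m' - G m| <= K * `|m' - m|.
  by apply: le_trans (max_tail_lip x b0 m m' (ltn0Sn j)) _; rewrite ler_wpM2r.
have flip m m' : `|f m' - f m| <= K * `|m' - m|.
  rewrite -mulrBr normrM (gtr0_norm bc0).
  apply: (@le_trans _ _ (b / c * (b * `|m' - m|))).
    by rewrite ler_wpM2l ?(ltW bc0)//; exact: max_tail_lip.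
  by rewrite mulrA ler_wpM2r.
have Gder m m' : m <= m' -> `|G m' - G m - (b * G m - c * f m) * (m' - m)| <= K * (m' - m) ^+ 2.
  move=> mm'; have := max_tail_der x b0 j0 mm'.
  have -> : b * (max_tail b x j.+1 m - max_tail b x j m) = b * G m - c * f m.
    by rewrite /f /G; field; rewrite gt_eqF.
  by move=> /le_trans; apply; rewrite ler_wpM2r// sqr_ge0.
have := phase_identity hW a0 (beta_diff_gt0 mu sigma0 l0) (ltW (betap_gt0 mu sigma0 l0))
  GK fK Glip flip Gder k l0 (betap_root mu sigma0 l0) (betam_root mu sigma0 l0)
  (fall_drawdown mu sigma0 a0 l0 G f).
have E w : (disc f k.+1 w)%:E = ((b / c)%:E * (disc (max_tail b x j) k.+1 w)%:E)%E.
  by rewrite -EFinM /discounted; case: ifP => _; rewrite ?mulr0// /f mulrCA.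
under eq_integral do rewrite E.
have I := integrable_discounted hW mu sigma a0 k.+1 (ltW l0) ler01 (measurable_max_tail x j0)
  (max_tail_bound x b0 j).
rewrite integralZl// => h.
have cb : c / b * (b / c) = 1 by field; rewrite !gt_eqF.
by rewrite EFinM -muleA -h muleA -EFinM cb mul1e.
Qed.

(** Each step lowers the phase index and raises the shape, so [j] stays general in the induction. It
    ends at time 0, where the maximum is 0 and the tail is deterministic. *)
Lemma discounted_max_tail x j n : 0 <= x -> (0 < j)%N ->
  (\int[P]_w (disc (max_tail b x j) n.+1 w)%:E =
   ((c / b) ^+ n.+1 * expR (- (bp * a)) ^+ n * gamma_tail (n.+1 + j) (b * x))%:E)%E.
Proof.
move=> x0; elim: n j => [|n IH] j j0; rewrite discounted_max_tail_step//.
  have -> : (\int[P]_w (disc (max_tail b x j.+1) 0 w)%:E = \int[P]_w (cst (gamma_tail j.+1 (b * x))%:E) w)%E.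
    apply: eq_integral => w _; rewrite /discounted /recovery_drawdown/= ltry mulr0 oppr0 expR0 mul1r.
    rewrite /max_at_drawdown/= running_max0; last exact: drifted_path_continuous.
    case: hW => W0 _ _ _.
    by rewrite /drifted W0 !mulr0 addr0 /max_tail subr0 max_l.
  by rewrite integral_cst//= probability_setT mule1 -EFinM !mulr1.
rewrite IH// -EFinM -addSnnS; congr _%:E; rewrite [in RHS]exprS [expR _ ^+ n.+1]exprS; ring.
Qed.

End laplace.

Lemma cvg_to_eq {R : realType} {I : Type} (F : set_system I) (f : I -> R) (u v : R) :
  f i @[i --> F] --> u -> u = v -> f i @[i --> F] --> v.
Proof. by move=> + <-. Qed.

Lemma cvg_harmonic_right {R : realType} : (n.+1%:R^-1 : R) @[n --> \oo] --> (0 : R)^'+.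
Proof.
move=> A /= [e /= e0 hA]; have := near_infty_natSinv_lt (PosNum e0).
apply: filterS => n /= ne; apply: hA => /=; last by rewrite invr_gt0.
by rewrite sub0r normrN gtr0_norm// invr_gt0.
Qed.

(** * The constants as the rate tends to zero *)

Section zero_rate_constants.
Context {R : realType}.
Variables (mu sigma a : R).
Hypothesis sigma0 : 0 < sigma.
Hypothesis a0 : 0 < a.

Let sn0 : sigma ^+ 2 != 0. Proof. by rewrite gt_eqF// exprn_gt0. Qed.

Lemma root_cvg : Num.sqrt (mu ^+ 2 + 2 * l * sigma ^+ 2) @[l --> (0 : R)^'+] --> `|mu|.
Proof.
rewrite -sqrtr_sqr; apply: (cvg_comp (fun l => mu ^+ 2 + 2 * l * sigma ^+ 2) Num.sqrt); last exact: sqrt_continuous.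
have cl : (l : R) @[l --> (0 : R)^'+] --> 0 by apply: cvg_at_right_filter; exact: cvg_id.
apply: cvg_to_eq.
  by apply: cvgD; [exact: cvg_cst|apply: cvgMr_tmp; apply: cvgMl_tmp; exact: cl].
by rewrite mulr0 mul0r addr0.
Qed.

Lemma betap_cvg : betap mu sigma l @[l --> (0 : R)^'+] --> (- mu + `|mu|) / sigma ^+ 2.
Proof. by apply: cvgMr_tmp; apply: cvgD; [exact: cvg_cst|exact: root_cvg]. Qed.

Lemma betam_cvg : betam mu sigma l @[l --> (0 : R)^'+] --> (- mu - `|mu|) / sigma ^+ 2.
Proof. by apply: cvgMr_tmp; apply: cvgB; [exact: cvg_cst|exact: root_cvg]. Qed.

Lemma betap0 : betap mu sigma 0 = (- mu + `|mu|) / sigma ^+ 2.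
Proof. by rewrite /betap mulr0 mul0r addr0 sqrtr_sqr. Qed.

Let exp_cvg (u : R -> R) v : u l @[l --> (0 : R)^'+] --> v ->
  expR (- u l * a) @[l --> (0 : R)^'+] --> expR (- v * a).
Proof.
move=> uv; apply: (cvg_comp (fun l => - u l * a) expR); last exact: continuous_expR.
by apply: cvgMr_tmp; exact: cvgN.
Qed.

(** The limiting denominator is nonzero. One of the limiting roots [p], [m] is 0, according to the
    sign of [mu], which makes the two numerators equal. *)
Lemma frac_cvg_drift : mu != 0 -> exists2 B : R, 0 < B &
  b_frac mu sigma a l @[l --> (0 : R)^'+] --> B /\ c_frac mu sigma a l @[l --> (0 : R)^'+] --> B.
Proof.
move=> mu0; set p := (- mu + `|mu|) / sigma ^+ 2; set m := (- mu - `|mu|) / sigma ^+ 2.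
have Ep := exp_cvg betap_cvg; have Em := exp_cvg betam_cvg.
rewrite -/p in Ep; rewrite -/m in Em.
have m0 : 0 < `|mu| by rewrite normr_gt0.
have mp : m < p by rewrite ltr_pM2r ?invr_gt0 ?exprn_gt0// ltrD2l; lra.
have d0 : 0 < expR (- m * a) - expR (- p * a).
  by rewrite subr_gt0 ltr_expR ltr_pM2r// ltrN2.
have dcvg : (expR (- betam mu sigma l * a) - expR (- betap mu sigma l * a))^-1 @[l --> (0 : R)^'+] -->
    (expR (- m * a) - expR (- p * a))^-1.
  by apply: cvgV; [rewrite gt_eqF|exact: cvgB].
have cc : c_frac mu sigma a l @[l --> (0 : R)^'+] --> (p - m) / (expR (- m * a) - expR (- p * a)).
  by apply: cvgM => //; apply: cvgB; [exact: betap_cvg|exact: betam_cvg].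
have cb : b_frac mu sigma a l @[l --> (0 : R)^'+] -->
    (p * expR (- m * a) - m * expR (- p * a)) / (expR (- m * a) - expR (- p * a)).
  apply: cvgM => //; apply: cvgB; (apply: cvgM; [|by []]); [exact: betap_cvg|exact: betam_cvg].
exists ((p - m) / (expR (- m * a) - expR (- p * a))); first by rewrite divr_gt0// subr_gt0.
split => //; suff <- : p * expR (- m * a) - m * expR (- p * a) = p - m by [].
have [h|h] := leP 0 mu.
  have -> : p = 0 by rewrite /p ger0_norm// addNr mul0r.
  by rewrite mul0r oppr0 mul0r expR0 mulr1.
have -> : m = 0 by rewrite /m ltr0_norm// opprK addNr mul0r.
by rewrite mul0r oppr0 mul0r expR0 mulr1.
Qed.

(** The roots are opposite; with [y = betap * a], [c] is [2 y / (expR y - expR (- y))] over [a],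
    squeezed between [expR (- y) / a] and [expR y / a], and [b] is [c] times the hyperbolic cosine
    of [y]. *)
Lemma frac_cvg_driftless : mu = 0 ->
  b_frac mu sigma a l @[l --> (0 : R)^'+] --> a^-1 /\ c_frac mu sigma a l @[l --> (0 : R)^'+] --> a^-1.
Proof.
move=> mu0; pose y l := betap mu sigma l * a.
have yc : y l @[l --> (0 : R)^'+] --> (0 : R).
  apply: cvg_to_eq; first by apply: cvgMr_tmp; exact: betap_cvg.
  by rewrite mu0 normr0 oppr0 addr0 !mul0r.
have mE l : betam mu sigma l = - betap mu sigma l.
  by rewrite /betam /betap mu0 -mulNr opprD opprK oppr0.
have ey : expR (y l) @[l --> (0 : R)^'+] --> (1 : R).
  by rewrite -expR0; apply: (cvg_comp y expR); [exact: yc|exact: continuous_expR].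
have eNy : expR (- y l) @[l --> (0 : R)^'+] --> (1 : R).
  apply: cvg_to_eq.
    by apply: (cvg_comp (fun l => - y l) expR); [apply: cvgN; exact: yc|exact: continuous_expR].
  by rewrite oppr0 expR0.
have cc : c_frac mu sigma a l @[l --> (0 : R)^'+] --> a^-1.
  apply: (@squeeze_cvgr _ _ _ _ (fun l => a^-1 * expR (- y l)) (fun l => a^-1 * expR (y l))).
  - near=> l.
    have l0 : 0 < l by near: l; exact: nbhs_right_gt.
    have p0 := betap_gt0 mu sigma0 l0.
    have y0 : 0 < y l by rewrite mulr_gt0.
    have -> : c_frac mu sigma a l = a^-1 * (2 * y l / (expR (y l) - expR (- y l))).
      rewrite /c_frac mE opprK mulNr -/(y l).
      have -> : betap mu sigma l + betap mu sigma l = a^-1 * (2 * y l).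
        by rewrite /y; field; rewrite gt_eqF.
      by rewrite [RHS]mulrA.
    have den : 0 < expR (y l) - expR (- y l) by rewrite subr_gt0 ltr_expR; lra.
    have h1 : 2 * y l * expR (- y l) <= expR (y l) - expR (- y l).
      have := ler_wpM2r (expR_ge0 (- y l)) (expR_ge1Dx (2 * y l)).
      rewrite -expRD; have -> : 2 * y l + - y l = y l by ring.
      lra.
    have h2 : expR (y l) - expR (- y l) <= 2 * y l * expR (y l).
      have := ler_wpM2r (expR_ge0 (y l)) (expR_ge1Dx (- (2 * y l))).
      rewrite -expRD; have -> : - (2 * y l) + y l = - y l by ring.
      lra.
    have ee : expR (y l) * expR (- y l) = 1 by rewrite -expRD subrr expR0.
    rewrite !ler_pM2l ?invr_gt0// ler_pdivlMr// ler_pdivrMr//; apply/andP; split.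
      have h3 := ler_wpM2r (expR_ge0 (- y l)) h2.
      by rewrite -[leRHS]mulrA ee mulr1 in h3; rewrite [leLHS]mulrC.
    have h3 := ler_wpM2r (expR_ge0 (y l)) h1.
    by rewrite -[leLHS]mulrA [expR (- _) * _]mulrC ee mulr1 in h3; rewrite [leRHS]mulrC.
  - by apply: cvg_to_eq; [apply: cvgMl_tmp; exact: eNy|rewrite mulr1].
  - by apply: cvg_to_eq; [apply: cvgMl_tmp; exact: ey|rewrite mulr1].
split => //.
have bE l : b_frac mu sigma a l = c_frac mu sigma a l * ((expR (y l) + expR (- y l)) / 2).
  rewrite /b_frac /c_frac !mE !mulNr !opprK -/(y l).
  by move: (expR (y l) - expR (- y l))^-1 => z; field.
under eq_fun do rewrite bE.
have -> : a^-1 = a^-1 * ((1 + 1) / 2) by field; rewrite gt_eqF.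
by apply: cvgM => //; apply: cvgMr_tmp; exact: cvgD.
Unshelve. all: by end_near. Qed.

Lemma frac_cvg : exists2 B : R, 0 < B &
  b_frac mu sigma a l @[l --> (0 : R)^'+] --> B /\ c_frac mu sigma a l @[l --> (0 : R)^'+] --> B.
Proof.
have [mu0|] := eqVneq mu 0; last exact: frac_cvg_drift.
by exists a^-1; [rewrite invr_gt0|exact: frac_cvg_driftless].
Qed.

End zero_rate_constants.

(** * From exponential tails to the indicator *)

Section laplace_indicator.
Context {d : measure_display} {T : measurableType d} {R : realType}.
Variables (P : probability T R) (W : R -> {RV P >-> R}).
Hypothesis hW : standard_brownian_motion W.
Variables (mu sigma a : R).
Hypothesis sigma0 : 0 < sigma.
Hypothesis a0 : 0 < a.
Local Notation disc := (discounted W mu sigma a).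
Local Notation above x := (fun m : R => (x < m)%R%:R).

Lemma measurable_above (x : R) : measurable_fun setT (above x : R -> R).
Proof.
have -> : (above x : R -> R) = \1_(`]x, +oo[%classic).
  by apply/funext => m; rewrite indicE; congr (nat_of_bool _)%:R; apply/idP/idP; rewrite inE/= in_itv/= andbT.
exact: measurable_indic.
Qed.

(* [1_(x < m)] is recovered from the tail function [P(m + Y > x)], [Y] exponential,
   by differentiating in [x]. *)
Let smooth_above b x (e m : R) := (max_tail b (x + e) 1 m - expR (- (b * e)) * max_tail b x 1 m) / (1 - expR (- (b * e))).

(** For [m <= x] the numerator cancels by memorylessness: moving the threshold by [e] multiplies the
    exponential tail by [expR (- (b * e))]. From [x + e] on, both tails are 1. *)
Let smooth_aboveE b x e m : 0 < b -> 0 < e -> (x < m -> x + e <= m) ->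
  smooth_above b x e m = (x < m)%R%:R.
Proof.
move=> b0 e0 h; have be : 0 < b * e by rewrite mulr_gt0.
have e1 : expR (- (b * e)) < 1 by rewrite -expR0 ltr_expR oppr_lt0.
rewrite /smooth_above /max_tail !gamma_tail1.
have [xm|mx] := ltP x m.
  have xem := h xm.
  rewrite !max_r ?subr_le0 ?(ltW xm)// !mulr0 oppr0 expR0 mulr1 divff// gt_eqF// subr_gt0//.
rewrite !max_l ?subr_ge0//; last by rewrite (le_trans mx)// lerDl ltW.
rewrite -expRD (_ : - (b * (x + e - m)) = - (b * e) + - (b * (x - m))) ?subrr ?mul0r//; ring.
Qed.

Let smooth_above_le b x e m : 0 < b -> 0 < e -> `|smooth_above b x e m| <= 1.
Proof.
move=> b0 e0; have be : 0 < b * e by rewrite mulr_gt0.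
have [mx|xm] := leP m x.
  by rewrite smooth_aboveE// ?ltNge ?mx// normr0.
have [xem|mxe] := leP (x + e) m.
  by rewrite smooth_aboveE// xm normr1.
have e1 : expR (- (b * e)) < 1 by rewrite -expR0 ltr_expR oppr_lt0.
have de : 0 < 1 - expR (- (b * e)) by rewrite subr_gt0.
rewrite /smooth_above /max_tail !gamma_tail1.
rewrite [Num.max (x - m) 0]max_r ?subr_le0 ?(ltW xm)// max_l ?subr_ge0 ?(ltW mxe)//.
rewrite mulr0 oppr0 expR0 mulr1 normrM normfV (gtr0_norm de) ler_pdivrMr// mul1r.
have h1 : expR (- (b * e)) <= expR (- (b * (x + e - m))).
  by rewrite ler_expR lerN2 ler_wpM2l ?(ltW b0)//; lra.
have h2 : expR (- (b * (x + e - m))) <= 1.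
  by rewrite -expR0 ler_expR oppr_le0 mulr_ge0 ?(ltW b0)//; lra.
by rewrite ger0_norm ?subr_ge0//; lra.
Qed.

Let smooth_above_cvg b x m : 0 < b ->
  smooth_above b x n.+1%:R^-1 m @[n --> \oo] --> ((x < m)%R%:R : R).
Proof.
move=> b0; apply: (@cvg_trans _ ((fun=> ((x < m)%R%:R : R)) @ \oo)); last exact: cvg_cst.
apply: near_eq_cvg; have [mx|xm] := leP m x.
  by apply: nearW => n; apply/esym; rewrite smooth_aboveE// ?ltNge ?mx.
have mx0 : 0 < m - x by rewrite subr_gt0.
near=> n; have nm : n.+1%:R^-1 < m - x by near: n; exact: (near_infty_natSinv_lt (PosNum mx0)).
by rewrite smooth_aboveE// -?lerBrDl ?(ltW nm)// xm.
Unshelve. all: by end_near. Qed.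

(** The same quotient on the side of the formula: its limit is the tail plus its derivative, and
    subtracting the mass of index [n] lowers the shape by one. *)
Let derivative_cvg b z n : 0 < b -> 0 <= z -> (0 < n)%N ->
  (gamma_tail n.+1 (z + b * i.+1%:R^-1) - expR (- (b * i.+1%:R^-1)) * gamma_tail n.+1 z) /
    (1 - expR (- (b * i.+1%:R^-1))) @[i --> \oo] --> (gamma_tail n z : R).
Proof.
move=> b0 z0 n0; pose y i : R := b * i.+1%:R^-1.
have yc : y i @[i --> \oo] --> (0 : R).
  have ic : (i.+1%:R^-1 : R) @[i --> \oo] --> (0 : R).
    by apply: cvg_trans cvg_harmonic_right _; exact: cvg_within.
  by apply: cvg_to_eq; [apply: cvgMl_tmp; exact: ic|rewrite mulr0].
have ey : expR (y i) @[i --> \oo] --> (1 : R).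
  by rewrite -expR0; apply: (cvg_comp y expR); [exact: yc|exact: continuous_expR].
have ebound : 2 * (expR (y i) - 1) + 2 * (y i * expR (y i)) @[i --> \oo] --> (0 : R).
  apply: cvg_to_eq.
    apply: cvgD; apply: cvgMl_tmp; last by apply: cvgM; [exact: yc|exact: ey].
    by apply: cvgB; [exact: ey|exact: cvg_cst].
  by rewrite subrr mul0r mulr0 addr0.
apply/subr_cvg0; apply: (@squeeze_cvgr _ _ _ _ (fun i => - (2 * (expR (y i) - 1) + 2 * (y i * expR (y i))))
  (fun i => 2 * (expR (y i) - 1) + 2 * (y i * expR (y i)))).
- apply: nearW => i; rewrite -ler_norml -/(y i).
  have y0 : 0 < y i by rewrite mulr_gt0// invr_gt0.
  set e := expR (- y i).
  have e1 : e < 1 by rewrite -expR0 ltr_expR oppr_lt0.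
  have de : 0 < 1 - e by rewrite subr_gt0.
  (* The ratio of increment to denominator, squeezed between 1 and [expR (y i)]. *)
  pose rho := y i / (1 - e).
  have r1 : 1 <= rho.
    by rewrite ler_pdivlMr// mul1r; have := expR_ge1Dx (- y i); rewrite -/e; lra.
  have r2 : rho <= expR (y i).
    rewrite ler_pdivrMr// mulrBr mulr1 -expRD subrr expR0.
    by have := expR_ge1Dx (y i); lra.
  have yz : 0 <= z + y i by rewrite addr_ge0// ltW.
  have Tl := gamma_tail_taylor z0 yz n0.
  have zz : z + y i - z = y i by ring.
  rewrite zz in Tl.
  have p0 := poisson_mass_ge0 n z0; have p1 := poisson_mass_le1 n z0.
  set q := poisson_mass n z in Tl p0 p1.
  set D := gamma_tail n.+1 (z + y i) - gamma_tail n.+1 z in Tl.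
  have -> : (gamma_tail n.+1 (z + y i) - e * gamma_tail n.+1 z) / (1 - e) - gamma_tail n z =
     q * (1 - rho) + (D + q * y i) / (1 - e).
    have -> : gamma_tail n z = gamma_tail n.+1 z - q by rewrite gamma_tailS addrK.
    by rewrite /D /rho; field; rewrite gt_eqF.
  apply: le_trans (ler_normD _ _) _; apply: lerD.
    rewrite normrM (ger0_norm p0) ler0_norm ?subr_le0// opprB.
    have : q * (rho - 1) <= 1 * (rho - 1) by rewrite ler_wpM2r// subr_ge0.
    lra.
  rewrite normrM normfV (gtr0_norm de).
  apply: (@le_trans _ _ (2 * y i ^+ 2 / (1 - e))); first by rewrite ler_pM2r// invr_gt0.
  have -> : 2 * y i ^+ 2 / (1 - e) = 2 * (y i * rho) by rewrite /rho; ring.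
  by rewrite ler_wpM2l// ler_wpM2l// ltW.
- by apply: cvg_to_eq; [apply: cvgN; exact: ebound|rewrite oppr0].
- exact: ebound.
Qed.

(** The recursion is used with shape 1, which gives a tail of shape [n + 2]; the differentiation
    brings it back to [n + 1]. Both limits follow the same sequence of increments, with domination
    by 1. *)
Lemma laplace_drawdown_gt0 (l x : R) n : 0 < l -> 0 <= x ->
  (\int[P]_w (disc l (above x) n.+1 w)%:E =
   ((c_frac mu sigma a l / b_frac mu sigma a l) ^+ n.+1 * expR (- (betap mu sigma l * a)) ^+ n *
     gamma_tail n.+1 (b_frac mu sigma a l * x))%:E)%E.
Proof.
move=> l0 x0; set b := b_frac mu sigma a l; set c := c_frac mu sigma a l.
have b0 : 0 < b by exact: b_frac_gt0.
set A := (c / b) ^+ n.+1 * _ ^+ n.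
pose h i m := smooth_above b x i.+1%:R^-1 m.
have hn i : 0 < i.+1%:R^-1 :> R by rewrite invr_gt0.
have mt y : measurable_fun setT (max_tail b y 1) by exact: measurable_max_tail.
have mh i : measurable_fun setT (h i).
  apply: measurable_funM => //; apply: measurable_funB => //; exact: measurable_funM.
have Ih y : P.-integrable setT (EFin \o disc l (max_tail b y 1) n.+1).
  apply: (integrable_discounted hW mu sigma a0 n.+1 (ltW l0) ler01) => // m.
  exact: max_tail_bound.
have E i : (\int[P]_w (disc l (h i) n.+1 w)%:E =
   (A * ((gamma_tail n.+2 (b * x + b * i.+1%:R^-1) - expR (- (b * i.+1%:R^-1)) * gamma_tail n.+2 (b * x)) /
    (1 - expR (- (b * i.+1%:R^-1)))))%:E)%E.
  set y := i.+1%:R^-1; set k := (1 - expR (- (b * y)))^-1.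
  have -> : (\int[P]_w (disc l (h i) n.+1 w)%:E = \int[P]_w (k%:E * ((disc l (max_tail b (x + y) 1) n.+1 w)%:E
      - (expR (- (b * y)))%:E * (disc l (max_tail b x 1) n.+1 w)%:E)))%E.
    apply: eq_integral => w _.
    transitivity ((k * (disc l (max_tail b (x + y) 1) n.+1 w -
      expR (- (b * y)) * disc l (max_tail b x 1) n.+1 w))%:E); last by [].
    congr _%:E.
    rewrite /discounted; case: ifP => _; last by rewrite mulr0 subrr mulr0.
    by rewrite /h /smooth_above -/y -/k; ring.
  have I1 : P.-integrable setT (fun w => (disc l (max_tail b (x + y) 1) n.+1 w)%:E) by exact: Ih.
  have I2 : P.-integrable setT (fun w => (disc l (max_tail b x 1) n.+1 w)%:E) by exact: Ih.
  rewrite integralZl//; last exact: (integrableB measurableT (Ih _) (integrableZl measurableT _ (Ih _))).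
  rewrite integralB//; last exact: (integrableZl measurableT _ (Ih _)).
  have DT z : 0 <= z -> (\int[P]_w (disc l (max_tail b z 1) n.+1 w)%:E =
      (A * gamma_tail n.+2 (b * z))%:E)%E.
    by move=> z0; have := discounted_max_tail hW mu sigma0 a0 l0 n z0 (ltn0Sn 0); rewrite addn1.
  have y0 : 0 <= x + y by exact: addr_ge0 x0 (ltW (hn i)).
  rewrite integralZl//.
  rewrite (DT _ y0) (DT _ x0).
  transitivity ((k * (A * gamma_tail n.+2 (b * (x + y)) -
    expR (- (b * y)) * (A * gamma_tail n.+2 (b * x))))%:E); first by [].
  by congr _%:E; rewrite (mulrDr b) /k; ring.
have [|||i w|_ _] := @integral_cvg_dominated _ _ _ P (fun i w => disc l (h i) n.+1 w)
  (disc l (above x) n.+1) (cst 1).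
- by move=> i; exact: measurable_discounted.
- move=> w; rewrite /discounted; case: ifP => _; last exact: cvg_cst.
  by apply: cvgMl_tmp; exact: smooth_above_cvg.
- exact: finite_measure_integrable_cst.
- by apply: discounted_le; rewrite ?(ltW l0)// => m; exact: smooth_above_le.
move=> ch; suff h2 : (\int[P]_w (disc l (h i) n.+1 w)%:E)%E @[i --> \oo] -->
  (A * gamma_tail n.+1 (b * x))%:E by exact: (cvg_unique _ ch h2).
rewrite (eq_cvg _ _ E).
apply: cvg_EFin; first exact: nearW.
by apply: cvgMl_tmp; apply: derivative_cvg => //; rewrite mulr_ge0// ltW.
Qed.

(** For [l = 0] the rates [1 / (i + 1)] are used, with domination by 1. Both constants tend to the
    same [B > 0], so every factor of the formula passes to the limit. *)
Lemma laplace_drawdown (l x : R) n : 0 <= l -> 0 <= x ->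
  (\int[P]_w (disc l (above x) n.+1 w)%:E =
   ((c_const mu sigma a l / b_const mu sigma a l) ^+ n.+1 * expR (- (betap mu sigma l * a)) ^+ n *
     gamma_tail n.+1 (b_const mu sigma a l * x))%:E)%E.
Proof.
move=> l0 x0; rewrite /c_const /b_const; have [{l0}->|ln0] := eqVneq l 0; last first.
  by apply: laplace_drawdown_gt0 => //; rewrite lt_neqAle eq_sym ln0.
have [B B0 [cb cc]] := frac_cvg mu sigma0 a0.
rewrite (cvg_lim _ cb)// (cvg_lim _ cc)//.
pose li (i : nat) : R := i.+1%:R^-1.
have li0 i : 0 < li i by rewrite invr_gt0.
have lic : li i @[i --> \oo] --> (0 : R)^'+ by exact: cvg_harmonic_right.
have [|||i w|_ _] := @integral_cvg_dominated _ _ _ P (fun i w => disc (li i) (above x) n.+1 w)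
  (disc 0 (above x) n.+1) (cst 1).
- by move=> i; apply: measurable_discounted => //; exact: measurable_above.
- move=> w; rewrite /discounted; case: ifP => _; last exact: cvg_cst.
  apply: cvgMr_tmp; apply: (cvg_comp _ expR); last exact: continuous_expR.
  apply: cvgN; apply: cvgMr_tmp; apply: cvg_trans lic _; exact: cvg_within.
- exact: finite_measure_integrable_cst.
- by apply: discounted_le; rewrite ?(ltW (li0 i))// => m; case: (_ < _); rewrite ?normr1 ?normr0.
move=> ch; suff h2 : (\int[P]_w (disc (li i) (above x) n.+1 w)%:E)%E @[i --> \oo] -->
    ((B / B) ^+ n.+1 * expR (- (betap mu sigma 0 * a)) ^+ n * gamma_tail n.+1 (B * x))%:E.
  exact: (cvg_unique _ ch h2).
rewrite (eq_cvg _ _ (fun i => laplace_drawdown_gt0 n (li0 i) x0)).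
apply: cvg_EFin; first exact: nearW.
have cb' : b_frac mu sigma a (li i) @[i --> \oo] --> B by exact: (cvg_comp _ _ lic cb).
have cc' : c_frac mu sigma a (li i) @[i --> \oo] --> B by exact: (cvg_comp _ _ lic cc).
have cp' : betap mu sigma (li i) @[i --> \oo] --> betap mu sigma 0.
  have h : betap mu sigma l @[l --> (0 : R)^'+] --> betap mu sigma 0.
    by rewrite betap0; exact: betap_cvg.
  exact: (cvg_comp _ _ lic h).
apply: cvgM; last first.
  apply: (cvg_comp (fun i => b_frac mu sigma a (li i) * x) (gamma_tail n.+1)); first by apply: cvgMr_tmp; exact: cb'.
  apply: differentiable_continuous; apply/derivable1_diffP.
  by have [] := is_derive_gamma_tail n (B * x).
apply: cvgM.
  apply: (cvg_comp (fun i => c_frac mu sigma a (li i) / b_frac mu sigma a (li i)) (fun z => z ^+ n.+1)).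
    by apply: cvgM; [exact: cc'|apply: cvgV; [rewrite gt_eqF|exact: cb']].
  exact: exprn_continuous.
apply: (cvg_comp (fun i => expR (- (betap mu sigma (li i) * a))) (fun z => z ^+ n)); last exact: exprn_continuous.
apply: (cvg_comp _ expR); last exact: continuous_expR.
by apply: cvgN; apply: cvgMr_tmp; exact: cp'.
Qed.

End laplace_indicator.

Theorem theorem3p1 (d : measure_display) (T : measurableType d) (R : realType)
    (P : probability T R) (W : R -> {RV P >-> R})
    (hW : standard_brownian_motion W)
    (mu sigma a : R) (hsigma : 0 < sigma) (ha : 0 < a)
    (n : nat) (hn : (0 < n)%N) (l x : R) (hl : 0 <= l) (hx : 0 <= x) :
  let X : R -> T -> R := drifted mu sigma (fun t w => W t w) in
  let tau : T -> \bar R := recovery_drawdown X a n in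
  let U : set T :=
    [set w | (tau w < +oo)%E /\ x < max_at_drawdown X a n w] in
  let b := b_const mu sigma a l in
  let c := c_const mu sigma a l in
  ('E_P[fun w => (expR (- l * fine (tau w)) * \1_U w)%R])%E =
  ((c / b) ^+ n * expR (- (n%:R - 1) * betap mu sigma l * a)
   * \sum_(0 <= m < n) ((b * x) ^+ m / m`!%:R * expR (- (b * x))))%:E.
Proof.
move=> X tau U b c; rewrite unlock.
case: n hn @tau @U => // n _ tau U.
have -> : expR (- (n.+1%:R - 1) * betap mu sigma l * a) = expR (- (betap mu sigma l * a)) ^+ n.
  by rewrite -expRM_natl -natr1 addrK; congr expR; ring.
rewrite -(laplace_drawdown hW mu hsigma ha n hl hx).
apply: eq_integral => w _; congr _%:E; rewrite /discounted -/X -/(tau w) indicE.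
(* At an infinite time [fine] is 0 and the exponential is 1; the indicator of [U] makes the product
   vanish. *)
case: ifPn => [tw|/negP tw]; last by rewrite memNset ?mulr0// => -[].
rewrite mulNr; congr (_ * _); congr (nat_of_bool _)%:R.
by apply/idP/idP => [|h]; rewrite inE; [case|split].
Qed.
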